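(* Let $n\in\mathbb{N}$, $n\ge1$. Let $f\in L^1(\mathbb{R}^n)\cap L^2(\mathbb{R}^n)$ be nonnegative, let $\lambda>0$, and let $0<\alpha<2$. Then there exist nonnegative functions $\mu\in L^1(\mathbb{R}^n)\cap L^\infty(\mathbb{R}^n)$ and $u\in H^\alpha(\mathbb{R}^n)\cap L^1(\mathbb{R}^n)$ such that $$f=\mu+(-\Delta)^{\alpha/2}u$$ (almost everywhere), and such that, with $\Omega:=\{x\in\mathbb{R}^n\colon u(x)>0\}$: (1) $\|\mu\|_{L^\infty(\mathbb{R}^n)}\le\lambda$ and $\|\mu\|_{L^1(\mathbb{R}^n)}=\|f\|_{L^1(\mathbb{R}^n)}$; (2) $\mu=\lambda$ almost everywhere on $\Omega$; (3) $|\Omega|\le\frac1\lambda\|f\|_{L^1(\mathbb{R}^n)}$. Moreover, if $\alpha\ge1$, then $u\in H^1(\mathbb{R}^n)$ and $\nabla u=0$ almost everywhere on $\mathbb{R}^n\setminus\Omega$.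
   Context: The Fourier transform is $\widehat f(\xi)=\int_{\mathbb{R}^n}f(x)e^{-2\pi i x\cdot\xi}\,dx$. For $\alpha>0$, $(-\Delta)^{\alpha/2}$ is the Fourier multiplier operator with symbol $(2\pi|\xi|)^\alpha$. $H^\alpha(\mathbb{R}^n)$ is the Sobolev space of $u\in L^2(\mathbb{R}^n)$ such that $(-\Delta)^{\alpha/2}u\in L^2(\mathbb{R}^n)$. $|\Omega|$ denotes Lebesgue measure, and $\nabla u$ is the weak gradient. Functions are identified when equal almost everywhere, and nonnegativity is meant almost everywhere. *)

(* Defs.v *)
From HB Require Import structures.
From mathcomp Require Import all_boot all_order all_algebra.
From mathcomp Require Import all_classical all_reals all_analysis.
From mathcomp.real_closed Require Import complex.
Set Implicit Arguments.
Unset Strict Implicit.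
Unset Printing Implicit Defensive.
Import Order.TTheory GRing.Theory Num.Theory.
Import numFieldNormedType.Exports.
Local Open Scope classical_set_scope.
Local Open Scope ring_scope.

(* R^n is 'rV[R]_n. Its sigma-algebra is the one generated by the coordinates,
   that is, the Borel sigma-algebra. *)
Section measurable_rV.
Context {R : realType} {n : nat}.

Let coors : 'I_n -> 'rV[R]_n -> R := fun i x => x 0 i.

Let rV_set0 : g_sigma_preimage coors set0.
Proof. exact: sigma_algebra0. Qed.

Let rV_setC A : g_sigma_preimage coors A -> g_sigma_preimage coors (~` A).
Proof. exact: sigma_algebraC. Qed.

Let rV_bigcup (F : _^nat) : (forall i, g_sigma_preimage coors (F i)) ->
  g_sigma_preimage coors (\bigcup_i (F i)).
Proof. exact: sigma_algebra_bigcup. Qed.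

HB.instance Definition _ := @isMeasurable.Build default_measure_display
  'rV[R]_n (g_sigma_preimage coors) rV_set0 rV_setC rV_bigcup.

End measurable_rV.

Lemma measurable_coord {R : realType} n (i : 'I_n) :
  measurable_fun [set: 'rV[R]_n] (fun x : 'rV[R]_n => x 0 i).
Proof.
move=> _ Y mY; rewrite setTI; apply: sub_sigma_algebra => /=.
rewrite -bigcup_seq/=; exists i => /=; first by rewrite mem_index_enum.
by exists Y => //; rewrite setTI.
Qed.

Lemma measurable_fun_rVP {R : realType} n d (T : measurableType d) (f : T -> 'rV[R]_n) :
  measurable_fun [set: T] f <->
  forall i, measurable_fun [set: T] (fun t => f t 0 i).
Proof.
split=> [mf i|mf].
  by apply: (@measurableT_comp _ _ _ _ _ _ (fun x : 'rV[R]_n => x 0 i)) => //;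
    exact: measurable_coord.
have sub : g_sigma_preimage (fun (i : 'I_n) t => f t 0 i) `<=` measurable.
  apply: smallest_sub; first exact: sigma_algebra_measurable.
  case: n => [|m] in f mf *; first by rewrite big_ord0.
  rewrite -bigcup_mkord_ord; apply: bigcup_sub => i Ii.
  by move=> A [B mB <-]; exact: mf.
move=> _ A mA; apply: sub.
by rewrite (g_sigma_preimage_comp (fun i (x : 'rV[R]_n) => x 0 i) f); exists A.
Qed.

Section lebesgue_rV.
Context {R : realType}.

Definition consrV n (p : R * 'rV[R]_n) : 'rV[R]_n.+1 :=
  row_mx (p.1%:M : 'rV_1) p.2.

Definition unconsrV n (x : 'rV[R]_n.+1) : R * 'rV[R]_n :=
  (x 0 0, rsubmx (x : 'rV_(1 + n))).

Lemma consrVK n : cancel (@consrV n) (@unconsrV n).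
Proof.
case=> a x; rewrite /unconsrV /consrV/= row_mxKr; congr pair.
rewrite (_ : (0 : 'I_n.+1) = lshift n (0 : 'I_1)); last exact/val_inj.
by rewrite (row_mxEl (a%:M : 'rV_1)) mxE eqxx mulr1n.
Qed.

Lemma unconsrVK n : cancel (@unconsrV n) (@consrV n).
Proof.
move=> x; rewrite /consrV /unconsrV /=.
suff -> : (x 0 0)%:M = lsubmx (x : 'rV_(1 + n)) by exact: (@hsubmxK _ 1 1 n x).
by apply/rowP => i; rewrite !mxE ord1 eqxx mulr1n; congr (x _ _); exact/val_inj.
Qed.

Lemma measurable_consrV n : measurable_fun [set: R * 'rV[R]_n] (@consrV n).
Proof.
apply/measurable_fun_rVP => i.
have [j ->|j ->] := @split_ordP 1 n i.
  under eq_fun => p do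
    rewrite (row_mxEl (p.1%:M : 'rV_1)) mxE ord1 eqxx mulr1n.
  exact: measurable_fst.
under eq_fun => p do rewrite (row_mxEr (p.1%:M : 'rV_1)).
by apply: (measurableT_comp (measurable_coord j)).
Qed.

Lemma measurable_unconsrV n : measurable_fun [set: 'rV[R]_n.+1] (@unconsrV n).
Proof.
apply/measurable_fun_pairP; split => /=.
  exact: measurable_coord.
apply/measurable_fun_rVP => i /=.
under eq_fun do rewrite mxE.
exact: measurable_coord.
Qed.

Section step.
Variables (n : nat)
  (m : {sigma_finite_measure set 'rV[R]_n -> \bar R}).

Definition lebesgue_step : set 'rV[R]_n.+1 -> \bar R :=
  pushforward (@lebesgue_measure R \x m)%E (@consrV n).

Let prod_measure : {measure set (measurableTypeR R * 'rV[R]_n) -> \bar R} :=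
  (@lebesgue_measure R \x m)%E.

Let lebesgue_step0 : lebesgue_step set0 = 0%E.
Proof. exact: (measure0 prod_measure). Qed.

Let lebesgue_step_ge0 A : (0 <= lebesgue_step A)%E.
Proof. exact: (measure_ge0 prod_measure). Qed.

Let lebesgue_step_sigma_additive : semi_sigma_additive lebesgue_step.
Proof.
have mc (A : set 'rV[R]_n.+1) : measurable A ->
    measurable (@consrV n @^-1` A).
  by move=> mA; rewrite -[X in measurable X]setTI; exact: measurable_consrV.
move=> F mF tF mUF; rewrite /lebesgue_step /pushforward preimage_bigcup.
apply: (measure_semi_sigma_additive (s := prod_measure)).
- by move=> k; exact: mc.
- apply/trivIsetP => /= i j _ _ ij; rewrite -preimage_setI.
  by move/trivIsetP : tF => /(_ _ _ _ _ ij) ->//; rewrite preimage_set0.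
- by rewrite -preimage_bigcup; exact: mc.
Qed.

HB.instance Definition _ := isMeasure.Build _ _ _ lebesgue_step
  lebesgue_step0 lebesgue_step_ge0 lebesgue_step_sigma_additive.

Let lebesgue_step_sigma_finite : sigma_finite [set: 'rV[R]_n.+1] lebesgue_step.
Proof.
have /sigma_finiteP[F [TF ndF Foo]] := sigma_finiteT (@lebesgue_measure R).
have /sigma_finiteP[G [TG ndG Goo]] := sigma_finiteT m.
exists (fun k => @unconsrV n @^-1` (F k `*` G k)).
  rewrite -preimage_bigcup [X in _ @^-1` X](_ : _ = setT) ?preimage_setT//.
  rewrite -subTset => -[x y] _.
  have [i _ Fix] : (\bigcup_i F i) x by rewrite -TF.
  have [j _ Gjy] : (\bigcup_i G i) y by rewrite -TG.
  exists (maxn i j) => //; split.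
    by move: x Fix; exact/subsetPset/ndF/leq_maxl.
  by move: y Gjy; exact/subsetPset/ndG/leq_maxr.
move=> k; have [mF Fk] := Foo k; have [mG Gk] := Goo k; split.
  rewrite -[X in measurable X]setTI; apply: measurable_unconsrV => //.
  exact: measurableX.
rewrite /lebesgue_step /pushforward -comp_preimage.
rewrite (_ : _ \o _ = id); last by apply/funext => p /=; rewrite consrVK.
by rewrite preimage_id product_measure1E// lte_mul_pinfty// ge0_fin_numE.
Qed.

HB.instance Definition _ := Measure_isSigmaFinite.Build _ _ _
  lebesgue_step lebesgue_step_sigma_finite.

End step.

(* the n-fold product of the Lebesgue measure of R; see lebesgue_rV_box *)
Fixpoint lebesgue_rV n : {sigma_finite_measure set 'rV[R]_n -> \bar R} :=
  match n with
  | 0 => dirac (0 : 'rV[R]_0)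
  | n'.+1 => lebesgue_step (lebesgue_rV n')
  end.

End lebesgue_rV.

Lemma lebesgue_rV_box {R : realType} n (A : 'I_n -> set R) :
  (forall i, measurable (A i)) ->
  lebesgue_rV n [set x : 'rV[R]_n | forall i, A i (x 0 i)] =
  (\prod_(i < n) (@lebesgue_measure R (A i)))%E.
Proof.
elim: n A => [|n IH] A mA /=.
  by rewrite big_ord0 diracE mem_set//= => -[].
rewrite big_ord_recl -IH//.
rewrite /lebesgue_step /pushforward.
have mB : measurable [set x : 'rV[R]_n | forall i, A (lift ord0 i) (x 0 i)].
  have -> : [set x : 'rV[R]_n | forall i, A (lift ord0 i) (x 0 i)] =
      \bigcap_(i in [set: 'I_n])
        ((fun x : 'rV[R]_n => x 0 i) @^-1` A (lift ord0 i)).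
    by apply/seteqP; split => x /= Ax i; [move=> _|]; exact: Ax.
  apply: fin_bigcap_measurable => // i _.
  by rewrite -[X in measurable X]setTI; exact: measurable_coord.
rewrite -product_measure1E//; last exact: mA.
congr (_ _).
have c0 (p : R * 'rV[R]_n) : consrV p 0 ord0 = p.1.
  by rewrite -[in RHS](consrVK p).
have cS (p : R * 'rV[R]_n) i : consrV p 0 (lift ord0 i) = p.2 0 i.
  rewrite -[in RHS](consrVK p) /= [RHS]mxE.
  by apply: (congr1 (consrV p 0)); exact/val_inj.
apply/seteqP; split => [p /= Ap|p /= [Ap0 Ap] i].
  split; first by rewrite -c0.
  by move=> i; rewrite -cS.
by have [j ->|->] := unliftP ord0 i; [rewrite cS|rewrite c0].
Qed.

Section fourier.
Context {R : realType} {n : nat}.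
Implicit Types (x xi : 'rV[R]_n) (u v f : 'rV[R]_n -> R)
  (U V : 'rV[R]_n -> R[i]).
Local Notation leb := (@lebesgue_rV R n).

Definition dotrV x xi : R := \sum_i x 0 i * xi 0 i.

(* the library's norm on 'rV[R]_n is the sup norm *)
Definition euclidean_norm x : R := Num.sqrt (dotrV x x).

(* \int f(x) e^{-2 pi i x.xi} dx for a real-valued integrable f, split into its
   real and imaginary parts *)
Definition fourier f xi : R[i] :=
  ((\int[leb]_x (f x * cos (2 * pi * dotrV x xi)))%R
   +i* (- (\int[leb]_x (f x * sin (2 * pi * dotrV x xi)))%R))%C.

(* U is the Fourier transform of u in L^2, i.e. the extension by L^2-density of
   the integral formula on L^1 /\ L^2; U is determined up to a null set. *)
Definition is_fourierL2 u U :=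
  [/\ u \in Lfun leb 2%:E,
      ((@complex.Re R \o U) \in Lfun leb 2%:E /\
       (@complex.Im R \o U) \in Lfun leb 2%:E) &
      exists g : nat -> 'rV[R]_n -> R,
      [/\ forall k, g k \in Lfun leb 1%E /\ g k \in Lfun leb 2%:E,
          ('N[leb]_2%:E[EFin \o (fun x => (g k x - u x)%R)])%E @[k --> \oo] --> 0%E &
          ('N[leb]_2%:E[EFin \o (fun xi => Normc.normc (fourier (g k) xi - U xi)%R)])%E
            @[k --> \oo] --> 0%E ] ].

(* v = (-Delta)^{s/2} u, where u and v are in L^2 (this is part of
   is_fourierL2) *)
Definition is_frac_laplacian (s : R) u v :=
  exists U V, [/\ is_fourierL2 u U, is_fourierL2 v V &
    {ae leb, forall xi,
      V xi = ((2 * pi * euclidean_norm xi) `^ s)%:C%C * U xi}].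

Definition sobolev (s : R) u := exists v, is_frac_laplacian s u v.

(* mixed partial derivative of f along the coordinates listed in s *)
Definition iter_partial (s : seq 'I_n) f : 'rV[R]_n -> R :=
  foldr (fun i h x => 'D_(delta_mx 0 i) h x) f s.

Definition smooth f := forall s x, differentiable (iter_partial s f) x.

Definition test_function f :=
  smooth f /\ compact (closure [set x | f x != 0]).

Definition locally_integrable_rV f := measurable_fun setT f /\
  forall K, compact K -> (\int[leb]_(x in K) `|f x|%:E < +oo)%E.

Definition is_weak_gradient u (g : 'rV[R]_n -> 'rV[R]_n) :=
  locally_integrable_rV u /\
  forall i, locally_integrable_rV (fun x => g x 0 i) /\
    forall phi, test_function phi ->
      (\int[leb]_x (u x * 'D_(delta_mx 0 i) phi x))%R =
      - (\int[leb]_x (g x 0 i * phi x))%R.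

End fourier.

(* Main.v *)
Require Import Defs.
From mathcomp Require Import all_boot all_order all_algebra.
From mathcomp Require Import all_classical all_reals all_analysis.
From mathcomp Require Import measurable_realfun ring lra.
From mathcomp.real_closed Require Import complex.

(* Partial balayage. Put beta = alpha/2 and a(xi) = (2 pi |xi|)^alpha. Replacing the powers of z
   in the Taylor series of 1 - (1 - z)^beta, whose coefficients are nonnegative, by Gaussian
   densities gives even kernels s >= 0 of mass at most 1 such that the bounded operators
   u |-> kap (u - s * u) have symbols A with A <= a <= A (1 + a / kap).
   For such an operator the obstacle problem is solved by sweeping: replace f by f - e + s * e
   with e = (f - lambda)^+, over and over. The total U of the swept functions satisfies
   0 <= mu <= lambda for mu = f - (U - s * U), and mu = lambda where U > 0, so that
   |{U > 0}| <= |f|_1 / lambda. A function h supported in a set of given finite measure satisfies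
   |h|_2^2 <= C int A |h^|^2 with C independent of kap, because its transform is too flat to
   concentrate near 0. This gap bounds the sweeping and, with the monotonicity of the obstacle
   problem, makes u = U / kap a Cauchy family in L^2 as kap tends to infinity. The densities mu
   converge weakly. The mass is preserved in the limit because a vanishes at 0.
   If alpha >= 1, the difference quotients of u converge in L^2; on {u = 0} they are nonnegative
   for positive steps and nonpositive for negative ones, so the gradient vanishes there.
   The Hartley transform, with the real kernel cos + sin, replaces the Fourier transform: it is
   an isometry of the real L^2 and commutes with even multipliers. *)

Set Implicit Arguments.
Unset Strict Implicit.
Unset Printing Implicit Defensive.
Import Order.TTheory GRing.Theory Num.Theory.
Import numFieldNormedType.Exports.
Local Open Scope classical_set_scope.
Local Open Scope ring_scope.

(** * Integrable and square-integrable real functions *)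

Section L1_L2.
Context d (T : measurableType d) (R : realType) (mu : {measure set T -> \bar R}).
Implicit Types f g h : T -> R.

(** The difficulty is to let kap tend to infinity without compactness, with bounds in L^2 only. The
    form of the approximation answers this. Where the symbols are positive, A <= a <= A (1 + a /
    kap) says that 1/A and 1/a differ by at most 1/kap, so two approximations satisfy A - A' <= A A'
    / kap'. Exchanging the operators thus costs a product of two fluxes A u^ and A' u'^, and fluxes
    are bounded in L^2 by f and lambda alone, since 0 <= mu <= lambda. The Cauchy estimate has rate
    1/kap + 1/kap'. The symbol A = kap (1 - exp(-t |2 pi xi|^2))^beta with t^beta = 1/kap has the
    property because w / (1 + w) <= 1 - exp(-w) <= w for w >= 0. Its expansion in powers of a
    Gaussian gives a bounded integrable kernel, so that convolutions are pointwise formulas and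
    every approximate object stays in L^1 and L^2, where the transform is an integral. Fluxes
    converge only weakly; the relation between density and potential survives because the potentials
    converge strongly. *)

Definition L1 f : Prop := mu.-integrable setT (EFin \o f).

Definition Int f : R := \int[mu]_x f x.

Definition L2 f : Prop := measurable_fun setT f /\ L1 (fun x => f x ^+ 2).

Definition ip f g : R := Int (fun x => f x * g x).

Lemma L1_meas f : L1 f -> measurable_fun setT f.
Proof. by move=> /integrableP[/measurable_EFinP]. Qed.

Lemma L2_meas f : L2 f -> measurable_fun setT f.
Proof. by case. Qed.

Lemma L1D f g : L1 f -> L1 g -> L1 (fun x => f x + g x).
Proof. by move=> Lf Lg; exact: (integrableD measurableT Lf Lg). Qed.

Lemma L1B f g : L1 f -> L1 g -> L1 (fun x => f x - g x).
Proof. by move=> Lf Lg; exact: (integrableB measurableT Lf Lg). Qed.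

Lemma L1N f : L1 f -> L1 (fun x => - f x).
Proof. by move=> Lf; exact: (integrableN Lf). Qed.

Lemma L1Z k f : L1 f -> L1 (fun x => k * f x).
Proof. by move=> Lf; exact: (integrableZl measurableT k Lf). Qed.

Lemma L1_0 : L1 (fun=> 0).
Proof. exact: integrable0. Qed.

Lemma L1_norm f : L1 f -> L1 (fun x => `|f x|).
Proof. exact: integrable_norm. Qed.

Lemma L1_le f g : measurable_fun setT f -> (forall x, `|f x| <= g x) -> L1 g -> L1 f.
Proof.
move=> mf fg; apply: le_integrable => //; first exact/measurable_EFinP.
by move=> x _ /=; rewrite lee_fin (le_trans (fg x))// ler_norm.
Qed.

Lemma L1_sum (I : Type) (s : seq I) (P : pred I) (F : I -> T -> R) :
  (forall i, P i -> L1 (F i)) -> L1 (fun x => \sum_(i <- s | P i) F i x).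
Proof.
move=> LF; rewrite /L1 /comp.
under eq_fun do rewrite -sumEFin.
exact: integrable_sum.
Qed.

Lemma L1_bM f g M : L1 f -> measurable_fun setT g -> (forall x, `|g x| <= M) ->
  L1 (fun x => f x * g x).
Proof.
move=> Lf mg gM; apply: (@L1_le _ (fun x => M * `|f x|)).
- by apply: measurable_funM => //; exact: L1_meas.
- by move=> x; rewrite normrM mulrC ler_wpM2r.
- exact/L1Z/L1_norm.
Qed.

Lemma L1_fin_num f : L1 f -> (\int[mu]_x (f x)%:E = (Int f)%:E)%E.
Proof. by move=> Lf; rewrite /Int /Rintegral fineK//; exact: integrable_fin_num. Qed.

Lemma L1_ge0P f : measurable_fun setT f -> (forall x, 0 <= f x) ->
  L1 f <-> (\int[mu]_x (f x)%:E < +oo)%E.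
Proof.
move=> mf f0; split=> [/integrableP[_]|foo].
  by under eq_integral do rewrite gee0_abs ?lee_fin//.
apply/integrableP; split; first exact/measurable_EFinP.
by under eq_integral do rewrite gee0_abs ?lee_fin//.
Qed.

Lemma intD f g : L1 f -> L1 g -> Int (fun x => f x + g x) = Int f + Int g.
Proof. by move=> ? ?; exact: RintegralD. Qed.

Lemma intB f g : L1 f -> L1 g -> Int (fun x => f x - g x) = Int f - Int g.
Proof. by move=> ? ?; exact: RintegralB. Qed.

Lemma intZl k f : L1 f -> Int (fun x => k * f x) = k * Int f.
Proof. by move=> ?; exact: RintegralZl. Qed.

Lemma intZr k f : L1 f -> Int (fun x => f x * k) = Int f * k.
Proof. by move=> ?; exact: RintegralZr. Qed.

Lemma intN f : L1 f -> Int (fun x => - f x) = - Int f.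
Proof.
move=> Lf; rewrite -mulN1r -intZl//; congr Int.
by apply/funext => x; rewrite mulN1r.
Qed.

Lemma int0 : Int (fun=> 0) = 0.
Proof. by rewrite /Int Rintegral_cst// mul0r. Qed.

Lemma int_ge0 f : (forall x, 0 <= f x) -> 0 <= Int f.
Proof. by move=> f0; exact: Rintegral_ge0. Qed.

Lemma int_le f g : L1 f -> L1 g -> (forall x, f x <= g x) -> Int f <= Int g.
Proof. by move=> ? ? fg; apply: le_Rintegral. Qed.

Lemma int_sum (I : Type) (s : seq I) (F : I -> T -> R) :
  (forall i, L1 (F i)) -> Int (fun x => \sum_(i <- s) F i x) = \sum_(i <- s) Int (F i).
Proof.
move=> LF; elim: s => [|i s ih].
  by rewrite big_nil -[RHS]int0; congr Int; apply/funext => x; rewrite big_nil.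
rewrite big_cons -ih -intD//; last exact: L1_sum.
by congr Int; apply/funext => x; rewrite big_cons.
Qed.

Lemma norm_int_le f : L1 f -> `|Int f| <= Int (fun x => `|f x|).
Proof. by move=> Lf; exact: le_normr_Rintegral. Qed.

Lemma L2_L1M f g : L2 f -> L2 g -> L1 (fun x => f x * g x).
Proof.
move=> [mf Lf] [mg Lg].
apply: (@L1_le _ (fun x => f x ^+ 2 + g x ^+ 2)); last exact: L1D.
  exact: measurable_funM.
move=> x; rewrite normrM -[f x ^+ 2]real_normK ?num_real//.
rewrite -[g x ^+ 2]real_normK ?num_real//.
have := sqr_ge0 (`|f x| - `|g x|); have := mulr_ge0 (normr_ge0 (f x)) (normr_ge0 (g x)).
by nra.
Qed.

Lemma L2Z k f : L2 f -> L2 (fun x => k * f x).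
Proof.
move=> [mf Lf]; split; first exact: measurable_funM.
rewrite (_ : (fun x => _) = fun x => k ^+ 2 * f x ^+ 2); first exact: L1Z.
by apply/funext => x; rewrite exprMn.
Qed.

Lemma L2_le f g : measurable_fun setT f -> (forall x, `|f x| <= `|g x|) -> L2 g -> L2 f.
Proof.
move=> mf fg [mg Lg]; split => //; apply: L1_le Lg; first exact: measurable_funX.
by move=> x; rewrite normrX -[leRHS]real_normK ?num_real// lerXn2r// nnegrE.
Qed.

Lemma L2N f : L2 f -> L2 (fun x => - f x).
Proof.
move=> Lf; apply: L2_le (Lf) => [|x]; last by rewrite normrN.
by apply: measurableT_comp => //; case: Lf.
Qed.

Lemma L2D f g : L2 f -> L2 g -> L2 (fun x => f x + g x).
Proof.
move=> Lf Lg; split; first by apply: measurable_funD; apply: L2_meas.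
rewrite (_ : (fun x => _) = fun x => (f x ^+ 2 + g x ^+ 2) + 2 * (f x * g x)).
  by apply: L1D; [apply: L1D; [case: Lf|case: Lg]|apply/L1Z/L2_L1M].
by apply/funext => x; ring.
Qed.

Lemma L2B f g : L2 f -> L2 g -> L2 (fun x => f x - g x).
Proof. by move=> Lf Lg; apply: L2D => //; exact: L2N. Qed.

Lemma L2_0 : L2 (fun=> 0).
Proof.
split => //; rewrite (_ : (fun x => _) = fun=> 0); first exact: L1_0.
by apply/funext => x; rewrite expr0n.
Qed.

Lemma L2_bM f g M : L2 f -> measurable_fun setT g -> (forall x, `|g x| <= M) ->
  L2 (fun x => g x * f x).
Proof.
move=> Lf mg gM; apply: (@L2_le _ (fun x => M * f x)); last exact: L2Z.
  by apply: measurable_funM => //; exact: L2_meas.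
by move=> x; rewrite !normrM ler_wpM2r// (le_trans (gM x))// ler_norm.
Qed.

Lemma L1_L2_bounded f M : L1 f -> (forall x, `|f x| <= M) -> L2 f.
Proof.
move=> Lf fM; split; first exact: L1_meas.
by apply: L1_bM => //; exact: L1_meas.
Qed.

Lemma ipC f g : ip f g = ip g f.
Proof. by congr Int; apply/funext => x; rewrite mulrC. Qed.

Lemma ipDl f g h : L2 f -> L2 g -> L2 h -> ip (fun x => f x + g x) h = ip f h + ip g h.
Proof.
move=> Lf Lg Lh; rewrite /ip -intD; [|exact: L2_L1M..].
by congr Int; apply/funext => x; rewrite mulrDl.
Qed.

Lemma ipBl f g h : L2 f -> L2 g -> L2 h -> ip (fun x => f x - g x) h = ip f h - ip g h.
Proof.
move=> Lf Lg Lh; rewrite /ip -intB; [|exact: L2_L1M..].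
by congr Int; apply/funext => x; rewrite mulrBl.
Qed.

Lemma ipZl k f h : L2 f -> L2 h -> ip (fun x => k * f x) h = k * ip f h.
Proof.
move=> Lf Lh; rewrite /ip -intZl; [|exact: L2_L1M..].
by congr Int; apply/funext => x; rewrite mulrA.
Qed.

Lemma ipDr f g h : L2 f -> L2 g -> L2 h -> ip h (fun x => f x + g x) = ip h f + ip h g.
Proof. by move=> *; rewrite ![ip h _]ipC ipDl. Qed.

Lemma ipBr f g h : L2 f -> L2 g -> L2 h -> ip h (fun x => f x - g x) = ip h f - ip h g.
Proof. by move=> *; rewrite ![ip h _]ipC ipBl. Qed.

Lemma ipZr k f h : L2 f -> L2 h -> ip h (fun x => k * f x) = k * ip h f.
Proof. by move=> *; rewrite ![ip h _]ipC ipZl. Qed.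

Definition sq f := ip f f.

Lemma sqE f : sq f = Int (fun x => f x ^+ 2).
Proof. by congr Int; apply/funext => x; rewrite expr2. Qed.

Lemma sq_ge0 f : 0 <= sq f.
Proof. by apply: int_ge0 => x; rewrite -expr2 sqr_ge0. Qed.

Lemma sqD f g : L2 f -> L2 g -> sq (fun x => f x + g x) = sq f + 2 * ip f g + sq g.
Proof.
move=> Lf Lg; rewrite /sq ipDl ?ipDr//; try exact: L2D.
by rewrite (ipC g f); ring.
Qed.

Lemma sqB f g : L2 f -> L2 g -> sq (fun x => f x - g x) = sq f - 2 * ip f g + sq g.
Proof.
move=> Lf Lg; rewrite /sq ipBl ?ipBr//; try exact: L2B.
by rewrite (ipC g f); ring.
Qed.

Lemma sqZ k f : L2 f -> sq (fun x => k * f x) = k ^+ 2 * sq f.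
Proof. by move=> Lf; rewrite /sq ipZl ?ipZr//; [ring|exact: L2Z]. Qed.

Lemma sq_le f g : measurable_fun setT f -> (forall x, `|f x| <= `|g x|) -> L2 g ->
  sq f <= sq g.
Proof.
move=> mf fg Lg; have Lf := L2_le mf fg Lg; rewrite !sqE; apply: int_le.
- by case: Lf.
- by case: Lg.
- by move=> x; rewrite -real_normK ?num_real// -[leRHS]real_normK ?num_real// lerXn2r// nnegrE.
Qed.

Lemma sqBle f g : L2 f -> L2 g -> sq (fun x => f x - g x) <= 2 * sq f + 2 * sq g.
Proof.
move=> Lf Lg; have := sq_ge0 (fun x => f x + g x); rewrite sqB// sqD//.
by nra.
Qed.

Lemma cauchy_schwarz f g : L2 f -> L2 g -> ip f g ^+ 2 <= sq f * sq g.
Proof.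
move=> Lf Lg.
have P t : 0 <= sq f - 2 * (t * ip f g) + t ^+ 2 * sq g.
  rewrite -sqZ// -ipZr// -sqB//; [exact: sq_ge0|exact: L2Z].
have [g0|g0] := eqVneq (sq g) 0.
  have /eqP-> : ip f g == 0; last by rewrite expr0n g0 mulr0.
  rewrite -[_ == _]negbK; apply/negP => fg0.
  (* When [sq g = 0] the polynomial in t is affine, and at this t it equals [- sq f - 2 < 0]. *)
  have := P ((sq f + 1) / ip f g); rewrite g0 mulr0 addr0 divfK//.
  by have := sq_ge0 f; lra.
have gp : 0 < sq g by rewrite lt_def g0 sq_ge0.
have := P (ip f g / sq g).
rewrite (_ : _ + _ = (sq f * sq g - ip f g ^+ 2) / sq g); last by field.
by rewrite ler_pdivlMr// mul0r subr_ge0.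
Qed.

Lemma norm_ip_le f g : L2 f -> L2 g -> `|ip f g| <= Num.sqrt (sq f) * Num.sqrt (sq g).
Proof.
move=> Lf Lg; rewrite -sqrtrM ?sq_ge0// -sqrtr_sqr ler_wsqrtr//.
exact: cauchy_schwarz.
Qed.

Lemma nrm2D f g : L2 f -> L2 g ->
  Num.sqrt (sq (fun x => f x + g x)) <= Num.sqrt (sq f) + Num.sqrt (sq g).
Proof.
move=> Lf Lg; rewrite -(@ler_pXn2r _ 2)// ?nnegrE ?addr_ge0 ?sqrtr_ge0//.
rewrite sqrrD !sqr_sqrtr ?sq_ge0// sqD//.
have := le_trans (ler_norm _) (norm_ip_le Lf Lg).
by rewrite mulr_natl => ?; lra.
Qed.

End L1_L2.

Section indicators.
Context d (T : measurableType d) (R : realType) (mu : {measure set T -> \bar R}).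
Implicit Types (g u : T -> R) (B : set T).

Lemma measurable_superlevel g (c : R) : measurable_fun setT g -> measurable [set x | c < g x].
Proof.
move=> mg; rewrite (_ : [set x | _] = g @^-1` `]c, +oo[).
  by rewrite -[X in measurable X]setTI; exact: mg.
by apply/seteqP; split => x /=; rewrite in_itv /= andbT.
Qed.

Lemma measurable_neq0 g : measurable_fun setT g -> measurable [set x | g x != 0].
Proof.
move=> mg; rewrite (_ : [set x | _] = g @^-1` [set~ 0]).
  by rewrite -[X in measurable X]setTI; apply: mg => //; exact: measurableC.
by apply/seteqP; split => x /=; [move/eqP|move=> /eqP].
Qed.

Lemma norm_indic_le1 B x : `|\1_B x : R| <= 1.
Proof. by rewrite indicE normr_nat lern1 leq_b1. Qed.

Lemma sqr_indic B : (fun x => (\1_B x : R) ^+ 2) = \1_B.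
Proof. by apply/funext => x; rewrite indicE; case: (_ \in _); rewrite ?expr1n ?expr0n. Qed.

Lemma L1_indic B : measurable B -> (mu B < +oo)%E -> L1 mu \1_B.
Proof.
move=> mB fB; apply/L1_ge0P; [exact: measurable_indic|by []|].
by rewrite integral_indic// setIT.
Qed.

Lemma L2_indic B : measurable B -> (mu B < +oo)%E -> L2 mu \1_B.
Proof. by move=> mB fB; split; [exact: measurable_indic|rewrite sqr_indic; exact: L1_indic]. Qed.

Lemma L2_indicM g B : measurable B -> (mu B < +oo)%E -> L2 mu g -> L1 mu (fun x => g x * \1_B x).
Proof. by move=> mB fB Lg; apply: L2_L1M Lg _; exact: L2_indic. Qed.

(** On the support |u| <= u^2 + 1, and the constant 1 is integrable there. *)
Lemma L2_finite_support_L1 u (m : R) : L2 mu u -> (mu [set x | (u x != 0)%R] <= m%:E)%E -> L1 mu u.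
Proof.
move=> Lu um; have mf := L2_meas Lu; have [_ Lu2] := Lu.
have LS : L1 mu \1_[set x | u x != 0].
  by apply: L1_indic; [exact: measurable_neq0|rewrite (le_lt_trans um)// ltry].
apply: L1_le mf _ (L1D Lu2 LS) => x.
rewrite indicE; have [u0|u0] := eqVneq (u x) 0; first by rewrite u0 normr0 expr0n/= addr_ge0.
rewrite mem_set//= -(real_normK (num_real (u x))).
by have := sqr_ge0 (`|u x| - 1); have := normr_ge0 (u x); nra.
Qed.

End indicators.

(** * Limit theorems and completeness of L^2 *)

Section real_sequences.
Context (R : realType).
Implicit Types u v : nat -> R.

Lemma squeeze0 u v : (forall k, `|u k| <= v k) -> v k @[k --> \oo] --> 0 ->
  u k @[k --> \oo] --> 0.
Proof.
move=> uv v0; apply: norm_cvg0; apply: squeeze_cvgr (cvg_cst 0) v0.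
by apply: nearW => k; rewrite normr_ge0 uv.
Qed.

Lemma cvg_le_cst u l C : u k @[k --> \oo] --> l -> (\forall k \near \oo, u k <= C) -> l <= C.
Proof. by move=> ul uC; rewrite -(cvg_lim _ ul)//; apply: limr_le => //; apply: cvgP ul. Qed.

Lemma cvg_ge_cst u l C : u k @[k --> \oo] --> l -> (\forall k \near \oo, C <= u k) -> C <= l.
Proof. by move=> ul uC; rewrite -(cvg_lim _ ul)//; apply: limr_ge => //; apply: cvgP ul. Qed.

Lemma sqrt_cvg0 u : u k @[k --> \oo] --> 0 -> Num.sqrt (u k) @[k --> \oo] --> 0.
Proof. by move=> u0; rewrite -sqrtr0; apply: continuous_cvg => //; exact: sqrt_continuous. Qed.

End real_sequences.

Section L1_L2_limits.
Context d (T : measurableType d) (R : realType) (mu : {measure set T -> \bar R}).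
Implicit Types f g h : T -> R.
Local Notation L1 := (L1 mu).
Local Notation L2 := (L2 mu).
Local Notation Int := (Int mu).
Local Notation ip := (ip mu).
Local Notation sq := (sq mu).

Lemma ae_int_dominated_cvg (F : nat -> T -> R) f g :
  (forall k, measurable_fun setT (F k)) -> measurable_fun setT f ->
  {ae mu, forall x, F k x @[k --> \oo] --> f x} -> L1 g ->
  {ae mu, forall x, forall k, `|F k x| <= g x} ->
  Int (F k) @[k --> \oo] --> Int f.
Proof.
move=> mF mf Ff Lg Fg.
have [] := @dominated_convergence _ _ _ mu _ measurableT (fun k => EFin \o F k)
  (EFin \o f) (EFin \o g) _ _ _ Lg _.
- by move=> k; exact/measurable_EFinP.
- exact/measurable_EFinP.
- apply: filterS Ff => x Fx _; apply/fine_cvgP; split; first exact: nearW.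
  exact: Fx.
- by apply: filterS Fg => x h k _; rewrite lee_fin.
move=> Lf _ cv.
rewrite /= in cv; rewrite L1_fin_num// in cv.
exact: (fine_cvg cv).
Qed.

Lemma int_dominated_cvg (F : nat -> T -> R) f g :
  (forall k, measurable_fun setT (F k)) -> measurable_fun setT f ->
  {ae mu, forall x, F k x @[k --> \oo] --> f x} -> L1 g ->
  (forall k x, `|F k x| <= g x) ->
  L1 f /\ Int (F k) @[k --> \oo] --> Int f.
Proof.
move=> mF mf Ff Lg Fg; split; last first.
  by apply: ae_int_dominated_cvg Ff Lg _ => //; exact: aeW.
have [] := @dominated_convergence _ _ _ mu _ measurableT (fun k => EFin \o F k)
  (EFin \o f) (EFin \o g) _ _ _ Lg _ => //.
- by move=> k; exact/measurable_EFinP.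
- exact/measurable_EFinP.
- apply: filterS Ff => x Fx _; apply/fine_cvgP; split; first exact: nearW.
  exact: Fx.
- by apply: aeW => x k _; rewrite lee_fin.
Qed.

(** Integrability of [f] is a conclusion: almost everywhere [f] equals the lower limit of the
    integrands, whose integral Fatou's lemma bounds by [C]. This is how limit objects enter L^1 and
    L^2. *)
Lemma fatou_int (F : nat -> T -> R) f C :
  (forall k, L1 (F k)) -> (forall k x, 0 <= F k x) ->
  measurable_fun setT f -> (forall x, 0 <= f x) ->
  {ae mu, forall x, F k x @[k --> \oo] --> f x} ->
  (\forall k \near \oo, Int (F k) <= C) ->
  L1 f /\ Int f <= C.
Proof.
move=> LF F0 mf f0 Ff FC.
have intf : (\int[mu]_x (f x)%:E <= C%:E)%E.
  apply: (@le_trans _ _ (limn_einf (fun k => \int[mu]_x (F k x)%:E)%E)).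
    apply: le_trans (fatou mu measurableT (f := fun k => EFin \o F k) _ _).
    - apply: ae_ge0_le_integral => //.
      + by move=> x _; rewrite lee_fin.
      + exact/measurable_EFinP.
      + move=> x _; rewrite limn_einf_lim; apply: lime_ge.
          by apply: ereal_nondecreasing_is_cvgn; exact: nondecreasing_einfs.
        apply: nearW => k; apply: le_ereal_inf_tmp => _ [m _ <-] /=.
        by rewrite lee_fin.
      + apply: (@emeasurable_fun_cvg _ _ _ _ (fun k x => einfs (fun m => (F m x)%:E) k)).
          by move=> k; apply: measurable_fun_einfs => m; exact/measurable_EFinP/L1_meas.
        move=> x _; rewrite limn_einf_lim.
        by apply: ereal_nondecreasing_is_cvgn; exact: nondecreasing_einfs.
      + apply: filterS Ff => x Fx _; rewrite is_cvg_limn_einfE; last first.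
          by apply/cvg_ex; exists (f x)%:E; apply/fine_cvgP; split; [exact: nearW|].
        rewrite (_ : limn _ = (f x)%:E)//; apply/cvg_lim => //.
        by apply/fine_cvgP; split; [exact: nearW|].
    - by move=> k; exact/measurable_EFinP/L1_meas.
    - by move=> k x _; rewrite lee_fin.
  rewrite limn_einf_lim; apply: lime_le.
    by apply: ereal_nondecreasing_is_cvgn; exact: nondecreasing_einfs.
  near=> k; apply: (@le_trans _ _ (\int[mu]_x (F k x)%:E)%E).
    by apply: ereal_inf_lbound; exists k => /=.
  by rewrite L1_fin_num// lee_fin; near: k.
have Lf : L1 f.
  by apply/L1_ge0P => //; apply: le_lt_trans intf _; rewrite ltry.
by split => //; rewrite -lee_fin -L1_fin_num.
Unshelve. all: by end_near. Qed.

Lemma int_eq0_ae f : L1 f -> (forall x, 0 <= f x) -> Int f = 0 ->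
  {ae mu, forall x, f x = 0}.
Proof.
move=> Lf f0 if0.
have := (ae_eq_integral_abs mu measurableT (f := EFin \o f) (measurable_int mu Lf)).1.
rewrite (eq_integral (EFin \o f)) ?L1_fin_num ?if0//; last first.
  by move=> x _ /=; rewrite ger0_norm.
by move=> /(_ erefl); apply: filterS => x /(_ Logic.I) [].
Qed.

Lemma ae_int_le f g : L1 f -> L1 g -> {ae mu, forall x, f x <= g x} ->
  Int f <= Int g.
Proof.
move=> Lf Lg fg; rewrite -subr_ge0 -intB//.
(* The difference is nonnegative only almost everywhere, so its positive part is integrated
   instead. *)
rewrite /Int /Rintegral fine_ge0// (@ae_eq_integral _ _ _ mu setT
  (fun x => (Num.max (g x - f x) 0)%:E) (fun x => (g x - f x)%:E)) //.
- by apply: integral_ge0 => x _; rewrite lee_fin le_max lexx orbT.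
- by apply/measurable_EFinP; exact: L1_meas (L1B Lg Lf).
- apply/measurable_EFinP/measurable_maxr => //.
  exact: L1_meas (L1B Lg Lf).
- by apply: filterS fg => x fgx _; congr EFin; rewrite max_l// subr_ge0.
Qed.

Lemma ae_int_eq f g : L1 f -> L1 g -> {ae mu, forall x, f x = g x} ->
  Int f = Int g.
Proof.
move=> Lf Lg fg; apply/eqP; rewrite eq_le !ae_int_le//;
  by apply: filterS fg => x ->.
Qed.

Lemma ae_L1 f g : measurable_fun setT f -> {ae mu, forall x, f x = g x} ->
  L1 g -> L1 f.
Proof.
move=> mf fg /integrableP[mg oog]; apply/integrableP; split.
  exact/measurable_EFinP.
rewrite (ae_eq_integral (fun x => `|(EFin \o g) x|)%E)//.
- by apply: measurableT_comp => //; exact/measurable_EFinP.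
- exact: measurableT_comp.
- by apply: filterS fg => x fgx _ /=; rewrite fgx.
Qed.

Definition cvg2 (F : nat -> T -> R) f := sq (fun x => F k x - f x) @[k --> \oo] --> (0 : R).

Lemma cvg2_ip (F : nat -> T -> R) f g : (forall k, L2 (F k)) -> L2 f -> L2 g ->
  cvg2 F f -> ip (F k) g @[k --> \oo] --> ip f g.
Proof.
move=> LF Lf Lg Ff; apply/subr_cvg0.
have : Num.sqrt (sq (fun x => F k x - f x)) * Num.sqrt (sq g) @[k --> \oo] --> 0.
  by rewrite -[X in _ --> X](mul0r (Num.sqrt (sq g))); apply: cvgMl; exact: sqrt_cvg0.
apply: squeeze0 => k; rewrite -ipBl//; apply: norm_ip_le => //.
exact: L2B.
Qed.

Lemma nrm2B f g : L2 f -> L2 g ->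
  `|Num.sqrt (sq f) - Num.sqrt (sq g)| <= Num.sqrt (sq (fun x => f x - g x)).
Proof.
move=> Lf Lg.
have H f' g' : L2 f' -> L2 g' ->
    Num.sqrt (sq f') - Num.sqrt (sq g') <= Num.sqrt (sq (fun x => f' x - g' x)).
  move=> Lf' Lg'; rewrite lerBlDr.
  rewrite (_ : f' = fun x => (f' x - g' x) + g' x); last first.
    by apply/funext => x; rewrite subrK.
  rewrite (_ : (fun x => f' x - g' x + g' x - g' x) = fun x => f' x - g' x); last first.
    by apply/funext => x; rewrite subrK.
  by apply: nrm2D => //; exact: L2B.
rewrite ler_norml H// andbT lerNl opprB (le_trans (H _ _ Lg Lf))//.
rewrite (_ : sq (fun x => g x - f x) = sq (fun x => f x - g x))//.
by rewrite !sqE; congr (Int _); apply/funext => x; ring.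
Qed.

Lemma cvg2_sq (F : nat -> T -> R) f : (forall k, L2 (F k)) -> L2 f ->
  cvg2 F f -> sq (F k) @[k --> \oo] --> sq f.
Proof.
move=> LF Lf Ff.
have : Num.sqrt (sq (F k)) @[k --> \oo] --> Num.sqrt (sq f).
  apply/subr_cvg0; apply: squeeze0 (sqrt_cvg0 Ff) => k.
  exact: nrm2B.
move=> h.
have -> : sq f = Num.sqrt (sq f) * Num.sqrt (sq f) by rewrite -expr2 sqr_sqrtr ?sq_ge0.
rewrite (_ : (fun k => sq (F k)) =
  fun k => Num.sqrt (sq (F k)) * Num.sqrt (sq (F k))); first exact: cvgM.
by apply/funext => k; rewrite -expr2 sqr_sqrtr ?sq_ge0.
Qed.

(** Almost everywhere on [Z] the negative part of [f] is at most |F_k - f|, so its L^2 norm is 0. A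
    sign thus survives L^2 convergence without extracting a subsequence. *)
Lemma cvg2_ge0 (F : nat -> T -> R) f (Z : set T) :
  (forall k, L2 (fun x => F k x - f x)) -> measurable_fun setT f ->
  measurable Z ->
  (forall k, {ae mu, forall x, Z x -> 0 <= F k x}) -> cvg2 F f ->
  {ae mu, forall x, Z x -> 0 <= f x}.
Proof.
move=> LF mf mZ F0 Ff.
pose g x := (Num.max (- f x) 0) * \1_Z x.
have mg : measurable_fun setT g.
  apply: measurable_funM; last exact: measurable_indic.
  by apply: measurable_maxr => //; exact: measurableT_comp.
have gF k : {ae mu, forall x, g x ^+ 2 <= (F k x - f x) ^+ 2}.
  apply: filterS (F0 k) => x; rewrite /g indicE.
  case: (boolP (x \in Z)) => [/set_mem Zx /(_ Zx)|_ _] /=; last first.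
    by rewrite mulr0 expr0n sqr_ge0.
  rewrite mulr1 => Fk0; have [h|h] := leP 0 (- f x); last by rewrite expr0n sqr_ge0.
  by rewrite lerXn2r// ?nnegrE ?addr_ge0// lerDr.
have Lg : L2 g.
  split => //; have [_ /integrableP[_ oo]] := LF 0%N; apply/integrableP; split.
    by apply/measurable_EFinP; exact: measurable_funX.
  apply: le_lt_trans oo; apply: ae_ge0_le_integral => //.
  - by apply: measurableT_comp => //; apply/measurable_EFinP; exact: measurable_funX.
  - apply: measurableT_comp => //; apply/measurable_EFinP; apply: measurable_funX.
    exact: L2_meas (LF 0%N).
  - by apply: filterS (gF 0%N) => x h _; rewrite lee_fin !ger0_norm ?sqr_ge0.
have g0 k : sq g <= sq (fun x => F k x - f x).
  by rewrite !sqE; apply: ae_int_le => //; [case: Lg|case: (LF k)].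
have sg0 : sq g = 0.
  apply/eqP; rewrite eq_le sq_ge0 andbT.
  by apply: cvg_ge_cst Ff _; exact: nearW.
have : {ae mu, forall x, g x ^+ 2 = 0}.
  by apply: int_eq0_ae; [case: Lg|move=> x; rewrite sqr_ge0|rewrite -sqE].
apply: filterS => x /eqP; rewrite sqrf_eq0 /g indicE => + Zx.
rewrite mem_set//= mulr1 => /eqP gx0.
by rewrite -oppr_le0 -gx0 le_max lexx.
Qed.

Lemma cvg2_uniq_sq (F : nat -> T -> R) f g : (forall k, L2 (F k)) -> L2 f -> L2 g ->
  cvg2 F f -> cvg2 F g -> sq (fun x => f x - g x) = 0.
Proof.
move=> LF Lf Lg Ff Fg; apply/eqP; rewrite eq_le sq_ge0 andbT.
have h k : sq (fun x => f x - g x) <=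
    2 * sq (fun x => F k x - g x) + 2 * sq (fun x => F k x - f x).
  apply: le_trans (sqBle _ _); [|exact: L2B|exact: L2B].
  by rewrite le_eqVlt; apply/orP; left; apply/eqP; congr (sq _); apply/funext => x; ring.
have cv : 2 * sq (fun x => F k x - g x) + 2 * sq (fun x => F k x - f x) @[k --> \oo] --> (2 * 0 + 2 * 0 : R).
  by apply: cvgD; apply: cvgMr.
by rewrite !mulr0 addr0 in cv; apply: cvg_ge_cst cv _; exact: nearW.
Qed.

Lemma summable_increments_cvg (u : nat -> R) (C : R) :
  (forall k, `|u k.+1 - u k| <= C * (2^-1) ^+ k) -> cvgn u.
Proof.
move=> uC.
have : cvgn (series (telescope u)).
  apply: normed_cvg; apply: (@series_le_cvg _ _ (geometric C 2^-1)).
  - by move=> k; exact: normr_ge0.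
  - by move=> k; rewrite (le_trans _ (uC k)).
  - by move=> k; rewrite /telescope /= uC.
  - by apply: is_cvg_geometric_series; rewrite ger0_norm ?invr_ge0// invf_lt1 ?ltr1n.
move=> /cvg_ex[l ul]; apply/cvg_ex; exists (u 0%N + l) => /=.
suff : u 0%N + series (telescope u) k @[k --> \oo] --> u 0%N + l.
  by under eq_fun do rewrite -eq_sum_telescope.
by apply: cvgD => //; exact: cvg_cst.
Qed.

(** Weighted by 4^k, the squared increments have integrals at most 2^-k. Their series is finite
    almost everywhere, which bounds the increments by a multiple of 2^-k. *)
Lemma ae_cvg_of_sq_geometric (G : nat -> T -> R) : (forall k, L2 (G k)) ->
  (forall k, sq (fun x => G k.+1 x - G k x) <= (8^-1) ^+ k) ->
  {ae mu, forall x, cvgn (fun k => G k x)}.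
Proof.
move=> LG G8.
pose h k x := ((4 ^+ k * (G k.+1 x - G k x) ^+ 2)%:E : \bar R).
have mh k : measurable_fun setT (h k).
  apply/measurable_EFinP; apply: measurable_funM => //.
  by apply: measurable_funX; apply: L2_meas; exact: L2B.
have h0 k x : (0 <= h k x)%E 
  by rewrite /h lee_fin; apply: mulr_ge0; [exact: exprn_ge0|exact: sqr_ge0].
have mH : measurable_fun setT (fun x => \sum_(0 <= k <oo) h k x)%E.
  by apply: ge0_emeasurable_sum => // k x _ _; exact: h0.
have intH : (\int[mu]_x (\sum_(0 <= k <oo) h k x) < +oo)%E.
  rewrite integral_nneseries//.
  apply: (@le_lt_trans _ _ (\sum_(0 <= k <oo) ((geometric 1 2^-1 k : R)%:E)))%E.
    apply: lee_nneseries => k _; first by move=> _; rewrite integral_ge0.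
    rewrite (_ : (\int[mu]_x h k x)%E =
        (4 ^+ k * sq (fun x => G k.+1 x - G k x))%:E); last first.
      rewrite sqE -intZl; last by case: (L2B (LG k.+1) (LG k)).
      by rewrite -L1_fin_num//; apply: L1Z; case: (L2B (LG k.+1) (LG k)).
    rewrite lee_fin /= mul1r (_ : 2^-1 = 4 * 8^-1 :> R); last by field.
    by rewrite exprMn ler_wpM2l// exprn_ge0.
  have cg : cvgn (series (geometric (1 : R) 2^-1)).
    by apply: is_cvg_geometric_series; rewrite ger0_norm ?invr_ge0// invf_lt1 ?ltr1n.
  rewrite (_ : (fun n => _) = EFin \o series (geometric 1 2^-1)); last first.
    by apply/funext => k; rewrite /series /= sumEFin.
  by rewrite EFin_lim// ltry.
have iH : mu.-integrable setT (fun x => \sum_(0 <= k <oo) h k x)%E.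
  apply/integrableP; split => //.
  by under eq_integral => x _ do rewrite gee0_abs ?nneseries_ge0//.
apply: filterS (integrable_ae measurableT iH) => x /(_ Logic.I) fx.
pose S := fine (\sum_(0 <= k <oo) h k x)%E.
have S0 : 0 <= S by apply: fine_ge0; exact: nneseries_ge0.
have hS k : 4 ^+ k * (G k.+1 x - G k x) ^+ 2 <= S.
  rewrite -lee_fin fineK//.
  apply: le_trans (nneseries_lim_ge k.+1 _); last by move=> i _ _; exact: h0.
  by rewrite big_nat_recr//= leeDr// sume_ge0.
(* [S + 1] stands for the square root of [S], as S <= (S + 1)^2. *)
apply: (@summable_increments_cvg _ (S + 1)) => k.
rewrite -(@ler_pXn2r _ 2)// ?nnegrE ?mulr_ge0 ?addr_ge0 ?exprn_ge0 ?invr_ge0//.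
rewrite real_normK ?num_real// exprMn -exprM mulnC exprM.
rewrite (_ : 2^-1 ^+ 2 = 4^-1 :> R); last by rewrite exprVn -natrX.
rewrite exprVn ler_pdivlMr ?exprn_gt0// mulrC (le_trans (hS k))//.
by nra.
Qed.

(** A subsequence with increments of squared norm at most 8^-k converges almost everywhere. Fatou's
    lemma, applied along it with one index fixed, turns the Cauchy bounds into convergence of the
    whole sequence. *)
Lemma L2_complete (F : nat -> T -> R) : (forall k, L2 (F k)) ->
  (forall e, 0 < e -> exists N, forall j l, (N <= j)%N -> (N <= l)%N ->
     sq (fun x => F j x - F l x) <= e) ->
  exists2 f, L2 f & cvg2 F f.
Proof.
move=> LF CF.
have e0 k : 0 < (8^-1) ^+ k :> R by rewrite exprn_gt0// invr_gt0.
pose N k := projT1 (cid (CF _ (e0 k))).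
have NP k j l : (N k <= j)%N -> (N k <= l)%N -> sq (fun x => F j x - F l x) <= (8^-1) ^+ k.
  by rewrite /N; case: cid => /= ? h; exact: h.
(* The sum dominates [N k] and is nondecreasing in k, which [N] itself need not be. *)
pose n k := (\sum_(i < k.+1) N i)%N.
have nS k : (n k <= n k.+1)%N by rewrite /n [leqRHS]big_ord_recr leq_addr.
have nN k : (N k <= n k)%N by rewrite /n big_ord_recr leq_addl.
pose G k := F (n k).
have nmono j k : (j <= k)%N -> (n j <= n k)%N.
  by move=> jk; rewrite -(subnKC jk); elim: (k - j)%N => [|i ih]; rewrite ?addn0// addnS (leq_trans ih).
have GF k j : (N k <= j)%N -> sq (fun x => G k x - F j x) <= (8^-1) ^+ k by exact: NP.
have cG : {ae mu, forall x, cvgn (fun k => G k x)}.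
  apply: ae_cvg_of_sq_geometric => k; first exact: LF.
  by apply: NP => //; rewrite (leq_trans (nN k)).
(* The upper limit is measurable everywhere, also at the points of the null set where the
   subsequence diverges. *)
pose f x := fine (limn_esup (fun k => (G k x)%:E)).
have mf : measurable_fun setT f.
  apply: (@measurableT_comp _ _ _ _ _ _ fine); first exact: fine_measurable.
  by apply: measurable_fun_limn_esup => k; apply/measurable_EFinP/L2_meas/LF.
have Gf : {ae mu, forall x, G k x @[k --> \oo] --> f x}.
  apply: filterS cG => x /cvg_ex[l Gl].
  have El : (G k x)%:E @[k --> \oo] --> l%:E.
    by apply/fine_cvgP; split; [exact: nearW|exact: Gl].
  rewrite /f is_cvg_limn_esupE; last by apply/cvg_ex; exists l%:E.
  by rewrite (cvg_lim _ El).
have key k j : (N k <= j)%N ->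
    L2 (fun x => F j x - f x) /\ sq (fun x => F j x - f x) <= (8^-1) ^+ k.
  move=> kj; have [] := @fatou_int (fun i x => (F j x - G i x) ^+ 2)
      (fun x => (F j x - f x) ^+ 2) ((8^-1) ^+ k).
  - by move=> i; case: (L2B (LF j) (LF (n i))).
  - by move=> i x; exact: sqr_ge0.
  - by apply: measurable_funX; apply: measurable_funB => //; exact: L2_meas (LF j).
  - by move=> x; exact: sqr_ge0.
  - apply: filterS Gf => x Gx; under eq_fun do rewrite expr2.
    by rewrite expr2; apply: cvgM; apply: cvgB => //; exact: cvg_cst.
  - near=> i; rewrite -sqE; apply: NP => //.
    by rewrite (leq_trans (nN k))// nmono//; near: i; exact: nbhs_infty_ge.
  move=> L1f ?; split; last by rewrite sqE.
  by split => //; apply: measurable_funB => //; exact: L2_meas (LF j).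
exists f.
  have [Lb _] := key 0%N _ (leqnn _).
  rewrite (_ : f = fun x => F (N 0%N) x - (F (N 0%N) x - f x)); first exact: L2B.
  by apply/funext => x; rewrite subKr.
apply/cvgrPdist_le => e ep.
have : geometric (1 : R) 8^-1 k @[k --> \oo] --> 0.
  by apply: cvg_geometric; rewrite ger0_norm ?invr_ge0// invf_lt1 ?ltr1n.
move=> /cvgrPdist_le /(_ e ep) [k _ /(_ k (leqnn _))]; rewrite /= mul1r sub0r normrN => ke.
near=> j; rewrite sub0r normrN ger0_norm ?sq_ge0//.
apply: le_trans (le_trans (ler_norm _) ke).
by apply: (key _ _ _).2; near: j; exact: nbhs_infty_ge.
Unshelve. all: by end_near. Qed.

End L1_L2_limits.

(** * Lebesgue measure on R^n *)

Section measurability.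
Context {R : realType} {n : nat}.
Implicit Types x y xi : 'rV[R]_n.

Lemma measurable_fun_dotrV d (T : measurableType d) (f g : T -> 'rV[R]_n) :
  measurable_fun setT f -> measurable_fun setT g ->
  measurable_fun setT (fun t => dotrV (f t) (g t)).
Proof.
move=> /measurable_fun_rVP mf /measurable_fun_rVP mg.
by apply: measurable_sum => i; apply: measurable_funM; [exact: mf|exact: mg].
Qed.

Lemma measurable_fun_addrV d (T : measurableType d) (f g : T -> 'rV[R]_n) :
  measurable_fun setT f -> measurable_fun setT g ->
  measurable_fun setT (fun t => f t + g t).
Proof.
move=> /measurable_fun_rVP mf /measurable_fun_rVP mg.
apply/measurable_fun_rVP => i; under eq_fun do rewrite mxE.
by apply: measurable_funD; [exact: mf|exact: mg].
Qed.

Lemma measurable_fun_scalerV d (T : measurableType d) (f : T -> 'rV[R]_n) c :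
  measurable_fun setT f -> measurable_fun setT (fun t => c *: f t).
Proof.
move=> /measurable_fun_rVP mf.
apply/measurable_fun_rVP => i; under eq_fun do rewrite mxE.
by apply: measurable_funM; [exact: measurable_cst|exact: mf].
Qed.

Lemma measurable_fun_opprV d (T : measurableType d) (f : T -> 'rV[R]_n) :
  measurable_fun setT f -> measurable_fun setT (fun t => - f t).
Proof.
move=> mf; under eq_fun do rewrite -scaleN1r.
exact: measurable_fun_scalerV.
Qed.

Lemma measurable_fun_subrV d (T : measurableType d) (f g : T -> 'rV[R]_n) :
  measurable_fun setT f -> measurable_fun setT g ->
  measurable_fun setT (fun t => f t - g t).
Proof. by move=> mf mg; apply: measurable_fun_addrV => //; exact: measurable_fun_opprV. Qed.

Lemma measurable_boxrV (A : 'I_n -> set R) : (forall i, measurable (A i)) ->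
  measurable [set x : 'rV[R]_n | forall i, A i (x 0 i)].
Proof.
move=> mA; have -> : [set x : 'rV[R]_n | forall i, A i (x 0 i)] =
    \bigcap_(i in [set: 'I_n]) ((fun x : 'rV[R]_n => x 0 i) @^-1` A i).
  by apply/seteqP; split => x /= Ax i; [move=> _|]; exact: Ax.
apply: fin_bigcap_measurable => // i _.
by rewrite -[X in measurable X]setTI; exact: measurable_coord.
Qed.

Definition cube (r : R) : set 'rV[R]_n := [set x | forall i, `|x 0 i| < r].

Lemma cubeE r : cube r = [set x | forall i, `]- r, r[%classic (x 0 i)].
Proof.
by apply/seteqP; split => x /= h i; have := h i; rewrite /= in_itv /= ltr_norml.
Qed.

Lemma measurable_cube r : measurable (cube r).
Proof. by rewrite cubeE; apply: (@measurable_boxrV (fun=> `]- r, r[%classic)). Qed.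

Lemma lebesgue_cube r : 0 <= r -> lebesgue_rV n (cube r) = ((2 * r) ^+ n)%:E.
Proof.
move=> r0; rewrite cubeE (lebesgue_rV_box (A := fun=> `]- r, r[%classic))//.
rewrite (eq_bigr (fun=> (2 * r)%:E)).
  by rewrite prodEFin prodr_const card_ord.
move=> i _; rewrite lebesgue_measure_itv /= lte_fin.
case: ltP => [_|]; first by rewrite -EFinB opprK mulr_natl mulr2n.
rewrite -subr_ge0 -opprD oppr_ge0 => h.
by congr EFin; lra.
Qed.

Lemma cube_finite r : (lebesgue_rV n (cube r) < +oo)%E.
Proof.
have [r0|r0] := leP 0 r; first by rewrite lebesgue_cube// ltry.
apply: (@le_lt_trans _ _ (lebesgue_rV n (cube 0))); last by rewrite lebesgue_cube// ltry.
apply: le_measure; rewrite ?inE; try exact: measurable_cube.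
by move=> x h i; exact: lt_trans (h i) r0.
Qed.

Lemma cube_mono r s : r <= s -> cube r `<=` cube s.
Proof. by move=> rs x h i; exact: lt_le_trans (h i) rs. Qed.

Lemma bigcup_cube : \bigcup_k cube k%:R = [set: 'rV[R]_n].
Proof.
apply/seteqP; split => // x _.
pose M := \sum_i `|x 0 i|.
have M0 : 0 <= M by apply: sumr_ge0.
exists (Num.truncn M).+1 => // i.
apply: le_lt_trans (truncnS_gt _); rewrite /M (bigD1 i)//= lerDl.
by apply: sumr_ge0.
Qed.

(** The sigma-algebra is generated by coordinates, so an open set is written as a union of boxes
    with rational centres and half-sides 1/(k+1), of which there are countably many. *)
Lemma open_measurable_rV (A : set 'rV[R]_n) : open A -> measurable A.
Proof.
move=> oA.
pose B (p : {ffun 'I_n -> rat} * nat) : set 'rV[R]_n :=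
  [set x | forall i, `]ratr (p.1 i) - p.2.+1%:R^-1, ratr (p.1 i) + p.2.+1%:R^-1[%classic (x 0 i)].
have -> : A = \bigcup_p (if `[< B p `<=` A >] then B p else set0).
  apply/seteqP; split => [x Ax|x [p _]]; last by case: asboolP => // BA; exact: BA.
  have /nbhs_ballP[e /= e0 eA] : nbhs x A by exact: open_nbhs_nbhs.
  (* A box containing x in each coordinate within 1/(k+1) of its centre lies within 2/(k+1) < e of
     x. *)
  pose k := Num.truncn (2 / e).
  have ke : 2 * k.+1%:R^-1 < e.
    by rewrite ltr_pdivrMr// mulrC -ltr_pdivrMr//; exact: truncnS_gt.
  have q i : {q : rat | ratr q \in `](x 0 i - k.+1%:R^-1), (x 0 i + k.+1%:R^-1)[}.
    by apply: cid; apply: rat_in_itvoo; rewrite ltrBlDr -addrA ltrDl addr_gt0.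
  exists ([ffun i => projT1 (q i)], k) => //.
  case: asboolP => [_ i /=|[]].
    rewrite ffunE; case: (q i) => r /=; rewrite !in_itv /= => /andP[h1 h2].
    by rewrite ltrBlDr h2 -ltrBlDr h1.
  move=> y By; apply: eA; split => // i j; rewrite (ord1 i).
  have := By j; rewrite /= ffunE; case: (q j) => r /=; rewrite !in_itv /= => /andP[h1 h2] /andP[h3 h4].
  rewrite /ball /= ltr_norml; move: ke h1 h2 h3 h4; set d := k.+1%:R^-1 => ke *.
  by apply/andP; split; lra.
apply: countable_bigcupT_measurable; first exact: countableP.
move=> p; case: asboolP => // _.
by apply: (@measurable_boxrV (fun i => `]ratr (p.1 i) - p.2.+1%:R^-1, ratr (p.1 i) + p.2.+1%:R^-1[%classic)).
Qed.

Lemma closed_measurable_rV (A : set 'rV[R]_n) : closed A -> measurable A.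
Proof. 
move=> cA; rewrite -[A]setCK; apply: measurableC; apply: open_measurable_rV.
exact: closed_openC. Qed.

Lemma continuous_measurable_rV (f : 'rV[R]_n -> R) : continuous f -> measurable_fun setT f.
Proof.
move=> /continuousP cf; apply: (measurability _ (RGenOpens.measurableE R)).
move=> _ [_ [a [b ->] <-]]; rewrite setTI; apply: open_measurable_rV.
exact/cf/interval_open.
Qed.

End measurability.

(** * Integration coordinate by coordinate, translations and reflections *)

Section iterated_integral.
Context {R : realType}.

Lemma consrV_ord0 n (p : R * 'rV[R]_n) : consrV p 0 ord0 = p.1.
Proof. by rewrite -[in RHS](consrVK p). Qed.

Lemma consrV_lift n (p : R * 'rV[R]_n) i : consrV p 0 (lift ord0 i) = p.2 0 i.
Proof.
rewrite -[in RHS](consrVK p) /= [RHS]mxE.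
by apply: (congr1 (consrV p 0)); exact/val_inj.
Qed.

Lemma ge0_integral_rVS n (h : 'rV[R]_n.+1 -> \bar R) :
  measurable_fun setT h -> (forall x, 0 <= h x)%E ->
  (\int[lebesgue_rV n.+1]_x h x =
   \int[lebesgue_measure]_t \int[lebesgue_rV n]_x h (consrV (t, x)))%E.
Proof.
move=> mh h0.
transitivity (\int[pushforward (@lebesgue_measure R \x lebesgue_rV n) (@consrV R n)]_x h x)%E.
  by refine (eq_measure_integral _ _).
rewrite ge0_integral_pushforward//; last exact: measurable_consrV.
rewrite preimage_setT fubini_tonelli1//=.
by apply: measurableT_comp => //; exact: measurable_consrV.
Unshelve. all: exact: measurable_consrV.
Qed.

Lemma measurable_consrV2 n (h : 'rV[R]_n.+1 -> \bar R) : measurable_fun setT h ->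
  measurable_fun setT (fun p : R * 'rV[R]_n => h (consrV p)).
Proof. by move=> mh; apply: measurableT_comp => //; exact: measurable_consrV. Qed.

(** The condition |s| = 1 covers translations and reflections together. The image measure agrees
    with Lebesgue measure on half-open intervals; a reflection moves the closed end to the other
    side, which does not change the length. *)
Lemma ge0_integral_affine1 (s a : R) (h : R -> \bar R) : `|s| = 1 ->
  measurable_fun setT h -> (forall x, 0 <= h x)%E ->
  (\int[lebesgue_measure]_t h (a + s * t)%R = \int[lebesgue_measure]_t h t)%E.
Proof.
move=> s1 mh h0.
pose phi t : measurableTypeR R := a + s * t.
have mphi : measurable_fun setT (phi : measurableTypeR R -> measurableTypeR R).
  by apply: measurable_funD => //; exact: measurable_funM.
transitivity (\int[pushforward (@lebesgue_measure R) phi]_t h t)%E.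
  by rewrite ge0_integral_pushforward.
apply: eq_measure_integral => A mA _.
apply/esym; apply: lebesgue_measure_unique => // _ [[x y] _ <-] /=.
rewrite /pushforward.
have [s0|s0|s0] := ltgtP s 0; last by rewrite s0 normr0 in s1; move/eqP: s1; rewrite eq_sym oner_eq0.
  have {s1 s0}sE : s = -1 by move: s1; rewrite ltr0_norm// => <-; rewrite opprK.
  rewrite [phi @^-1` _](_ : _ = `[(a - y), (a - x)[%classic); last first.
    apply/seteqP; split => t; rewrite /phi sE /= !in_itv /= => /andP[h1 h2];
      by apply/andP; split; lra.
  rewrite !lebesgue_measure_itv /= !lte_fin.
  by rewrite ltrD2l ltrN2; case: ifP => // _; rewrite -!EFinB; congr EFin; ring.
have {s1 s0}sE : s = 1 by move: s1; rewrite gtr0_norm.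
rewrite [phi @^-1` _](_ : _ = `](x - a), (y - a)]%classic); last first.
  apply/seteqP; split => t; rewrite /phi sE /= !in_itv /= => /andP[h1 h2];
    by apply/andP; split; lra.
rewrite !lebesgue_measure_itv /= !lte_fin ltrD2r.
by case: ifP => // _; rewrite -!EFinB; congr EFin; ring.
Qed.

Lemma ge0_integral_affine (s : R) n (a : 'rV[R]_n) (h : 'rV[R]_n -> \bar R) : `|s| = 1 ->
  measurable_fun setT h -> (forall x, 0 <= h x)%E ->
  (\int[lebesgue_rV n]_x h (a + s *: x)%R = \int[lebesgue_rV n]_x h x)%E.
Proof.
move=> s1; elim: n a h => [|n ih] a h mh h0.
  by apply: eq_integral => x _; congr h; apply/rowP; case.
have maff m (b : 'rV[R]_m) : measurable_fun setT (fun x : 'rV[R]_m => b + s *: x).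
  by apply: measurable_fun_addrV => //; apply: measurable_fun_scalerV.
rewrite (ge0_integral_rVS (measurableT_comp mh (maff _ a)) (fun x => h0 _)).
rewrite (ge0_integral_rVS mh h0).
have [[b c] <-] : exists p, consrV p = a by exists (unconsrV a); rewrite unconsrVK.
have E t (x : 'rV[R]_n) : consrV (b, c) + s *: consrV (t, x) = consrV (b + s * t, c + s *: x).
  by apply/rowP => i; have [j ->|->] := unliftP ord0 i;
    rewrite [LHS]mxE [X in _ + X]mxE ?consrV_lift ?consrV_ord0 //= !mxE.
under eq_integral => t _ do under eq_integral => x _ do rewrite /= E.
under eq_integral => t _.
  rewrite (ih c (fun y => h (consrV ((b + s * t)%R, y))))//; last first.
    by apply: (measurableT_comp (measurable_consrV2 mh)); exact: pair1_measurable.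
  over.
rewrite (ge0_integral_affine1 b (h := fun t => \int[lebesgue_rV n]_x h (consrV (t, x)))%E)//.
  exact: (measurable_fun_fubini_tonelli_F (fun p => h (consrV p)) (measurable_consrV2 mh)).
by move=> t; exact: integral_ge0.
Qed.

End iterated_integral.

Section invariance.
Context {R : realType} {n : nat}.
Local Notation leb := (lebesgue_rV n : {sigma_finite_measure set 'rV[R]_n -> \bar R}).
Implicit Types (f : 'rV[R]_n -> R) (a : 'rV[R]_n).

Lemma measurable_affine (s : R) (a : 'rV[R]_n) : measurable_fun setT (fun x : 'rV[R]_n => a + s *: x).
Proof. by apply: measurable_fun_addrV => //; apply: measurable_fun_scalerV. Qed.

Lemma L1_affine f (s : R) a : `|s| = 1 -> L1 leb f ->
  L1 leb (fun x : 'rV[R]_n => f (a + s *: x)) /\ Int leb (fun x : 'rV[R]_n => f (a + s *: x)) = Int leb f.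
Proof.
move=> s1 Lf; have mf := measurable_int _ Lf.
have maff := measurable_affine s a.
split.
  apply/integrableP; split; first exact: (measurableT_comp mf maff).
  have /integrableP[_] := Lf; rewrite -(ge0_integral_affine a s1)//.
  exact: measurableT_comp.
rewrite /Int /Rintegral; congr fine; rewrite integralE [RHS]integralE.
have mp : measurable_fun setT (fun x => (f x)%:E)^\+%E by exact: measurable_funepos mf.
have mn : measurable_fun setT (fun x => (f x)%:E)^\-%E by exact: measurable_funeneg mf.
congr (_ - _)%E.
  rewrite -[RHS](ge0_integral_affine a s1 mp); last by move=> x; exact: funepos_ge0.
  by apply: eq_integral => x _; rewrite !funepos.unlock.
rewrite -[RHS](ge0_integral_affine a s1 mn); last by move=> x; exact: funeneg_ge0.
by apply: eq_integral => x _; rewrite !funeneg.unlock.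
Qed.

Lemma L1_shift f a : L1 leb f -> L1 leb (fun x : 'rV[R]_n => f (x + a)).
Proof.
move=> Lf; have [] := @L1_affine f 1 a (normr1 _) Lf.
by under eq_fun do rewrite scale1r addrC.
Qed.

Lemma Int_shift f a : L1 leb f -> Int leb (fun x : 'rV[R]_n => f (x + a)) = Int leb f.
Proof.
move=> Lf; have [_ <-] := @L1_affine f 1 a (normr1 _) Lf.
by congr Int; apply/funext => x; rewrite scale1r addrC.
Qed.

Lemma L1_refl f a : L1 leb f -> L1 leb (fun x : 'rV[R]_n => f (a - x)).
Proof.
move=> Lf; have [] := @L1_affine f (-1) a (normrN1 _) Lf.
by under eq_fun do rewrite scaleN1r.
Qed.

Lemma Int_refl f a : L1 leb f -> Int leb (fun x : 'rV[R]_n => f (a - x)) = Int leb f.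
Proof.
move=> Lf; have [_ <-] := @L1_affine f (-1) a (normrN1 _) Lf.
by congr Int; apply/funext => x; rewrite scaleN1r.
Qed.

Lemma measurable_shift f a : measurable_fun setT f -> measurable_fun setT (fun x : 'rV[R]_n => f (x + a)).
Proof. by move=> mf; apply: (measurableT_comp mf); apply: measurable_fun_addrV. Qed.

Lemma measurable_refl f a : measurable_fun setT f -> measurable_fun setT (fun x : 'rV[R]_n => f (a - x)).
Proof. by move=> mf; apply: (measurableT_comp mf); apply: measurable_fun_subrV. Qed.

Lemma L2_shift f a : L2 leb f -> L2 leb (fun x : 'rV[R]_n => f (x + a)).
Proof. by move=> [mf Lf]; split; [exact: measurable_shift|exact: (L1_shift a Lf)]. Qed.

Lemma L2_oppr f : L2 leb f -> L2 leb (fun x : 'rV[R]_n => f (- x)).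
Proof.
move=> [mf Lf]; split.
  by have := @measurable_refl f 0 mf; under eq_fun do rewrite sub0r.
by have := @L1_refl _ 0 Lf; under eq_fun do rewrite sub0r.
Qed.

Lemma Int_oppr f : L1 leb f -> Int leb (fun x : 'rV[R]_n => f (- x)) = Int leb f.
Proof. by move=> Lf; rewrite -(Int_refl 0 Lf); congr Int; apply/funext => x; rewrite sub0r. Qed.

Lemma sq_oppr f : L2 leb f -> sq leb (fun x : 'rV[R]_n => f (- x)) = sq leb f.
Proof. by move=> [_ Lf]; rewrite !sqE (Int_oppr Lf). Qed.

End invariance.

(** * Gaussians and their transforms *)

Section derivatives.
Context {R : realType}.
Implicit Types (f g : R -> R) (x a b k : R).

Lemma is_derive_mul f g x a b : is_derive x 1 f a -> is_derive x 1 g b ->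
  is_derive x 1 (fun t => f t * g t) (f x * b + g x * a).
Proof. by move=> df dg; exact: (is_deriveM df dg). Qed.

Lemma is_derive_comp_expR f x a : is_derive x 1 f a ->
  is_derive x 1 (fun t => expR (f t)) (expR (f x) * a).
Proof. by move=> df; exact: (is_derive1_comp (is_derive_expR (f x)) df). Qed.

Lemma is_derive_comp_sin f x a : is_derive x 1 f a ->
  is_derive x 1 (fun t => sin (f t)) (cos (f x) * a).
Proof. by move=> df; exact: (is_derive1_comp (is_derive_sin (f x)) df). Qed.

Lemma is_derive_comp_cos f x a : is_derive x 1 f a ->
  is_derive x 1 (fun t => cos (f t)) (- sin (f x) * a).
Proof. by move=> df; exact: (is_derive1_comp (is_derive_cos (f x)) df). Qed.

Lemma is_derive_mulk k x : is_derive x 1 (fun t => k * t) k.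
Proof.
have := is_derive_mul (is_derive_cst k x 1) (is_derive_id x (1 : R)).
by rewrite mulr1 mulr0 addr0.
Qed.

Lemma is_derive_mulk_sqr k x : is_derive x 1 (fun t => k * t ^+ 2) (2 * k * x).
Proof.
have := is_derive_mul (is_derive_mulk k x) (is_derive_id x (1 : R)).
rewrite (_ : (fun t => _) = fun t => k * t ^+ 2); last first.
  by apply/funext => t; rewrite expr2 mulrA.
by rewrite (_ : _ + _ = 2 * k * x)//=; ring.
Qed.

Lemma is_derive_continuous f (df : R -> R) : (forall x, is_derive x 1 f (df x)) -> continuous f.
Proof.
move=> dff x; apply: differentiable_continuous; apply/derivable1_diffP.
exact: (@ex_derive _ _ _ _ _ _ _ (dff x)).
Qed.

Lemma is_derive_int d (Y : measurableType d) (mu : {measure set Y -> \bar R})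
    (f f' : R -> Y -> R) (G : Y -> R) :
  (forall x y, is_derive x 1 (f^~ y) (f' x y)) ->
  (forall x, L1 mu (f x)) -> L1 mu G -> (forall x y, `|f' x y| <= G y) ->
  forall x, is_derive x 1 (fun t => Int mu (f t)) (Int mu (f' x)).
Proof.
move=> df Lf LG fG x.
have E t y : partial1of2 f t y = f' t y.
  by rewrite /partial1of2 derive1E; apply: derive_val.
have xI : `](x - 1), (x + 1)[%classic x.
  by rewrite /= in_itv /= ltrBlDr ltrDl ltr01.
have G0 y : 0 <= G y by exact: le_trans (fG 0 y).
have D1 : forall t y, `](x - 1), (x + 1)[%classic t -> setT y -> derivable (f^~ y) t 1.
  by move=> t y _ _; exact: (@ex_derive _ _ _ _ _ _ _ (df t y)).
have D2 : forall t y, `](x - 1), (x + 1)[%classic t -> setT y -> `|partial1of2 f t y| <= G y.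
  by move=> t y _ _; rewrite E.
apply: DeriveDef.
  exact: (@derivable_under_integral _ _ _ mu f setT measurableT x _ _ xI (fun t _ => Lf t) D1 G G0 LG D2).
rewrite -derive1E.
rewrite (@differentiation_under_integral _ _ _ mu f setT measurableT x _ _ xI (fun t _ => Lf t) D1 G G0 LG D2).
by congr (Rintegral mu); apply/funext => y; rewrite E.
Qed.

End derivatives.

Section gauss1.
Context {R : realType}.
Local Notation leb1 := (@lebesgue_measure R).
Variable c : R.
Hypothesis c0 : 0 < c.

Definition gauss1 (b t : R) : R := expR (- b * t ^+ 2).

Lemma measurable_gauss1 b : measurable_fun setT (gauss1 b).
Proof.
apply: (measurableT_comp (@measurable_expR R)).
by apply: measurable_funM => //; exact: measurable_funX.
Qed.

(** Normalization of the normal density of variance 1/(2c). *)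
Lemma integral_gauss1 : (\int[leb1]_t (gauss1 c t)%:E = (Num.sqrt (pi / c))%:E)%E.
Proof.
pose s := Num.sqrt (2 * c)^-1.
have c2 : 0 < (2 * c)^-1 by rewrite invr_gt0 mulr_gt0.
have s0 : s != 0 by rewrite gt_eqF// sqrtr_gt0.
have s2 : s ^+ 2 = (2 * c)^-1 by rewrite sqr_sqrtr// ltW.
have P0 := normal_peak_gt0 s0.
have E t : gauss1 c t = (normal_peak s)^-1 * normal_pdf 0 s t.
  rewrite normal_pdfE// mulKf ?gt_eqF// /normal_fun /gauss1 s2.
  by congr expR; rewrite -mulr_natl; field; rewrite ?gt_eqF.
under eq_integral do rewrite E EFinM.
rewrite integralZl//; last exact: integrable_normal_pdf.
rewrite integral_normal_pdf mule1; congr EFin.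
rewrite /normal_peak invrK s2; congr Num.sqrt.
by rewrite -mulr_natl; field; rewrite gt_eqF.
Qed.

Lemma gauss1_ge0 b t : 0 <= gauss1 b t.
Proof. exact: expR_ge0. Qed.

End gauss1.

Section gauss1_fourier.
Context {R : realType}.
Local Notation leb1 := (@lebesgue_measure R).

Lemma L1_gauss1 (c : R) : 0 < c -> L1 leb1 (gauss1 c).
Proof.
move=> c0; apply/L1_ge0P; first exact: measurable_gauss1.
  by move=> t; exact: gauss1_ge0.
by rewrite integral_gauss1// ltry.
Qed.

Variable c : R.
Hypothesis c0 : 0 < c.

Let half0 : 0 < c / 2. Proof. by rewrite divr_gt0. Qed.

(** Half of the exponent absorbs the factor t: exp(c t^2 / 2) >= 1 + c t^2 / 2, and (1 + 1/c)(1 + c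
    t^2 / 2) >= 1 + t^2 / 2 >= |t|. *)
Lemma norm_mul_gauss1 (t : R) : `|t * gauss1 c t| <= (1 + c^-1) * gauss1 (c / 2) t.
Proof.
rewrite normrM (ger0_norm (gauss1_ge0 _ _)) /gauss1.
rewrite (_ : - c * t ^+ 2 = - (c / 2 * t ^+ 2) + - (c / 2) * t ^+ 2); last by field.
rewrite expRD mulrA ler_wpM2r ?expR_ge0//.
rewrite expRN ler_pdivrMr ?expR_gt0//.
have h : 1 + c / 2 * t ^+ 2 <= expR (c / 2 * t ^+ 2) by exact: expR_ge1Dx.
have ci : 0 <= c^-1 by rewrite invr_ge0 ltW.
apply: le_trans (ler_wpM2l _ h); last by rewrite addr_ge0.
rewrite mulrDl mul1r mulrDr mulr1 (_ : c^-1 * (c / 2 * t ^+ 2) = t ^+ 2 / 2); last first.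
  by field; rewrite gt_eqF.
have t2 : 0 <= c / 2 * t ^+ 2 by rewrite mulr_ge0 ?sqr_ge0// ltW.
rewrite -[t ^+ 2]real_normK ?num_real//.
rewrite -[t ^+ 2]real_normK ?num_real// in t2.
by have := sqr_ge0 (`|t| - 1); nra.
Qed.

Lemma L1_mul_gauss1 : L1 leb1 (fun t => t * gauss1 c t).
Proof.
have H : L1 leb1 (fun t => (1 + c^-1) * gauss1 (c / 2) t).
  by apply/L1Z/L1_gauss1.
apply: L1_le H; last exact: norm_mul_gauss1.
by apply: measurable_funM => //; exact: measurable_gauss1.
Qed.

Let msin w : measurable_fun setT (fun t : R => sin (w * t)).
Proof.
apply: continuous_measurable_fun.
by apply: is_derive_continuous => x; exact: is_derive_comp_sin (is_derive_mulk w x).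
Qed.

Let mcos w : measurable_fun setT (fun t : R => cos (w * t)).
Proof.
apply: continuous_measurable_fun.
by apply: is_derive_continuous => x; exact: is_derive_comp_cos (is_derive_mulk w x).
Qed.

Let L1cos w : L1 leb1 (fun t => gauss1 c t * cos (w * t)).
Proof.
apply: (@L1_bM _ _ _ _ _ _ 1); [exact: L1_gauss1|exact: mcos|].
by move=> t; exact: cos_max.
Qed.

Let L1sin w : L1 leb1 (fun t => (t * gauss1 c t) * sin (w * t)).
Proof.
apply: (@L1_bM _ _ _ _ _ _ 1); [exact: L1_mul_gauss1|exact: msin|].
by move=> t; exact: sin_max.
Qed.

Lemma cvg_gauss1_nat : gauss1 c k%:R @[k --> \oo] --> (0 : R).
Proof.
have : geometric 1 (expR (- c)) k @[k --> \oo] --> (0 : R).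
  by apply: cvg_geometric; rewrite ger0_norm ?expR_ge0// expR_lt1 oppr_lt0.
apply: squeeze0 => k /=; rewrite ger0_norm ?gauss1_ge0// mul1r -expRM_natl.
rewrite /gauss1 ler_expR mulrC ler_wnM2r ?oppr_le0 ?(ltW c0)//.
case: k => [|k]; first by rewrite expr0n.
by rewrite expr2 ler_peMr// ler1n.
Qed.

(* integration by parts on [-k, k], letting k tend to infinity *)
Lemma Int_mul_gauss1_sin w :
  Int leb1 (fun t => (t * gauss1 c t) * sin (w * t)) =
  w / (2 * c) * Int leb1 (fun t => gauss1 c t * cos (w * t)).
Proof.
pose F t := gauss1 c t * sin (w * t).
pose f t := w * (gauss1 c t * cos (w * t)) - 2 * c * ((t * gauss1 c t) * sin (w * t)).
have dF (t : R) : is_derive t 1 F (f t).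
  have := is_derive_mul (is_derive_comp_expR (is_derive_mulk_sqr (- c) t))
    (is_derive_comp_sin (is_derive_mulk w t)).
  rewrite (_ : _ + _ = f t)//= /f /gauss1; ring.
have Lf : L1 leb1 f.
  by apply: L1B; [exact: L1Z (L1cos w)|exact: L1Z (L1sin w)].
have cf : continuous f.
  have cg : continuous (gauss1 c).
    by apply: is_derive_continuous => x; exact: is_derive_comp_expR (is_derive_mulk_sqr (- c) x).
  have cc : continuous (fun t => cos (w * t)).
    by apply: is_derive_continuous => x; exact: is_derive_comp_cos (is_derive_mulk w x).
  have cs : continuous (fun t => sin (w * t)).
    by apply: is_derive_continuous => x; exact: is_derive_comp_sin (is_derive_mulk w x).
  move=> x; apply: cvgB; apply: cvgM; try exact: cvg_cst.
    by apply: cvgM; [exact: cg|exact: cc].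
  by apply: cvgM; [apply: cvgM; [exact: cvg_id|exact: cg]|exact: cs].
have cF := is_derive_continuous dF.
have FTC k : Int leb1 (fun t => f t * \1_(`[- k.+1%:R, k.+1%:R]%classic) t) = F k.+1%:R - F (- k.+1%:R).
  have kk : - k.+1%:R < k.+1%:R :> R by rewrite gtrN.
  have H1 : {within `[- k.+1%:R, k.+1%:R], continuous f} by exact: continuous_subspaceT.
  have H2 : derivable_oo_LRcontinuous F (- k.+1%:R) k.+1%:R.
    split.
    - by move=> x _; exact: (@ex_derive _ _ _ _ _ _ _ (dF x)).
    - exact: cvg_at_right_filter (cF _).
    - exact: cvg_at_left_filter (cF _).
  have H3 : {in `]- k.+1%:R, k.+1%:R[, F^`()%classic =1 f}.
    by move=> x _; rewrite derive1E; apply: derive_val.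
  have H := continuous_FTC2 kk H1 H2 H3.
  rewrite integral_mkcond in H.
  rewrite /Int /Rintegral (_ : (\int[leb1]_x _)%E = (F k.+1%:R - F (- k.+1%:R))%:E)//.
  rewrite EFinB -H; apply: eq_integral => x _; rewrite /patch indicE.
  by case: ifP => _; rewrite ?mulr1 ?mulr0.
have lim1 : Int leb1 (fun t => f t * \1_(`[- k.+1%:R, k.+1%:R]%classic) t) @[k --> \oo] --> Int leb1 f.
  have M1 k : measurable_fun setT (fun t : measurableTypeR R => f t * \1_(`[- k.+1%:R, k.+1%:R]%classic) t).
    by apply: measurable_funM; [exact: L1_meas Lf|exact: measurable_indic].
  have M2 := L1_meas Lf.
  have := @int_dominated_cvg _ _ _ leb1 _ f (fun t => `|f t|) M1 M2.
  case=> //.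
  - apply: aeW => t; apply: cvg_near_cst; near=> k.
    rewrite indicE mem_set ?mulr1//= in_itv /= -ler_norml.
    apply: (@le_trans _ _ k%:R); last by rewrite ler_nat.
    by near: k; exact: nbhs_infty_ger.
  - exact: L1_norm.
  - move=> k t; rewrite normrM ler_piMr// indicE.
    by case: (_ \in _); rewrite ?normr1 ?normr0.
have lim2 : F k.+1%:R - F (- k.+1%:R) @[k --> \oo] --> (0 : R).
  have h : 2 * gauss1 c k.+1%:R @[k --> \oo] --> (0 : R).
    rewrite -[X in _ --> X](mulr0 2); apply: cvgMr.
    by have := cvg_gauss1_nat; rewrite -(cvg_shiftS (fun k => gauss1 c k%:R)).
  apply: squeeze0 h => k; rewrite (le_trans (ler_normB _ _))// mulr_natl mulr2n.
  by rewrite /F !normrM /gauss1 sqrrN; apply: lerD;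
    rewrite ger0_norm ?expR_ge0// ler_piMr ?expR_ge0 ?sin_max.
have If0 : Int leb1 f = 0.
  by rewrite (_ : (fun k => _) = fun k => F k.+1%:R - F (- k.+1%:R)) in lim1;
    [exact: cvg_unique lim1 lim2|apply/funext => k; rewrite FTC].
move: If0; rewrite /f intB; [|exact: L1Z (L1cos w)|exact: L1Z (L1sin w)].
rewrite (intZl _ (L1cos w)) (intZl _ (L1sin w)).
move=> /eqP; rewrite subr_eq0 => /eqP E.
by apply: (@mulfI _ (2 * c)); [rewrite mulf_neq0// gt_eqF|rewrite -E; field; rewrite gt_eqF].
Unshelve. all: by end_near. Qed.

(** Differentiation under the integral followed by the integration by parts above gives F' = - (w /
    2c) F, so F(w) exp(w^2 / 4c) is constant. *)
Lemma Int_gauss1_cos w :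
  Int leb1 (fun t => gauss1 c t * cos (w * t)) = Num.sqrt (pi / c) * expR (- (w ^+ 2 / (4 * c))).
Proof.
pose F w := Int leb1 (fun t => gauss1 c t * cos (w * t)).
have dF (x : R) : is_derive x 1 F (- (x / (2 * c)) * F x).
  rewrite mulNr -Int_mul_gauss1_sin -intN; last exact: L1sin.
  have LG : L1 leb1 (fun t => `|t * gauss1 c t|) by apply: L1_norm; exact: L1_mul_gauss1.
  have H1 (y t : R) : is_derive y 1 (fun x : R => gauss1 c t * cos (x * t))
      (- (t * gauss1 c t * sin (y * t))).
    have dl : is_derive y 1 (fun z : R => z * t) t.
      by under eq_fun do rewrite mulrC; exact: is_derive_mulk.
    have := is_derive_mul (is_derive_cst (gauss1 c t) y 1) (is_derive_comp_cos dl).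
    by rewrite (_ : _ + _ = - (t * gauss1 c t * sin (y * t)))//=; ring.
  have H2 (y t : R) : `|- (t * gauss1 c t * sin (y * t))| <= `|t * gauss1 c t|.
    by rewrite normrN normrM ler_piMr// sin_max.
  exact: (@is_derive_int _ _ _ leb1 _ _ _ H1 L1cos LG H2 x).
pose H x := F x * expR ((4 * c)^-1 * x ^+ 2).
have dH (x : R) : is_derive x 1 H 0.
  have := is_derive_mul (dF x) (is_derive_comp_expR (is_derive_mulk_sqr (4 * c)^-1 x)).
  by rewrite (_ : _ + _ = 0)//; field; rewrite gt_eqF.
have := is_derive_0_is_cst w 0 dH; rewrite /H expr0n mulr0 expR0 mulr1.
have -> : F 0 = Num.sqrt (pi / c).
  rewrite /F; under eq_fun do rewrite mul0r cos0 mulr1.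
  by rewrite /Int /Rintegral integral_gauss1.
move=> <-; rewrite -/(F w) -mulrA -expRD.
by rewrite [X in expR X](_ : _ = 0) ?expR0 ?mulr1//; ring.
Qed.

End gauss1_fourier.

Section gauss.
Context {R : realType}.
Local Notation leb n := (lebesgue_rV n : {sigma_finite_measure set 'rV[R]_n -> \bar R}).

Lemma dotrVC n (x y : 'rV[R]_n) : dotrV x y = dotrV y x.
Proof. by apply: eq_bigr => i _; rewrite mulrC. Qed.

Lemma dotrVDl n (x y z : 'rV[R]_n) : dotrV (x + y) z = dotrV x z + dotrV y z.
Proof. by rewrite -big_split; apply: eq_bigr => i _; rewrite mxE mulrDl. Qed.

Lemma dotrVNl n (x z : 'rV[R]_n) : dotrV (- x) z = - dotrV x z.
Proof. by rewrite -sumrN; apply: eq_bigr => i _; rewrite mxE mulNr. Qed.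

Lemma dotrVNr n (x z : 'rV[R]_n) : dotrV z (- x) = - dotrV z x.
Proof. by rewrite dotrVC dotrVNl dotrVC. Qed.

Lemma dotrVBl n (x y z : 'rV[R]_n) : dotrV (x - y) z = dotrV x z - dotrV y z.
Proof. by rewrite dotrVDl dotrVNl. Qed.

Lemma dotrV_ge0 n (x : 'rV[R]_n) : 0 <= dotrV x x.
Proof. by apply: sumr_ge0 => i _; rewrite -expr2 sqr_ge0. Qed.

Lemma sqr_coord_le_dotrV n (x : 'rV[R]_n) i : x 0 i ^+ 2 <= dotrV x x.
Proof.
by rewrite /dotrV (bigD1 i)//= -expr2 lerDl sumr_ge0// => j _; rewrite -expr2 sqr_ge0.
Qed.

Lemma dotrV_consrV n (p q : R * 'rV[R]_n) : dotrV (consrV p) (consrV q) = p.1 * q.1 + dotrV p.2 q.2.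
Proof.
rewrite /dotrV big_ord_recl !consrV_ord0; congr (_ + _).
by apply: eq_bigr => i _; rewrite !consrV_lift.
Qed.

Definition gaussn (c : R) n (x : 'rV[R]_n) : R := expR (- c * dotrV x x).

Lemma gaussn_ge0 c n (x : 'rV[R]_n) : 0 <= gaussn c x.
Proof. exact: expR_ge0. Qed.

Lemma gaussnN c n (x : 'rV[R]_n) : gaussn c (- x) = gaussn c x.
Proof. by rewrite /gaussn dotrVNl dotrVNr opprK. Qed.

Lemma gaussn_le1 c n (x : 'rV[R]_n) : 0 <= c -> gaussn c x <= 1.
Proof.
by move=> c0; rewrite /gaussn -[leRHS]expR0 ler_expR mulNr oppr_le0 mulr_ge0// dotrV_ge0.
Qed.

Lemma measurable_gaussn c n : measurable_fun setT (@gaussn c n).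
Proof.
apply: (measurableT_comp (@measurable_expR R)).
by apply: measurable_funM => //; exact: measurable_fun_dotrV.
Qed.

Lemma gaussn_consrV c n (p : R * 'rV[R]_n) : gaussn c (consrV p) = gauss1 c p.1 * gaussn c p.2.
Proof. by rewrite /gaussn /gauss1 dotrV_consrV mulrDr expRD expr2. Qed.

Variable c : R.
Hypothesis c0 : 0 < c.

Lemma integral_gaussn n :
  (\int[leb n]_x (gaussn c x)%:E = (Num.sqrt (pi / c) ^+ n)%:E)%E.
Proof.
elim: n => [|n ih].
  rewrite integral_dirac//; last by apply/measurable_EFinP; exact: measurable_gaussn.
  by rewrite diracE mem_set// mul1e /gaussn /dotrV big_ord0 mulr0 expR0.
rewrite ge0_integral_rVS; first last.
- by move=> x; rewrite lee_fin gaussn_ge0.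
- by apply/measurable_EFinP; exact: measurable_gaussn.
under eq_integral => t _.
  under eq_integral => x _ do rewrite gaussn_consrV EFinM /=.
  rewrite ge0_integralZl//; first last.
  - by rewrite lee_fin gauss1_ge0.
  - by move=> x _; rewrite lee_fin gaussn_ge0.
  - by apply/measurable_EFinP; exact: measurable_gaussn.
  rewrite ih muleC /=; over.
rewrite ge0_integralZl//; first last.
- by move=> x _; rewrite lee_fin gauss1_ge0.
- by apply/measurable_EFinP; exact: measurable_gauss1.
by rewrite integral_gauss1// -EFinM exprSr.
Qed.

Lemma L1_gaussn n : L1 (leb n) (@gaussn c n).
Proof.
apply/L1_ge0P; first exact: measurable_gaussn.
  by move=> t; exact: gaussn_ge0.
by rewrite integral_gaussn ltry.
Qed.

Lemma measurable_cos_dotrV n (xi : 'rV[R]_n) : measurable_fun setT (fun x => cos (2 * pi * dotrV x xi)).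
Proof.
apply: (@measurableT_comp _ _ _ _ _ _ (@cos R)).
  by apply: continuous_measurable_fun; exact: continuous_cos.
by apply: measurable_funM => //; apply: measurable_fun_dotrV => //; exact: measurable_cst.
Qed.

Lemma measurable_sin_dotrV n (xi : 'rV[R]_n) : measurable_fun setT (fun x => sin (2 * pi * dotrV x xi)).
Proof.
apply: (@measurableT_comp _ _ _ _ _ _ (@sin R)).
  by apply: continuous_measurable_fun; exact: continuous_sin.
by apply: measurable_funM => //; apply: measurable_fun_dotrV => //; exact: measurable_cst.
Qed.

Lemma L1_gaussn_cos n xi : L1 (leb n) (fun x => gaussn c x * cos (2 * pi * dotrV x xi)).
Proof.
apply: (@L1_bM _ _ _ _ _ _ 1); [exact: L1_gaussn|exact: measurable_cos_dotrV|].
by move=> t; exact: cos_max.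
Qed.

Lemma L1_gaussn_sin n xi : L1 (leb n) (fun x => gaussn c x * sin (2 * pi * dotrV x xi)).
Proof.
apply: (@L1_bM _ _ _ _ _ _ 1); [exact: L1_gaussn|exact: measurable_sin_dotrV|].
by move=> t; exact: sin_max.
Qed.

Lemma Int_odd n (h : 'rV[R]_n -> R) : L1 (leb n) h -> (forall x, h (- x) = - h x) -> Int (leb n) h = 0.
Proof.
move=> Lh hodd; have := Int_oppr Lh.
rewrite (_ : (fun x => h (- x)) = fun x => - h x); last by apply/funext.
rewrite intN// => /eqP; rewrite eq_sym -subr_eq0 opprK -mulr2n mulrn_eq0 /= => /eqP.
exact.
Qed.

Lemma Int_gaussn_sin n xi : Int (leb n) (fun x => gaussn c x * sin (2 * pi * dotrV x xi)) = 0.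
Proof.
apply: Int_odd; first exact: L1_gaussn_sin.
by move=> x; rewrite gaussnN dotrVNl mulrN sinN mulrN.
Qed.

Lemma Int_gaussn n : Int (leb n) (@gaussn c n) = Num.sqrt (pi / c) ^+ n.
Proof. by rewrite /Int /Rintegral integral_gaussn. Qed.

(** Induction on the dimension. The cosine of a sum splits off the first coordinate; the term with
    the sine of the remaining ones integrates to 0 by oddness. *)
Lemma Int_gaussn_cos n xi : Int (leb n) (fun x => gaussn c x * cos (2 * pi * dotrV x xi)) =
  Num.sqrt (pi / c) ^+ n * gaussn (pi ^+ 2 / c) xi.
Proof.
elim: n xi => [|n ih] xi.
  rewrite [X in Int _ X](_ : _ = @gaussn c 0); last first.
    by apply/funext => x; rewrite /dotrV big_ord0 mulr0 cos0 mulr1.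
  by rewrite Int_gaussn expr0 mul1r /gaussn /dotrV big_ord0 mulr0 expR0.
have [[tau eta] <-] : exists p, consrV p = xi by exists (unconsrV xi); rewrite unconsrVK.
(* nonnegative integrand, so that Tonelli applies *)
pose h x := gaussn c x + gaussn c x * cos (2 * pi * dotrV x (consrV (tau, eta))).
have Lh : L1 (leb n.+1) h by apply: L1D; [exact: L1_gaussn|exact: L1_gaussn_cos].
have h0 x : 0 <= h x.
  by rewrite /h -{1}[gaussn c x]mulr1 -mulrDr mulr_ge0 ?gaussn_ge0//.
have E : Int (leb n.+1) h = Num.sqrt (pi / c) ^+ n.+1 +
    Num.sqrt (pi / c) ^+ n.+1 * gaussn (pi ^+ 2 / c) (consrV (tau, eta)).
  apply: EFin_inj; rewrite -L1_fin_num// ge0_integral_rVS; first last.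
  - by move=> x; rewrite lee_fin.
  - by apply/measurable_EFinP; exact: L1_meas Lh.
  pose A := Num.sqrt (pi / c) ^+ n; pose B := A * gaussn (pi ^+ 2 / c) eta.
  transitivity (\int[lebesgue_measure]_t (gauss1 c t * A + B * (gauss1 c t * cos (2 * pi * tau * t)))%:E)%E.
    apply: eq_integral => t _.
    pose k := gauss1 c t; pose C := cos (2 * pi * (t * tau)); pose S := sin (2 * pi * (t * tau)).
    transitivity (\int[leb n]_x ((k * gaussn c x + (k * C) * (gaussn c x * cos (2 * pi * dotrV x eta)))
        - (k * S) * (gaussn c x * sin (2 * pi * dotrV x eta)))%:E)%E.
      apply: eq_integral => x _; congr EFin.
      rewrite /h gaussn_consrV dotrV_consrV /= mulrDr cosD -/C -/S -/k; ring.
    have L1k := L1Z k (L1_gaussn n).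
    have L2k := L1Z (k * C) (L1_gaussn_cos eta).
    have L3k := L1Z (k * S) (L1_gaussn_sin eta).
    rewrite L1_fin_num; last by apply: L1B => //; exact: L1D.
    rewrite intB//; last exact: L1D.
    rewrite intD// (intZl _ (L1_gaussn n)) (intZl _ (L1_gaussn_cos eta)) (intZl _ (L1_gaussn_sin eta)).
    rewrite ih Int_gaussn_sin Int_gaussn mulr0 subr0; congr EFin.
    rewrite /B /A /C -/k (_ : 2 * pi * tau * t = 2 * pi * (t * tau)); [ring|ring].
  have L1c : L1 (@lebesgue_measure R) (fun t => gauss1 c t * cos (2 * pi * tau * t)).
    apply: (@L1_bM _ _ _ _ _ _ 1); [exact: L1_gauss1| |by move=> t; exact: cos_max].
    apply: continuous_measurable_fun.
    by apply: is_derive_continuous => x; exact: is_derive_comp_cos (is_derive_mulk _ x).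
  have L1g : L1 (@lebesgue_measure R) (fun t => gauss1 c t * A).
    by under eq_fun do rewrite mulrC; apply: L1Z; exact: L1_gauss1.
  rewrite L1_fin_num; last by apply: L1D => //; exact: L1Z.
  rewrite intD//; last exact: L1Z.
  rewrite (intZr _ (L1_gauss1 c0)) (intZl _ L1c) Int_gauss1_cos//.
  rewrite {1}/Int /Rintegral integral_gauss1//= /B /A gaussn_consrV /= (exprS (Num.sqrt (pi / c)) n); congr EFin.
  have -> : expR (- ((2 * pi * tau) ^+ 2 / (4 * c))) = gauss1 (pi ^+ 2 / c) tau.
    by rewrite /gauss1; congr expR; field; rewrite gt_eqF.
  ring.
move: E; rewrite intD; [|exact: L1_gaussn|exact: L1_gaussn_cos].
by rewrite Int_gaussn => /addrI.
Qed.

End gauss.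

(** * Convolution and the Hartley transform *)

Section fubini_real.
Context d1 d2 (T1 : measurableType d1) (T2 : measurableType d2) (R : realType).
Variables (m1 : {sigma_finite_measure set T1 -> \bar R}) (m2 : {sigma_finite_measure set T2 -> \bar R}).
Implicit Types K : T1 * T2 -> R.

Lemma measurable_section1 K x : measurable_fun setT K -> measurable_fun setT (fun y => K (x, y)).
Proof. by move=> mK; apply: (measurableT_comp mK); exact: pair1_measurable. Qed.

Lemma measurable_section2 K y : measurable_fun setT K -> measurable_fun setT (fun x => K (x, y)).
Proof. by move=> mK; apply: (measurableT_comp mK); exact: pair2_measurable. Qed.

Lemma measurable_Int K : measurable_fun setT K ->
  measurable_fun setT (fun x => Int m2 (fun y => K (x, y))).
Proof.
move=> /measurable_EFinP mK.
apply: (@measurableT_comp _ _ _ _ _ _ fine); first exact: fine_measurable.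
have -> : (fun x => \int[m2]_y (K (x, y))%:E)%E =
    (fun x => \int[m2]_y (EFin \o K)^\+%E (x, y) - \int[m2]_y (EFin \o K)^\-%E (x, y))%E.
  apply/funext => x; rewrite [LHS]integralE; congr (_ - _)%E; apply: eq_integral => y _.
    by rewrite !funepos.unlock.
  by rewrite !funeneg.unlock.
apply: emeasurable_funB.
  by apply: (measurable_fun_fubini_tonelli_F (EFin \o K)^\+%E) => //; exact: measurable_funepos.
by apply: (measurable_fun_fubini_tonelli_F (EFin \o K)^\-%E) => //; exact: measurable_funeneg.
Qed.

Lemma L1_prod K : measurable_fun setT K -> (forall x, L1 m2 (fun y => K (x, y))) ->
  L1 m1 (fun x => Int m2 (fun y => `|K (x, y)|)) -> L1 (m1 \x m2)%E K.
Proof.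
move=> mK LK LK1; apply/integrable12ltyP; first exact/measurable_EFinP.
under eq_integral => x _.
  rewrite (_ : (\int[m2]_y _)%E = (Int m2 (fun y => `|K (x, y)|))%:E); last first.
    by rewrite -L1_fin_num//; exact: L1_norm.
  over.
by apply/L1_ge0P => //; [exact: L1_meas LK1|move=> x; exact: int_ge0].
Qed.

Lemma Fubini_Int K : measurable_fun setT K -> (forall x, L1 m2 (fun y => K (x, y))) ->
  (forall y, L1 m1 (fun x => K (x, y))) ->
  L1 m1 (fun x => Int m2 (fun y => `|K (x, y)|)) ->
  Int m1 (fun x => Int m2 (fun y => K (x, y))) = Int m2 (fun y => Int m1 (fun x => K (x, y))).
Proof.
move=> mK LK1 LK2 LK; have LP := L1_prod mK LK1 LK.
have := Fubini LP; rewrite /fubini_F /fubini_G /= => E.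
rewrite /Int /Rintegral; congr fine.
under eq_integral do rewrite -/(Rintegral _ _ _) -/(Int _ _) -L1_fin_num//.
rewrite E; apply: eq_integral => y _.
by rewrite L1_fin_num.
Qed.

Lemma L1_Int K : measurable_fun setT K -> (forall x, L1 m2 (fun y => K (x, y))) ->
  L1 m1 (fun x => Int m2 (fun y => `|K (x, y)|)) ->
  L1 m1 (fun x => Int m2 (fun y => K (x, y))).
Proof.
move=> mK LK1 LK; apply: L1_le LK; first exact: measurable_Int.
by move=> x; exact: norm_int_le.
Qed.

Lemma L1_Int_swap K : measurable_fun setT K -> (forall x, L1 m2 (fun y => K (x, y))) ->
  (forall y, L1 m1 (fun x => K (x, y))) ->
  L1 m2 (fun y => Int m1 (fun x => `|K (x, y)|)) ->
  L1 m1 (fun x => Int m2 (fun y => `|K (x, y)|)).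
Proof.
move=> mK LK1 LK2 LK.
have mN : measurable_fun setT (fun z => `|K z|) by exact: measurableT_comp.
apply/L1_ge0P; [exact: (measurable_Int mN)|by move=> x; exact: int_ge0|].
rewrite (eq_integral (fun x => \int[m2]_y (`|K (x, y)|)%:E)%E); last first.
  by move=> x _; rewrite -L1_fin_num//; exact: L1_norm.
rewrite (fubini_tonelli (fun z => `|K z|%:E)); first last.
- by move=> z; rewrite lee_fin.
- exact/measurable_EFinP.
rewrite (eq_integral (fun y => (Int m1 (fun x => `|K (x, y)|))%:E)); last first.
  by move=> y _; rewrite -L1_fin_num//; exact: L1_norm.
by apply/L1_ge0P; [exact: L1_meas LK|move=> x; exact: int_ge0|].
Qed.

Lemma Fubini_Int_prod K (g : T1 -> R) (h : T2 -> R) : measurable_fun setT K ->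
  L1 m1 g -> L1 m2 h -> (forall x, 0 <= g x) -> (forall y, 0 <= h y) ->
  (forall x y, `|K (x, y)| <= g x * h y) ->
  Int m1 (fun x => Int m2 (fun y => K (x, y))) = Int m2 (fun y => Int m1 (fun x => K (x, y))).
Proof.
move=> mK Lg Lh g0 h0 Kgh.
have L1K x : L1 m2 (fun y => K (x, y)).
  apply: L1_le (L1Z (g x) Lh); first exact: measurable_section1.
  by move=> y; exact: Kgh.
have L2K y : L1 m1 (fun x => K (x, y)).
  apply: L1_le (L1Z (h y) Lg); first exact: measurable_section2.
  by move=> x; rewrite mulrC; exact: Kgh.
apply: Fubini_Int => //.
apply: L1_le (L1Z (Int m2 h) Lg).
  by apply: (@measurable_Int (fun z => `|K z|)); exact: measurableT_comp.
move=> x; rewrite ger0_norm ?int_ge0// mulrC -intZl//.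
by apply: int_le => //; [exact: L1_norm|exact: L1Z].
Qed.

End fubini_real.

Section convolution.
Context {R : realType} {n : nat}.
Local Notation leb := (lebesgue_rV n : {sigma_finite_measure set 'rV[R]_n -> \bar R}).
Implicit Types (s f g h : 'rV[R]_n -> R).

Definition convol s h (x : 'rV[R]_n) : R := Int leb (fun y => s (x - y) * h y).

Lemma measurable_conv_kernel s h : measurable_fun setT s -> measurable_fun setT h ->
  measurable_fun setT (fun z : 'rV[R]_n * 'rV[R]_n => s (z.1 - z.2) * h z.2).
Proof.
move=> ms mh; apply: measurable_funM; apply: measurableT_comp => //.
by apply: measurable_fun_subrV.
Qed.

Variables (s : 'rV[R]_n -> R) (M : R).
Hypotheses (Ls : L1 leb s) (sM : forall x, `|s x| <= M).

Let ms : measurable_fun setT s. Proof. exact: L1_meas Ls. Qed.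

Lemma L1_conv_kernel h x : L1 leb h -> L1 leb (fun y => s (x - y) * h y).
Proof.
move=> Lh; under eq_fun do rewrite mulrC.
apply: (L1_bM Lh); first by apply: (measurable_refl x).
by move=> y; exact: sM.
Qed.

Lemma L1_conv_kernel2 h y : L1 leb (fun x => s (x - y) * h y).
Proof.
under eq_fun do rewrite mulrC; apply: L1Z.
exact: (L1_shift (- y) Ls).
Qed.

Lemma measurable_conv h : L1 leb h -> measurable_fun setT (convol s h).
Proof.
move=> Lh; apply: (@measurable_Int _ _ _ _ _ leb (fun z : 'rV[R]_n * 'rV[R]_n => s (z.1 - z.2) * h z.2)).
by apply: measurable_conv_kernel => //; exact: L1_meas Lh.
Qed.

Lemma conv_bounded h x : L1 leb h -> `|convol s h x| <= M * Int leb (fun y => `|h y|).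
Proof.
move=> Lh; rewrite -intZl; last exact: L1_norm.
apply: le_trans (norm_int_le _) _; first exact: L1_conv_kernel.
apply: int_le; [by apply: L1_norm; exact: L1_conv_kernel|by apply: L1Z; exact: L1_norm|].
by move=> y; rewrite normrM ler_wpM2r.
Qed.

Let L1_int_norm h : L1 leb h ->
  L1 leb (fun y => Int leb (fun x => `|s (x - y) * h y|)).
Proof.
move=> Lh.
have -> : (fun y => Int leb (fun x => `|s (x - y) * h y|)) =
    fun y => Int leb (fun x => `|s x|) * `|h y|.
  apply/funext => y; under [X in Int _ X]eq_fun do rewrite normrM.
  rewrite intZr; last exact: (L1_shift (- y) (L1_norm Ls)).
  by rewrite (Int_shift (- y) (L1_norm Ls)).
by apply/L1Z/L1_norm.
Qed.

Lemma L1_conv h : L1 leb h -> L1 leb (convol s h).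
Proof.
move=> Lh.
have mK : measurable_fun setT (fun z : 'rV[R]_n * 'rV[R]_n => s (z.1 - z.2) * h z.2).
  by apply: measurable_conv_kernel => //; exact: L1_meas Lh.
apply: (@L1_Int _ _ _ _ _ leb leb (fun z : 'rV[R]_n * 'rV[R]_n => s (z.1 - z.2) * h z.2)) => //.
  by move=> x; exact: L1_conv_kernel.
apply: (@L1_Int_swap _ _ _ _ _ leb leb (fun z : 'rV[R]_n * 'rV[R]_n => s (z.1 - z.2) * h z.2)) => //.
- by move=> x; exact: L1_conv_kernel.
- by move=> x; exact: L1_conv_kernel2.
- exact: (L1_int_norm Lh).
Qed.

Lemma L2_conv h : L1 leb h -> L2 leb (convol s h).
Proof.
move=> Lh; apply: (@L1_L2_bounded _ _ _ _ _ (M * Int leb (fun y => `|h y|))); first exact: L1_conv.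
by move=> x; exact: conv_bounded.
Qed.

(* the test weight w is 1, or the kernel cas of the transform *)
Lemma Int_conv_weight h (w : 'rV[R]_n -> R) N : L1 leb h -> measurable_fun setT w ->
  (forall x, `|w x| <= N) ->
  Int leb (fun x => convol s h x * w x) =
  Int leb (fun y => h y * Int leb (fun x => s x * w (x + y))).
Proof.
move=> Lh mw wN.
pose K (z : 'rV[R]_n * 'rV[R]_n) := (s (z.1 - z.2) * h z.2) * w z.1.
have mK : measurable_fun setT K.
  apply: measurable_funM; first by apply: measurable_conv_kernel => //; exact: L1_meas Lh.
  exact: measurableT_comp.
have L1K x : L1 leb (fun y => K (x, y)).
  rewrite /K /=; under eq_fun do rewrite mulrC.
  by apply: L1Z; exact: L1_conv_kernel.
have L2K y : L1 leb (fun x => K (x, y)).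
  by apply: (@L1_bM _ _ _ _ _ _ N) => //; exact: L1_conv_kernel2.
transitivity (Int leb (fun x => Int leb (fun y => K (x, y)))).
  congr Int; apply/funext => x; rewrite /K /= intZr//; exact: L1_conv_kernel.
rewrite Fubini_Int//.
  congr Int; apply/funext => y; rewrite /K /=.
  have LK0 : L1 leb (fun x => s x * w (x + y)).
    apply: (@L1_bM _ _ _ _ _ _ N) => //; exact: measurable_shift.
  rewrite -[in RHS](Int_shift (- y) LK0) -intZl; last exact: (L1_shift (- y) LK0).
  by congr Int; apply/funext => x; rewrite subrK; ring.
apply: L1_Int_swap => //.
apply: L1_le (L1Z N (L1_int_norm Lh)).
  apply: (@measurable_Int _ _ _ _ _ leb (fun z : 'rV[R]_n * 'rV[R]_n => `|K (z.2, z.1)|)).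
  apply: measurableT_comp => //; apply: (measurableT_comp mK).
  by apply/measurable_fun_pairP; split; [exact: measurable_snd|exact: measurable_fst].
move=> y; rewrite ger0_norm; last exact: int_ge0.
rewrite -intZl; last by apply: L1_norm; exact: L1_conv_kernel2.
apply: int_le; [exact: L1_norm|by apply: L1Z; apply: L1_norm; exact: L1_conv_kernel2|].
by move=> x; rewrite /K /= normrM mulrC ler_wpM2r.
Qed.

Lemma Int_conv h : L1 leb h -> Int leb (convol s h) = Int leb s * Int leb h.
Proof.
move=> Lh; have := @Int_conv_weight h (fun=> 1) 1 Lh _ _.
rewrite (_ : (fun x => convol s h x * 1) = convol s h); last by apply/funext => x; rewrite mulr1.
move=> ->//; last by move=> _; rewrite normr1.
under [X in Int _ X]eq_fun => y do under [X in Int _ X]eq_fun do rewrite mulr1.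
by rewrite intZr// mulrC.
Qed.

Lemma convD g h x : L1 leb g -> L1 leb h ->
  convol s (fun y => g y + h y) x = convol s g x + convol s h x.
Proof.
move=> Lg Lh; rewrite /convol -intD; [|exact: L1_conv_kernel..].
by congr Int; apply/funext => y; rewrite mulrDr.
Qed.

Lemma convZ k h x : L1 leb h -> convol s (fun y => k * h y) x = k * convol s h x.
Proof.
move=> Lh; rewrite /convol -intZl; last exact: L1_conv_kernel.
by congr Int; apply/funext => y; rewrite mulrCA.
Qed.

Lemma conv_ge0 h x : (forall x, 0 <= s x) -> (forall y, 0 <= h y) -> 0 <= convol s h x.
Proof. by move=> s0 h0; apply: int_ge0 => y; rewrite mulr_ge0. Qed.

(* integrate 2 f(x) f(y) <= f(x)^2 + f(y)^2 against s(x - y) *)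
Lemma ip_conv_le f : (forall x, 0 <= s x) -> Int leb s = 1 ->
  L1 leb f -> L2 leb f -> ip leb f (convol s f) <= sq leb f.
Proof.
move=> s0 s1 Lf L2f.
have Lf2 : L1 leb (fun x => f x ^+ 2) by case: L2f.
have Lc2 := L1_conv Lf2.
have H x : f x * convol s f x <= 2^-1 * f x ^+ 2 + 2^-1 * convol s (fun y => f y ^+ 2) x.
  have Ls1 : L1 leb (fun y => s (x - y)) by exact: (L1_refl x Ls).
  have -> : f x ^+ 2 = Int leb (fun y => s (x - y) * f x ^+ 2).
    by rewrite intZr// (Int_refl x Ls) s1 mul1r.
  rewrite -mulrDr /convol -intD; [|by under eq_fun do rewrite mulrC; exact: L1Z|exact: L1_conv_kernel].
  rewrite -intZl; last exact: L1_conv_kernel.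
  rewrite -intZl; last by apply: L1D; [under eq_fun do rewrite mulrC; exact: L1Z|exact: L1_conv_kernel].
  apply: int_le; first by apply: L1Z; exact: L1_conv_kernel.
    by apply: L1Z; apply: L1D; [under eq_fun do rewrite mulrC; exact: L1Z|exact: L1_conv_kernel].
  move=> y; rewrite -mulrDr mulrCA [leRHS]mulrCA ler_wpM2l//.
  by have := sqr_ge0 (f x - f y); lra.
rewrite /ip; apply: le_trans (int_le _ _ H) _.
- by apply: L2_L1M => //; exact: L2_conv.
- by apply: L1D; exact: L1Z.
rewrite intD; [|exact: L1Z..]; rewrite !intZl// Int_conv// s1 mul1r sqE.
by lra.
Qed.

End convolution.

Section hartley.
Context {R : realType} {n : nat}.
Local Notation leb := (lebesgue_rV n : {sigma_finite_measure set 'rV[R]_n -> \bar R}).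
Implicit Types (s f g h : 'rV[R]_n -> R) (x xi : 'rV[R]_n).

Definition cas (t : R) := cos t + sin t.

Lemma norm_cas t : `|cas t| <= 2.
Proof. by rewrite (le_trans (ler_normD _ _))// mulr2n lerD// ?cos_max ?sin_max. Qed.

Lemma casM a b : cas a * cas b = cos (a - b) + sin (a + b).
Proof. by rewrite /cas cosB sinD; ring. Qed.

Lemma casD a b : cas (a + b) = cas b * cos a + (cos b - sin b) * sin a.
Proof. by rewrite /cas cosD sinD; ring. Qed.

Lemma continuous_cas : continuous cas.
Proof. by move=> t; apply: cvgD; [exact: continuous_cos|exact: continuous_sin]. Qed.

Lemma measurable_cas : measurable_fun setT cas.
Proof. by apply: continuous_measurable_fun; exact: continuous_cas. Qed.

Lemma measurable_cas_dotrV d (T : measurableType d) (p q : T -> 'rV[R]_n) :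
  measurable_fun setT p -> measurable_fun setT q ->
  measurable_fun setT (fun z => cas (2 * pi * dotrV (p z) (q z))).
Proof.
move=> mp mq; apply: (measurableT_comp measurable_cas).
by apply: measurable_funM => //; exact: measurable_fun_dotrV.
Qed.

(* The Hartley transform: a real isometry of L^2 that determines the Fourier
   transform (its even and odd parts are the cosine and sine transforms). *)
Definition hartley f xi : R := Int leb (fun x => f x * cas (2 * pi * dotrV x xi)).

Lemma L1_hartley_kernel f xi : L1 leb f -> L1 leb (fun x => f x * cas (2 * pi * dotrV x xi)).
Proof.
move=> Lf; apply: (L1_bM Lf); first exact: measurable_cas_dotrV.
by move=> x; exact: norm_cas.
Qed.

Lemma norm_hartley_le f xi : L1 leb f -> `|hartley f xi| <= 2 * Int leb (fun x => `|f x|).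
Proof.
move=> Lf; rewrite -intZl; last exact: L1_norm.
apply: le_trans (norm_int_le _) _; first exact: L1_hartley_kernel.
apply: int_le; [by apply: L1_norm; exact: L1_hartley_kernel|by apply: L1Z; exact: L1_norm|].
by move=> y; rewrite normrM mulrC ler_wpM2r// norm_cas.
Qed.

Lemma measurable_hartley f : L1 leb f -> measurable_fun setT (hartley f).
Proof.
move=> Lf; apply: (@measurable_Int _ _ _ _ _ leb (fun z : 'rV[R]_n * 'rV[R]_n => f z.2 * cas (2 * pi * dotrV z.2 z.1))).
apply: measurable_funM; last exact: measurable_cas_dotrV.
by apply: measurableT_comp => //; exact: L1_meas Lf.
Qed.

Lemma hartleyD f g : L1 leb f -> L1 leb g ->
  hartley (fun x => f x + g x) = fun xi => hartley f xi + hartley g xi.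
Proof.
move=> Lf Lg; apply/funext => xi; rewrite /hartley -intD; [|exact: L1_hartley_kernel..].
by congr Int; apply/funext => x; rewrite mulrDl.
Qed.

Lemma hartleyB f g : L1 leb f -> L1 leb g ->
  hartley (fun x => f x - g x) = fun xi => hartley f xi - hartley g xi.
Proof.
move=> Lf Lg; apply/funext => xi; rewrite /hartley -intB; [|exact: L1_hartley_kernel..].
by congr Int; apply/funext => x; rewrite mulrBl.
Qed.

Lemma hartleyZ k f : L1 leb f -> hartley (fun x => k * f x) = fun xi => k * hartley f xi.
Proof.
move=> Lf; apply/funext => xi; rewrite /hartley -intZl; last exact: L1_hartley_kernel.
by congr Int; apply/funext => x; rewrite mulrA.
Qed.

Definition cosT s xi : R := Int leb (fun x => s x * cos (2 * pi * dotrV x xi)).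

Lemma L1_cosT_kernel f xi : L1 leb f -> L1 leb (fun x => f x * cos (2 * pi * dotrV x xi)).
Proof.
move=> Lf; apply: (L1_bM Lf); first exact: measurable_cos_dotrV.
by move=> x; exact: cos_max.
Qed.

Lemma L1_sinT_kernel f xi : L1 leb f -> L1 leb (fun x => f x * sin (2 * pi * dotrV x xi)).
Proof.
move=> Lf; apply: (L1_bM Lf); first exact: measurable_sin_dotrV.
by move=> x; exact: sin_max.
Qed.

(** For a general kernel the product rule would involve [hartley f (- xi)] as well. By [casD] that
    contribution carries the sine transform of [s], which vanishes because [s] is even. *)
Lemma hartley_conv s (M : R) f xi : L1 leb s -> (forall x : 'rV[R]_n, `|s x| <= M) -> (forall x : 'rV[R]_n, s (- x) = s x) ->
  L1 leb f -> hartley (convol s f) xi = cosT s xi * hartley f xi.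
Proof.
move=> Ls sM seven Lf.
rewrite /hartley (Int_conv_weight Ls sM Lf (w := fun x => cas (2 * pi * dotrV x xi)) (N := 2)); first last.
- by move=> x; exact: norm_cas.
- exact: measurable_cas_dotrV.
rewrite -intZl; last exact: L1_hartley_kernel.
congr Int; apply/funext => y.
pose c := cas (2 * pi * dotrV y xi).
pose c' := cos (2 * pi * dotrV y xi) - sin (2 * pi * dotrV y xi).
have E : (fun x => s x * cas (2 * pi * dotrV (x + y) xi)) =
    fun x => c * (s x * cos (2 * pi * dotrV x xi)) + c' * (s x * sin (2 * pi * dotrV x xi)).
  by apply/funext => x; rewrite dotrVDl [2 * pi * _]mulrDr casD /c /c'; ring.
rewrite E intD; [|by apply: L1Z; exact: L1_cosT_kernel|by apply: L1Z; exact: L1_sinT_kernel].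
rewrite (intZl _ (L1_cosT_kernel xi Ls)) (intZl _ (L1_sinT_kernel xi Ls)).
rewrite (Int_odd (L1_sinT_kernel xi Ls)); last first.
  by move=> x; rewrite seven dotrVNl mulrN sinN mulrN.
by rewrite mulr0 addr0 /cosT /c; ring.
Qed.

End hartley.

(** * Plancherel's identity *)

Section heat_kernel.
Context {R : realType} {n : nat}.
Local Notation leb := (lebesgue_rV n : {sigma_finite_measure set 'rV[R]_n -> \bar R}).
Implicit Types (x xi : 'rV[R]_n).

(* the density whose transform is xi |-> expR (- c * |xi|^2) *)
Definition heat (c : R) x : R := Num.sqrt (pi / c) ^+ n * gaussn (pi ^+ 2 / c) x.

Variable c : R.
Hypothesis c0 : 0 < c.

Lemma heat_dual0 : 0 < pi ^+ 2 / c :> R.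
Proof. by rewrite divr_gt0// exprn_gt0// pi_gt0. Qed.

Lemma heat_ge0 x : 0 <= heat c x.
Proof. by rewrite mulr_ge0 ?gaussn_ge0// exprn_ge0// sqrtr_ge0. Qed.

Lemma heatN x : heat c (- x) = heat c x.
Proof. by rewrite /heat gaussnN. Qed.

Lemma heat_le x : heat c x <= Num.sqrt (pi / c) ^+ n.
Proof. by rewrite ler_piMr ?exprn_ge0 ?sqrtr_ge0// gaussn_le1// ltW// heat_dual0. Qed.

Lemma norm_heat_le x : `|heat c x| <= Num.sqrt (pi / c) ^+ n.
Proof. by rewrite ger0_norm ?heat_ge0// heat_le. Qed.

Lemma L1_heat : L1 leb (heat c).
Proof. by apply/L1Z/L1_gaussn/heat_dual0. Qed.

Lemma sqrt_heat_dual : Num.sqrt (pi / c) * Num.sqrt (pi / (pi ^+ 2 / c)) = 1.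
Proof.
rewrite -sqrtrM; last by rewrite divr_ge0 ?pi_ge0// ltW.
have p0 := pi_gt0 R; move: (@pi R) p0 => p p0.
rewrite (_ : _ * _ = 1) ?sqrtr1//; field.
by rewrite !gt_eqF.
Qed.

Lemma cosT_heat xi : cosT (heat c) xi = gaussn c xi.
Proof.
rewrite /cosT /heat.
have E : (fun x => Num.sqrt (pi / c) ^+ n * gaussn (pi ^+ 2 / c) x * cos (2 * pi * dotrV x xi)) =
    (fun x => Num.sqrt (pi / c) ^+ n * (gaussn (pi ^+ 2 / c) x * cos (2 * pi * dotrV x xi))).
  by apply/funext => x; rewrite mulrA.
rewrite E (intZl _ (L1_gaussn_cos heat_dual0 xi)) (Int_gaussn_cos heat_dual0).
rewrite mulrA -exprMn sqrt_heat_dual expr1n mul1r; congr (gaussn _ xi).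
have p0 := pi_gt0 R; move: (@pi R) p0 => p p0.
by field; rewrite !gt_eqF.
Qed.

Lemma Int_heat : Int leb (heat c) = 1.
Proof.
by rewrite (intZl _ (L1_gaussn heat_dual0 n)) (Int_gaussn heat_dual0) -exprMn sqrt_heat_dual expr1n.
Qed.

Lemma Int_gaussn_cos_heat x : Int leb (fun xi => gaussn c xi * cos (2 * pi * dotrV x xi)) = heat c x.
Proof.
rewrite /heat -(Int_gaussn_cos c0 x); congr Int; apply/funext => xi.
by rewrite dotrVC.
Qed.

(** Half of the exponent is estimated by |x|^2 >= d^2; the other half is the Gaussian of
    [heat (2 * c)], whose smaller normalization accounts for [Num.sqrt 2 ^+ n]. *)
Lemma heat_tail d x : 0 <= d -> ~ cube d x ->
  heat c x <= (Num.sqrt 2 ^+ n * expR (- (pi ^+ 2 * d ^+ 2 / 2) / c)) * heat (2 * c) x.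
Proof.
move=> d0 /existsNP[i /negP]; rewrite -leNgt => dx.
rewrite /heat mulrACA -exprMn -sqrtrM// (_ : 2 * (pi / (2 * c)) = pi / c); last first.
  by move: (@pi R) => p; field; rewrite gt_eqF.
rewrite ler_wpM2l ?exprn_ge0 ?sqrtr_ge0// /gaussn -expRD ler_expR.
have h : d ^+ 2 <= dotrV x x.
  apply: le_trans (sqr_coord_le_dotrV x i).
  by rewrite -[leRHS]real_normK ?num_real// lerXn2r ?nnegrE.
rewrite (_ : - (pi ^+ 2 * d ^+ 2 / 2) / c + - (pi ^+ 2 / (2 * c)) * dotrV x x =
  - (pi ^+ 2 / c) * ((d ^+ 2 + dotrV x x) / 2)); last by move: (@pi R) => p; field; rewrite gt_eqF.
rewrite !mulNr lerN2 ler_wpM2l//; first by rewrite ltW// heat_dual0.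
by rewrite ler_pdivrMr//; lra.
Qed.

End heat_kernel.

Section plancherel.
Context {R : realType} {n : nat}.
Local Notation leb := (lebesgue_rV n : {sigma_finite_measure set 'rV[R]_n -> \bar R}).
Local Notation L1 := (L1 leb).
Local Notation L2 := (L2 leb).
Local Notation Int := (Int leb).
Local Notation sq := (sq leb).
Implicit Types (s f g h : 'rV[R]_n -> R) (x xi : 'rV[R]_n).

(** Regularized Plancherel identity. The Gaussian weight makes the triple integral absolutely
    convergent, so both transforms can be unfolded and the xi integral done first. In [casM] the
    sine is odd in xi and drops out, and the cosine of x - y yields [heat c (x - y)]. *)
Lemma Int_gaussn_hartley_sqr c f : 0 < c -> L1 f ->
  Int (fun xi => gaussn c xi * hartley f xi ^+ 2) = Int (fun x => f x * convol (heat c) f x).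
Proof.
move=> c0 Lf.
have mf := L1_meas Lf; have LG := @L1_gaussn R c c0 n; have mG := @measurable_gaussn R c n.
have mH := measurable_hartley Lf.
pose N := Int (fun x => `|f x|).
have N0 : 0 <= N by exact: int_ge0.
have LN := L1_norm Lf.
transitivity (Int (fun xi => Int (fun x => gaussn c xi * hartley f xi * (f x * cas (2 * pi * dotrV x xi))))).
  congr (Int _); apply/funext => xi.
  by rewrite intZl ?expr2 ?mulrA//; exact: L1_hartley_kernel.
rewrite (@Fubini_Int_prod _ _ _ _ _ leb leb (fun z : 'rV[R]_n * 'rV[R]_n =>
    gaussn c z.1 * hartley f z.1 * (f z.2 * cas (2 * pi * dotrV z.2 z.1)))
  (fun xi => (2 * N) * gaussn c xi) (fun x => 2 * `|f x|)); first last.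
- move=> xi x /=; rewrite !normrM (ger0_norm (gaussn_ge0 _ _)) [_ * gaussn c xi]mulrC.
  rewrite -!mulrA; apply: ler_wpM2l; first exact: gaussn_ge0.
  rewrite [leRHS]mulrA; apply: ler_pM => //.
  + exact: norm_hartley_le.
  + by rewrite mulrC; apply: ler_wpM2r => //; exact: norm_cas.
- by move=> x; rewrite mulr_ge0.
- by move=> x; rewrite !mulr_ge0// gaussn_ge0.
- exact: L1Z.
- exact: L1Z.
- apply: measurable_funM; first apply: measurable_funM.
  + by apply: measurableT_comp.
  + by apply: measurableT_comp.
  + apply: measurable_funM; first by apply: measurableT_comp.
    by apply: measurable_cas_dotrV.
congr (Int _); apply/funext => x /=.
have LGh : L1 (fun xi => gaussn c xi * hartley f xi).
  by apply: (L1_bM LG mH) => xi; exact: norm_hartley_le.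
transitivity (f x * Int (fun xi => Int (fun y => gaussn c xi * cas (2 * pi * dotrV x xi) * (f y * cas (2 * pi * dotrV y xi))))).
  rewrite -intZl; last first.
    rewrite (_ : (fun xi => _) = fun xi => gaussn c xi * hartley f xi * cas (2 * pi * dotrV x xi)).
      by apply: (L1_bM LGh); [exact: measurable_cas_dotrV|move=> xi; exact: norm_cas].
    apply/funext => xi; rewrite intZl; [rewrite -/(hartley f xi); ring|exact: L1_hartley_kernel].
  congr (Int _); apply/funext => xi.
  rewrite intZl; [rewrite -/(hartley f xi); ring|exact: L1_hartley_kernel].
congr (_ * _).
rewrite (@Fubini_Int_prod _ _ _ _ _ leb leb (fun z : 'rV[R]_n * 'rV[R]_n =>
    gaussn c z.1 * cas (2 * pi * dotrV x z.1) * (f z.2 * cas (2 * pi * dotrV z.2 z.1)))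
  (fun xi => 2 * gaussn c xi) (fun x => 2 * `|f x|)); first last.
- move=> xi y /=; rewrite !normrM (ger0_norm (gaussn_ge0 _ _)) [_ * gaussn c xi]mulrC.
  rewrite -!mulrA; apply: ler_wpM2l; first exact: gaussn_ge0.
  apply: ler_pM => //; first exact: norm_cas.
  by rewrite mulrC; apply: ler_wpM2r => //; exact: norm_cas.
- by move=> y; rewrite mulr_ge0.
- by move=> y; rewrite !mulr_ge0// gaussn_ge0.
- exact: L1Z.
- exact: L1Z.
- apply: measurable_funM; first apply: measurable_funM.
  + by apply: measurableT_comp.
  + by apply: measurable_cas_dotrV.
  + apply: measurable_funM; first by apply: measurableT_comp.
    by apply: measurable_cas_dotrV.
congr (Int _); apply/funext => y /=.
rewrite -Int_gaussn_cos_heat//.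
have E : (fun xi => gaussn c xi * cas (2 * pi * dotrV x xi) * (f y * cas (2 * pi * dotrV y xi))) =
    fun xi => f y * (gaussn c xi * cos (2 * pi * dotrV xi (x - y)) + gaussn c xi * sin (2 * pi * dotrV xi (x + y))).
  apply/funext => xi; rewrite -mulrDr [dotrV xi (x - y)]dotrVC [dotrV xi (x + y)]dotrVC.
  by rewrite dotrVBl dotrVDl mulrBr [2 * pi * (_ + _)]mulrDr -casM; ring.
have L1c := L1_gaussn_cos c0 (x - y); have L1s := L1_gaussn_sin c0 (x + y).
rewrite E intZl; last exact: L1D.
rewrite (intD L1c L1s) (Int_gaussn_sin c0) addr0 mulrC; congr (_ * _).
by congr (Int _); apply/funext => xi; rewrite dotrVC.
Qed.

Lemma cvg_gaussn_inv x : gaussn k.+1%:R^-1 x @[k --> \oo] --> (1 : R).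
Proof.
rewrite -[X in _ --> X]expR0 /gaussn; apply: continuous_cvg; first exact: continuous_expR.
rewrite -[X in _ --> X](mul0r (dotrV x x)); apply: cvgMl.
by rewrite -oppr0; apply: cvgN; exact: cvg_harmonic.
Qed.

(** By [ip_conv_le] the regularized identity bounds the weighted integrals by [sq f]; the weights
    increase to 1 and Fatou's lemma removes them. *)
Lemma hartley_bessel f : L1 f -> L2 f -> L2 (hartley f) /\ sq (hartley f) <= sq f.
Proof.
move=> Lf L2f; have mH := measurable_hartley Lf.
pose F k xi := gaussn k.+1%:R^-1 xi * hartley f xi ^+ 2.
have c0 k : 0 < k.+1%:R^-1 :> R by [].
have [] := @fatou_int _ _ _ leb F (fun xi => hartley f xi ^+ 2) (sq f).
- move=> k; apply: (@L1_bM _ _ _ _ _ _ ((2 * Int (fun x => `|f x|)) ^+ 2)).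
  + exact: L1_gaussn.
  + exact: measurable_funX.
  + by move=> xi; rewrite normrX lerXn2r ?nnegrE// ?norm_hartley_le// mulr_ge0// int_ge0.
- by move=> k x; rewrite mulr_ge0 ?gaussn_ge0 ?sqr_ge0.
- exact: measurable_funX.
- by move=> x; exact: sqr_ge0.
- apply: aeW => xi; rewrite -[X in _ --> X]mul1r; apply: cvgMl; exact: cvg_gaussn_inv.
- apply: nearW => k; rewrite Int_gaussn_hartley_sqr//.
  apply: (ip_conv_le (L1_heat (c0 k)) (norm_heat_le (c0 k))) => //.
    exact: heat_ge0.
  exact: Int_heat.
by move=> LH le; split; [split|rewrite sqE].
Qed.

(** A predicate to be propagated: from open sets of finite measure to measurable subsets of cubes,
    then to simple functions and their L^2 limits. *)
Definition plancherel f := [/\ L1 f, L2 f & sq (hartley f) = sq f].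

Lemma plancherelZ k f : plancherel f -> plancherel (fun x => k * f x).
Proof.
move=> [Lf L2f E]; split; [exact: L1Z|exact: L2Z|].
rewrite hartleyZ//.
by rewrite !sqZ ?E//; case: (hartley_bessel Lf L2f).
Qed.

(* |f|^2 - |Hf|^2 is a nonnegative quadratic form, so its null set is a subspace *)
Lemma plancherelD f g : plancherel f -> plancherel g -> plancherel (fun x => f x + g x).
Proof.
move=> [Lf L2f Ef] [Lg L2g Eg].
have LD := L1D Lf Lg; have L2D' := L2D L2f L2g; have LB := L1B Lf Lg; have L2B' := L2B L2f L2g.
have [LHf _] := hartley_bessel Lf L2f; have [LHg _] := hartley_bessel Lg L2g.
have [_ BD] := hartley_bessel LD L2D'; have [_ BB] := hartley_bessel LB L2B'.
split => //.
move: BD BB.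
rewrite hartleyD// hartleyB//.
rewrite (sqD LHf LHg) (sqB LHf LHg) (sqD L2f L2g) (sqB L2f L2g) Ef Eg.
by move=> ? ?; lra.
Qed.

Lemma plancherel0 : plancherel (fun=> 0).
Proof.
split; [exact: L1_0|exact: L2_0|].
rewrite (_ : hartley _ = fun=> 0)//; apply/funext => xi.
by rewrite /hartley; under [X in Int X]eq_fun do rewrite mul0r; exact: int0.
Qed.

Lemma plancherelB f g : plancherel f -> plancherel g -> plancherel (fun x => f x - g x).
Proof.
move=> Pf Pg; have := plancherelD Pf (plancherelZ (-1) Pg).
by under [X in plancherel X -> _]eq_fun do rewrite mulN1r.
Qed.

Lemma plancherel_sum (I : Type) (r : seq I) (F : I -> 'rV[R]_n -> R) :
  (forall i, plancherel (F i)) -> plancherel (fun x => \sum_(i <- r) F i x).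
Proof.
move=> PF; elim: r => [|i r ih].
  by under eq_fun do rewrite big_nil; exact: plancherel0.
by under eq_fun do rewrite big_cons; exact: plancherelD.
Qed.

Lemma plancherel_lim (F : nat -> 'rV[R]_n -> R) f : (forall k, plancherel (F k)) ->
  L1 f -> L2 f -> cvg2 leb F f -> plancherel f.
Proof.
move=> PF Lf L2f Ff; have [LHf Bf] := hartley_bessel Lf L2f; split => //.
have LF k : L1 (F k) by case: (PF k).
have L2F k : L2 (F k) by case: (PF k).
have LHF k : L2 (hartley (F k)) by case: (hartley_bessel (LF k) (L2F k)).
have HFf : cvg2 leb (fun k => hartley (F k)) (hartley f).
  apply: squeeze0 Ff => k; rewrite ger0_norm ?sq_ge0//.
  have [_] := hartley_bessel (L1B (LF k) Lf) (L2B (L2F k) L2f).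
  by rewrite (hartleyB (LF k) Lf).
have h1 := cvg2_sq LHF LHf HFf; have h2 := cvg2_sq L2F L2f Ff.
apply: cvg_unique h2 => //.
by rewrite (_ : (fun k => sq (F k)) = fun k => sq (hartley (F k)))//;
  apply/funext => k; case: (PF k).
Qed.

(** A cube around x lies in [B], so the defect from 1 is at most the mass of the heat kernel outside
    that cube. *)
Lemma conv_heat_indic_cvg (B : set 'rV[R]_n) x : open B -> L1 \1_B -> B x ->
  convol (heat k.+1%:R^-1) \1_B x @[k --> \oo] --> (1 : R).
Proof.
move=> oB LB Bx.
have mB := open_measurable_rV oB.
have /nbhs_ballP[d /= d0 dB] : nbhs x B by exact: open_nbhs_nbhs.
have c0 k : 0 < k.+1%:R^-1 :> R by [].
(* The factor in [heat_tail] for c = 1/(k+1): it decays geometrically in k, and the kernel beside it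
   has mass 1. *)
pose C k : R := Num.sqrt 2 ^+ n * expR (- (pi ^+ 2 * d ^+ 2 / 2) / k.+1%:R^-1).
have LH k := L1_refl x (L1_heat (n := n) (c0 k)).
have LK k := L1_conv_kernel (L1_heat (c0 k)) (norm_heat_le (c0 k)) x LB.
suff main k : `|convol (heat k.+1%:R^-1) \1_B x - 1| <= C k.
  apply/subr_cvg0; apply: squeeze0 main _.
  rewrite -[X in _ --> X](mulr0 (Num.sqrt 2 ^+ n)); apply: cvgMr.
  pose e : R := expR (- (pi ^+ 2 * d ^+ 2 / 2)).
  have : geometric e e k @[k --> \oo] --> (0 : R).
    apply: cvg_geometric; rewrite ger0_norm ?expR_ge0// expR_lt1 oppr_lt0 divr_gt0// mulr_gt0//;
    by rewrite exprn_gt0// pi_gt0.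
  apply: cvg_trans; apply: near_eq_cvg; apply: nearW => k.
  by rewrite /= invrK /e -expRM_natr -expRD -mulr_natr -natr1; congr expR; ring.
have E1 : Int (fun y => heat k.+1%:R^-1 (x - y)) = 1.
  by rewrite (Int_refl x (L1_heat (c0 k))) Int_heat.
rewrite -[X in `|_ - X|]E1 distrC -(intB (LH k) (LK k)).
rewrite ger0_norm; last first.
  by apply: int_ge0 => y; rewrite -{1}[heat _ _]mulr1 -mulrBr mulr_ge0 ?heat_ge0.
have c20 : 0 < 2 * k.+1%:R^-1 :> R by rewrite mulr_gt0.
have L2H := L1_refl x (L1_heat (n := n) c20).
apply: (@le_trans _ _ (Int (fun y => C k * heat (2 * k.+1%:R^-1) (x - y)))); last first.
  by rewrite intZl// (Int_refl x (L1_heat c20)) Int_heat// mulr1.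
apply: int_le; [exact: L1B|exact: L1Z|].
move=> y; rewrite -{1}[heat _ _]mulr1 -mulrBr indicE.
have [yB|yB] := boolP (y \in B).
  by rewrite subrr mulr0 mulr_ge0 ?heat_ge0// mulr_ge0 ?expR_ge0// exprn_ge0// sqrtr_ge0.
rewrite subr0 mulr1; apply: heat_tail => //; first exact: ltW.
move=> cxy; move/negP: yB; apply; rewrite inE; apply: dB; split => // i j.
by rewrite (ord1 i) /ball /=; have := cxy j; rewrite !mxE.
Qed.

(** The inequality missing after [hartley_bessel]: the regularized energies are at most
    [sq (hartley \1_B)] and tend to the measure of [B]. Openness makes the convolutions converge to
    1 at every point of [B]. *)
Lemma plancherel_open (B : set 'rV[R]_n) : open B -> (leb B < +oo)%E -> plancherel \1_B.
Proof.
move=> oB Boo; have mB := open_measurable_rV oB.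
have LB : L1 \1_B by exact: L1_indic.
have sqB1 := @sqr_indic _ _ R B.
have L2B' : L2 \1_B by exact: L2_indic.
have [LHB le] := hartley_bessel LB L2B'.
split => //; apply/eqP; rewrite eq_le le /=.
have c0 k : 0 < k.+1%:R^-1 :> R by [].
pose F k x : R := \1_B x * convol (heat k.+1%:R^-1) \1_B x.
have IF k : Int (F k) <= sq (hartley \1_B).
  rewrite /F -Int_gaussn_hartley_sqr// sqE; apply: int_le.
  - apply: (@L1_bM _ _ _ _ _ _ ((2 * Int (fun x => `|\1_B x|)) ^+ 2)).
    + exact: L1_gaussn.
    + by apply: measurable_funX; exact: measurable_hartley.
    + by move=> xi; rewrite normrX lerXn2r ?nnegrE// ?norm_hartley_le// mulr_ge0// int_ge0.
  - by case: LHB.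
  - by move=> xi; rewrite ler_piMl ?sqr_ge0// gaussn_le1// ltW.
have [] := @int_dominated_cvg _ _ _ leb F \1_B \1_B.
- move=> k; apply: measurable_funM; first exact: measurable_indic.
  exact: (measurable_conv (L1_heat (c0 k)) LB).
- exact: measurable_indic.
- apply: aeW => x; rewrite /F indicE; have [xB|xB] := boolP (x \in B).
    under eq_fun do rewrite mul1r; apply: conv_heat_indic_cvg => //.
    exact: set_mem.
  by under eq_fun do rewrite mul0r; exact: cvg_cst.
- exact: LB.
- move=> k x; rewrite /F normrM ger0_norm// ler_piMr//.
  rewrite ger0_norm; last by apply: conv_ge0 => // y; exact: heat_ge0.
  have LH := L1_refl x (L1_heat (n := n) (c0 k)).
  apply: (@le_trans _ _ (Int (fun y => heat k.+1%:R^-1 (x - y)))).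
    apply: int_le => //; first exact: (L1_conv_kernel (L1_heat (c0 k)) (norm_heat_le (c0 k))).
    move=> y; rewrite ler_piMr ?heat_ge0// indicE; by case: (_ \in _).
  by rewrite (Int_refl x (L1_heat (c0 k))) Int_heat.
move=> _ cv; rewrite [leLHS]sqE sqB1.
by apply: cvg_le_cst cv _; exact: nearW.
Qed.

(** Lets the Dynkin induction below start from the open sets, which are stable under
    intersection. *)
Lemma measurable_rV_open : @measurable _ 'rV[R]_n = <<s @open 'rV[R]_n >>.
Proof.
apply/seteqP; split; last first.
  apply: smallest_sub; first exact: sigma_algebra_measurable.
  by move=> A; exact: open_measurable_rV.
pose T : measurableType _ := g_sigma_algebraType (@open 'rV[R]_n).
have mid : measurable_fun [set: T] (id : T -> 'rV[R]_n).
  apply/(@measurable_fun_rVP _ _ _ T) => i.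
  apply: (measurability _ (RGenOpens.measurableE R)).
  move=> _ [_ [a [b ->] <-]]; rewrite setTI; apply: sub_sigma_algebra.
  have := @coord_continuous R 1 n 0 i; move/continuousP; apply.
  exact: interval_open.
by move=> A mA; have := mid measurableT A mA; rewrite setTI.
Qed.

Lemma cube_open (r : R) : open (@cube R n r).
Proof.
have H (l : seq 'I_n) : open [set x : 'rV[R]_n | forall i, i \in l -> `]- r, r[%classic (x 0 i)].
  elim: l => [|i l ih].
    rewrite (_ : [set _ | _] = setT); first exact: openT.
    by apply/seteqP; split => // x _ i; rewrite in_nil.
  rewrite (_ : [set _ | _] = ((fun x : 'rV[R]_n => x 0 i) @^-1` `]- r, r[%classic) `&`
      [set x : 'rV[R]_n | forall i, i \in l -> `]- r, r[%classic (x 0 i)]).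
    apply: openI => //; have := @coord_continuous R 1 n 0 i; move/continuousP; apply.
    exact: interval_open.
  apply/seteqP; split => x /=.
    move=> h; split; first by apply: h; rewrite mem_head.
    by move=> j jl; apply: h; rewrite in_cons jl orbT.
  by case=> h1 h2 j; rewrite in_cons => /orP[/eqP->//|]; exact: h2.
suff -> : cube r = [set x : 'rV[R]_n | forall i, i \in enum 'I_n -> `]- r, r[%classic (x 0 i)].
  exact: H.
rewrite cubeE; by apply/seteqP; split => x /= h i; [move=> _|]; apply: h; rewrite mem_enum.
Qed.

(** The cube keeps all indicators in L^1 and L^2, so that complements become differences, and
    countable disjoint unions become L^2 limits dominated by the indicator of the cube. *)
Lemma plancherel_cubeI (r : R) (A : set 'rV[R]_n) : measurable A -> plancherel \1_(A `&` cube r).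
Proof.
move=> mA; have mQ : measurable (@cube R n r) by exact: measurable_cube.
rewrite measurable_rV_open in mA; move: A mA.
apply: (dynkin_induction measurable_rV_open).
- by move=> A B; exact: openI.
- by rewrite setTI; apply: plancherel_open; [exact: cube_open|exact: cube_finite].
- move=> A oA; apply: plancherel_open; first by apply: openI => //; exact: cube_open.
  apply: le_lt_trans (cube_finite r); apply: le_measure; rewrite ?inE//.
  by apply: measurableI => //; exact: open_measurable_rV.
- move=> A mA PA.
  have PQ : plancherel \1_(@cube R n r) by apply: plancherel_open; [exact: cube_open|exact: cube_finite].
  have := plancherelB PQ PA; congr plancherel; apply/funext => x.
  rewrite !indicE !in_setI in_setC.
  by case: (x \in A); case: (x \in cube r); rewrite /= ?subrr ?subr0.
- move=> F mF tF PF.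
  pose G k x : R := \sum_(i < k) \1_(F i `&` cube r) x.
  have GE k x : G k x = \1_((\big[setU/set0]_(i < k) F i) `&` cube r) x.
    rewrite /G; elim: k => [|k ih]; first by rewrite !big_ord0 set0I indic0.
    rewrite !big_ord_recr /= ih !indicE !in_setI in_setU.
    case: (boolP (x \in cube r)); rewrite ?andbF ?andbT ?addr0//= => _.
    case: (boolP (x \in F k)) => [xk|_]; last by rewrite addr0 orbF.
    case: (boolP (x \in \big[setU/set0]_(i < k) F i)) => [|_]; last by rewrite add0r.
    rewrite inE -bigcup_mkord => -[i /= ik Fi]; move/set_mem : xk => Fk.
    by move/trivIsetP : tF => /(_ i k Logic.I Logic.I); rewrite (ltn_eqF ik) => /(_ isT) /seteqP[] /(_ x) [].
  have mU : measurable (\bigcup_k F k `&` cube r).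
    by apply: measurableI => //; apply: bigcup_measurable => k _; exact: mF.
  have sqI (B : set 'rV[R]_n) := @sqr_indic _ _ R B.
  have LQ : L1 \1_(@cube R n r) by apply: L1_indic => //; exact: cube_finite.
  have LU : L1 \1_(\bigcup_k F k `&` cube r).
    apply: L1_le LQ; first exact: measurable_indic.
    move=> x; rewrite ger0_norm// !indicE in_setI.
    by case: (x \in cube r); rewrite ?andbF// andbT; case: (_ \in _).
  have L2U : L2 \1_(\bigcup_k F k `&` cube r) by split; [exact: measurable_indic|rewrite sqI].
  have PG k : plancherel (G k) by apply: plancherel_sum => i; exact: PF.
  apply: (plancherel_lim PG LU L2U).
  have GU k x : `|G k x - \1_(\bigcup_k F k `&` cube r) x| <= \1_(@cube R n r) x.
    rewrite GE !indicE !in_setI; case: (x \in cube r); rewrite ?andbF ?andbT ?subrr ?normr0//=.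
    by case: (x \in _); case: (x \in _); rewrite ?subrr ?subr0 ?sub0r ?normr0 ?normrN ?normr1.
  have [] := @int_dominated_cvg _ _ _ leb (fun k x => (G k x - \1_(\bigcup_k F k `&` cube r) x) ^+ 2) (fun=> 0) \1_(@cube R n r).
  + move=> k; apply: measurable_funX; apply: measurable_funB; last exact: measurable_indic.
    by case: (PG k) => /L1_meas.
  + by [].
  + apply: aeW => x; apply: cvg_near_cst.
    have [[i _ Fix]|nU] := pselect ((\bigcup_k F k) x).
      near=> k; rewrite GE !indicE !in_setI.
      rewrite [x \in \bigcup_k F k]mem_set ?[x \in \big[_/_]_(_ < _) _]mem_set ?subrr ?expr0n//; last by exists i.
      by rewrite -bigcup_mkord; exists i => //=; near: k; exact: nbhs_infty_gt.
    near=> k; rewrite GE !indicE !in_setI.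
    rewrite [x \in \bigcup_k F k]memNset ?[x \in \big[_/_]_(_ < _) _]memNset ?subrr ?expr0n//.
    by rewrite -bigcup_mkord => -[i /= _ Fi]; apply: nU; exists i.
  + exact: LQ.
  + move=> k x; rewrite normrX (le_trans _ (GU k x))// expr2 ler_piMl//.
    by rewrite (le_trans (GU k x))// indicE; case: (_ \in _).
  by move=> _; rewrite int0; congr (_ --> _); apply/funext => k; rewrite sqE.
Unshelve. all: by end_near. Qed.

Import HBSimple HBNNSimple.

(** Simple approximations from below, cut off by growing cubes; (F_k - f)^2 is dominated by f^2. *)
Lemma plancherel_ge0 f : L1 f -> L2 f -> (forall x, 0 <= f x) -> plancherel f.
Proof.
move=> Lf L2f f0; have mf := measurable_int _ Lf.
pose g := nnsfun_approx measurableT mf.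
have g_le k x : 0 <= g k x <= f x.
  apply/andP; split; first exact: fun_ge0.
  rewrite -lee_fin nnsfun_approxE; apply: (@le_approx _ _ _ setT (EFin \o f) k x) => //.
  by move=> y _; rewrite lee_fin.
have g_cvg x : g k x @[k --> \oo] --> f x.
  have := @cvg_nnsfun_approx _ _ _ setT measurableT (EFin \o f) mf.
  move=> /(_ (fun y _ => f0 y) x Logic.I) h.
  exact: (fine_cvg h).
pose F k x := g k x * \1_(@cube R n k%:R) x.
have F_le k x : 0 <= F k x <= f x.
  have := g_le k x; rewrite /F indicE; case: (x \in _); first by rewrite mulr1.
  by rewrite mulr0 lexx f0.
have PF k : plancherel (F k).
  have -> : F k = fun x => \sum_(y <- finmap.enum_fset (fset_set (range (g k)))) y * \1_((g k @^-1` [set y]) `&` cube k%:R) x.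
    apply/funext => x; rewrite /F fimfunE fsbig_finite//= mulr_suml.
    by apply: eq_bigr => y _; rewrite -mulrA indicI.
  apply: plancherel_sum => y; apply: plancherelZ; apply: plancherel_cubeI.
  by rewrite -[X in measurable X]setTI; exact: measurable_funP.
apply: (plancherel_lim PF Lf L2f).
have [] := @int_dominated_cvg _ _ _ leb (fun k x => (F k x - f x) ^+ 2) (fun=> 0) (fun x => f x ^+ 2).
- move=> k; apply: measurable_funX; apply: measurable_funB; last exact: L1_meas Lf.
  by case: (PF k) => /L1_meas.
- by [].
- apply: aeW => x; rewrite (_ : 0 = (f x - f x) * (f x - f x)); last by rewrite subrr mulr0.
  under eq_fun do rewrite expr2.
  suff h : F k x @[k --> \oo] --> f x by apply: cvgM; apply: cvgB => //; exact: cvg_cst.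
  rewrite -[X in _ --> X]mulr1; apply: cvgM; first exact: g_cvg.
  apply: cvg_near_cst.
  have : [set: 'rV[R]_n] x by []; rewrite -bigcup_cube => -[i _ xi].
  near=> k; rewrite indicE mem_set//; apply: (cube_mono _ xi).
  by rewrite ler_nat; near: k; exact: nbhs_infty_ge.
- by case: L2f.
- move=> k x; rewrite normrX lerXn2r ?nnegrE//.
  by have /andP[h1 h2] := F_le k x; rewrite ler_norml; apply/andP; split; have := f0 x; lra.
by move=> _; rewrite int0; congr (_ --> _); apply/funext => k; rewrite sqE.
Unshelve. all: by end_near. Qed.

Theorem hartley_plancherel f : L1 f -> L2 f -> L2 (hartley f) /\ sq (hartley f) = sq f.
Proof.
move=> Lf L2f; have mf := L1_meas Lf.
pose p x := Num.max (f x) 0; pose m x := Num.max (- f x) 0.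
have mp : measurable_fun setT p by exact: measurable_maxr.
have mm : measurable_fun setT m by apply: measurable_maxr => //; exact: measurableT_comp.
have pf x : `|p x| <= `|f x|.
  by rewrite /p; have [h|h] := leP (f x) 0; rewrite ?normr0.
have mf' x : `|m x| <= `|f x|.
  by rewrite /m; have [h|h] := leP (- f x) 0; rewrite ?normr0 ?normrN.
have Pp : plancherel p.
  apply: plancherel_ge0; [exact: L1_le mp pf (L1_norm Lf)|exact: L2_le mp pf L2f|].
  by move=> x; rewrite le_max lexx orbT.
have Pm : plancherel m.
  apply: plancherel_ge0; [exact: L1_le mm mf' (L1_norm Lf)|exact: L2_le mm mf' L2f|].
  by move=> x; rewrite le_max lexx orbT.
have := plancherelB Pp Pm.
rewrite (_ : (fun x => p x - m x) = f); last first.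
  apply/funext => x; rewrite /p /m; have [h|h] := leP (f x) 0.
    by rewrite max_l ?oppr_ge0// sub0r opprK.
  by rewrite max_r ?subr0// oppr_le0 ltW.
by case=> _ _ ->; split => //; case: (hartley_bessel Lf L2f).
Qed.

End plancherel.

(** * Balayage for a bounded jump generator *)

Section monotone_L2_limit.
Context d (T : measurableType d) (R : realType) (mu : {measure set T -> \bar R}).
Variables (F : nat -> T -> R) (C : R).
Hypotheses (LF : forall k, L2 mu (F k)) (F0 : forall k x, 0 <= F k x).
Hypothesis F_homo : forall k x, F k x <= F k.+1 x.
Hypothesis FC : forall k, sq mu (F k) <= C.

Let F_le j k x : (j <= k)%N -> F j x <= F k x.
Proof. by move=> jk; rewrite -(subnKC jk); elim: (k - j)%N => [|i ih]; rewrite ?addn0// addnS (le_trans ih). Qed.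

(** The pointwise limit could be infinite; monotone convergence of the squares confines this to a
    null set, where [fine] yields 0. Hence the comparison with [G] holds almost everywhere, whereas
    the last clause holds at every point. *)
Lemma monotone_L2_limit : exists2 G, L2 mu G &
  [/\ forall x, 0 <= G x, sq mu G <= C,
      {ae mu, forall x, F k x @[k --> \oo] --> G x /\ forall k, F k x <= G x} &
      forall x, 0 < G x -> exists k, 0 < F k x].
Proof.
pose l x := limn (fun k => (F k x)%:E).
have cl x : (F k x)%:E @[k --> \oo] --> l x.
  by apply: ereal_nondecreasing_is_cvgn => j k jk; rewrite lee_fin F_le.
have Fl k x : ((F k x)%:E <= l x)%E.
  by apply: lime_ge; [exact: cvgP (cl x)|near=> j; rewrite lee_fin F_le//; near: j; exact: nbhs_infty_ge].
have mF k : measurable_fun setT (F k) by exact: L2_meas (LF k).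
have ml : measurable_fun setT l.
  by apply: (emeasurable_fun_cvg (fun k x => (F k x)%:E)) => [k|x _]; [exact/measurable_EFinP|exact: cl].
pose G x := fine (l x).
have l0 x : (0 <= l x)%E by apply: le_trans (Fl 0%N x); rewrite lee_fin.
have G0 x : 0 <= G x by exact: fine_ge0.
have mG : measurable_fun setT G by apply: (measurableT_comp (fine_measurable measurableT)).
have lfin : {ae mu, forall x, l x \is a fin_num}.
  pose h k x := ((F k x ^+ 2)%:E : \bar R).
  have nd x : nondecreasing_seq (h ^~ x).
    by move=> j k jk; rewrite lee_fin lerXn2r ?nnegrE// F_le.
  have mh k : measurable_fun setT (h k) by apply/measurable_EFinP; exact: measurable_funX.
  have h0 k x : (0 <= h k x)%E by rewrite lee_fin sqr_ge0.
  pose L x := limn (h ^~ x).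
  have hL x : h k x @[k --> \oo] --> L x by exact: ereal_nondecreasing_is_cvgn.
  have mL : measurable_fun setT L.
    by apply: (emeasurable_fun_cvg h) => // x _; exact: hL.
  have L0 x : (0 <= L x)%E by apply: lime_ge; [exact: cvgP (hL x)|exact: nearW].
  have iL : (\int[mu]_x L x <= C%:E)%E.
    rewrite (monotone_convergence mu measurableT mh (fun k x _ => h0 k x) (fun x _ => nd x)).
    apply: lime_le.
      apply: ereal_nondecreasing_is_cvgn => j k jk.
      by apply: ge0_le_integral => // x _; exact: nd.
    apply: nearW => k; rewrite (_ : (\int[mu]_x h k x)%E = (sq mu (F k))%:E) ?lee_fin//.
    by rewrite sqE -L1_fin_num//; case: (LF k).
  have IL : mu.-integrable setT L.
    apply/integrableP; split => //; under eq_integral do rewrite gee0_abs//.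
    by apply: le_lt_trans iL _; rewrite ltry.
  apply: filterS (integrable_ae measurableT IL) => x /(_ Logic.I) fx.
  rewrite ge0_fin_numE//; apply: (@le_lt_trans _ _ (1 + L x)%E); last first.
    by rewrite -ge0_fin_numE ?adde_ge0// fin_numD fx.
  apply: lime_le; first exact: cvgP (cl x).
  (* F <= 1 + F^2 carries finiteness from the limit of the squares to the limit of the functions. *)
  apply: nearW => k; apply: (@le_trans _ _ (1 + h k x)%E).
    by rewrite -EFinD lee_fin; have := sqr_ge0 (F k x - 1); have := F0 k x; nra.
  by rewrite leeD2l//; apply: lime_ge; [exact: cvgP (hL x)|near=> j; apply: nd; near: j; exact: nbhs_infty_ge].
have FG : {ae mu, forall x, F k x @[k --> \oo] --> G x /\ forall k, F k x <= G x}.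
  apply: filterS lfin => x fx; split.
    by have := cl x; rewrite -(fineK fx) => h; exact: (fine_cvg h).
  by move=> k; rewrite -lee_fin fineK.
have [] := @fatou_int _ _ _ mu (fun k x => F k x ^+ 2) (fun x => G x ^+ 2) C.
- by move=> k; case: (LF k).
- by move=> k x; exact: sqr_ge0.
- exact: measurable_funX.
- by move=> x; exact: sqr_ge0.
- apply: filterS FG => x [h _]; under eq_fun do rewrite expr2.
  by rewrite expr2; exact: cvgM.
- by apply: nearW => k; rewrite -sqE.
move=> LG GC; exists G; first by split.
split => //.
move=> x Gx; apply: contrapT => /forallNP nF.
have F00 k : F k x = 0 by apply/eqP; rewrite eq_le F0 andbT leNgt; apply/negP/nF.
move: Gx; rewrite /G /l; under eq_fun do rewrite F00.
by rewrite lim_cst//= ltxx.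
Unshelve. all: by end_near. Qed.

End monotone_L2_limit.

(** * The spectral gap on sets of finite measure, and bounded jump generators *)

Section spectral.
Context {R : realType} {n : nat}.
Local Notation leb := (lebesgue_rV n : {sigma_finite_measure set 'rV[R]_n -> \bar R}).
Local Notation L1 := (L1 leb).
Local Notation L2 := (L2 leb).
Local Notation Int := (Int leb).
Local Notation sq := (sq leb).
Local Notation ip := (ip leb).
Implicit Types (s f g h : 'rV[R]_n -> R) (x xi : 'rV[R]_n).

Lemma hartley_ip f g : L1 f -> L2 f -> L1 g -> L2 g -> ip (hartley f) (hartley g) = ip f g.
Proof.
move=> Lf L2f Lg L2g.
have [Hf Ef] := hartley_plancherel Lf L2f; have [Hg Eg] := hartley_plancherel Lg L2g.
have [_] := hartley_plancherel (L1D Lf Lg) (L2D L2f L2g).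
rewrite hartleyD// (sqD Hf Hg) (sqD L2f L2g) Ef Eg => E.
by move/addIr/addrI : E => /mulfI; apply.
Qed.

Lemma L1_support_le h (m : R) : L1 h -> L2 h -> (leb [set x | (h x != 0)%R] <= m%:E)%E ->
  (Int (fun x => `|h x|)) ^+ 2 <= m * sq h.
Proof.
move=> Lh L2h hm; have mh := L1_meas Lh.
have m0 : 0 <= m by rewrite -lee_fin; apply: le_trans hm.
pose A := [set x | h x != 0].
have mA : measurable A by exact: measurable_neq0.
have fA : (leb A < +oo)%E by apply: le_lt_trans hm _; rewrite ltry.
have LA : L1 \1_A by exact: L1_indic.
have L2A : L2 \1_A by exact: L2_indic.
have L2N : L2 (fun x => `|h x|).
  by apply: L2_le L2h; [exact: measurableT_comp|move=> x; rewrite normr_id].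
have -> : Int (fun x => `|h x|) = ip \1_A (fun x => `|h x|).
  congr (Int _); apply/funext => x; rewrite indicE.
  have [|] := boolP (x \in A); first by rewrite mul1r.
  by rewrite notin_setE /A /= => /negP/negPn/eqP ->; rewrite normr0 mulr0.
apply: le_trans (cauchy_schwarz L2A L2N) _.
have -> : sq (fun x => `|h x|) = sq h.
  by rewrite !sqE; congr (Int _); apply/funext => x; rewrite real_normK ?num_real.
apply: ler_wpM2r; first exact: sq_ge0.
by rewrite sqE sqr_indic -lee_fin -L1_fin_num// integral_indic// setIT.
Qed.

(** By Cauchy-Schwarz on the support, |h^|^2 <= 4 |h|_1^2 <= 4 m |h|_2^2 at every point, so a cube
    of small volume around 0 carries at most half of the L^2 mass of h^. *)
Lemma spectral_gap (hn : (1 <= n)%N) (m : R) : 0 <= m ->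
  exists2 r : R, 0 < r & forall h, L1 h -> L2 h ->
  (leb [set x | (h x != 0)%R] <= m%:E)%E ->
  sq h <= 2 * Int (fun xi => hartley h xi ^+ 2 * \1_(~` cube r) xi).
Proof.
move=> m0.
(* Chosen so that 4 m (2r)^n <= 8 m r <= 1/2; the [+ 1] covers m = 0. *)
pose r : R := (16 * (m + 1))^-1.
have r0 : 0 < r by rewrite invr_gt0 mulr_gt0// ltr_pwDr.
have r1 : 2 * r <= 1.
  by rewrite /r ler_pdivrMr ?mulr_gt0 ?ltr_pwDr// mul1r; lra.
exists r => // h Lh L2h hm.
have [LH E] := hartley_plancherel Lh L2h.
have mQ : measurable (@cube R n r) by exact: measurable_cube.
have LH2 : L1 (fun xi => hartley h xi ^+ 2) by case: LH.
have ind1 (B : set 'rV[R]_n) x := @norm_indic_le1 _ _ R B x.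
have LHc : L1 (fun xi => hartley h xi ^+ 2 * \1_(~` cube r) xi).
  by apply: (@L1_bM _ _ _ _ _ _ 1) => //; apply: measurable_indic; exact: measurableC.
have LHQ : L1 (fun xi => hartley h xi ^+ 2 * \1_(cube r) xi).
  by apply: (@L1_bM _ _ _ _ _ _ 1) => //; exact: measurable_indic.
have LQ : L1 \1_(@cube R n r) by apply: L1_indic => //; exact: cube_finite.
have split_sq : sq h = Int (fun xi => hartley h xi ^+ 2 * \1_(cube r) xi) +
    Int (fun xi => hartley h xi ^+ 2 * \1_(~` cube r) xi).
  rewrite -E sqE -intD//; congr (Int _); apply/funext => xi.
  by rewrite !indicE in_setC; case: (_ \in _); rewrite /= ?mulr1 ?mulr0 ?addr0 ?add0r.
have low : Int (fun xi => hartley h xi ^+ 2 * \1_(cube r) xi) <= 2^-1 * sq h.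
  apply: (@le_trans _ _ (Int (fun xi => (4 * (m * sq h)) * \1_(@cube R n r) xi))).
    apply: int_le => //; first exact: L1Z.
    move=> xi; apply: ler_wpM2r => //.
    rewrite -[leLHS]real_normK ?num_real//.
    apply: (@le_trans _ _ ((2 * Int (fun x => `|h x|)) ^+ 2)).
      by rewrite lerXn2r ?nnegrE ?norm_hartley_le// mulr_ge0// int_ge0.
    rewrite exprMn; apply: ler_pM; rewrite ?sqr_ge0//; first by rewrite -natrX.
    exact: L1_support_le.
  rewrite intZl//.
  have -> : Int \1_(@cube R n r) = (2 * r) ^+ n.
    apply: EFin_inj; rewrite -L1_fin_num// integral_indic// setIT.
    exact: lebesgue_cube (ltW r0).
  (* Here n >= 1 enters: in dimension 0 the cube would not shrink. *)
  have rn : (2 * r) ^+ n <= 2 * r.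
    case: n hn => // k _; rewrite exprS ler_piMr ?mulr_ge0 ?(ltW r0)//.
    by rewrite exprn_ile1// mulr_ge0// ltW.
  have sh := sq_ge0 leb h.
  have c0 : 0 <= 4 * (m * sq h) by rewrite !mulr_ge0.
  apply: le_trans (ler_wpM2l c0 rn) _.
  rewrite (_ : 4 * (m * sq h) * (2 * r) = (8 * m * r) * sq h); last by ring.
  apply: ler_wpM2r => //; rewrite /r ler_pdivrMr ?mulr_gt0 ?ltr_pwDr//.
  by lra.
by move: split_sq low => ->; lra.
Qed.

Definition jump_kernel s := [/\ L1 s, exists M : R, forall x, `|s x| <= M,
  forall x, s (- x) = s x, forall x, 0 <= s x & Int s <= 1].

Lemma norm_cosT_le s xi : jump_kernel s -> `|cosT s xi| <= 1.
Proof.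
case=> Ls _ _ s0 s1; apply: le_trans (norm_int_le (L1_cosT_kernel xi Ls)) _.
apply: le_trans s1; apply: int_le => //; first by apply: L1_norm; exact: L1_cosT_kernel.
by move=> x; rewrite normrM ger0_norm// ler_piMr// cos_max.
Qed.

Lemma measurable_cosT s : L1 s -> measurable_fun setT (cosT s).
Proof.
move=> Ls; apply: (@measurable_Int _ _ _ _ _ leb (fun z : 'rV[R]_n * 'rV[R]_n => s z.2 * cos (2 * pi * dotrV z.2 z.1))).
apply: measurable_funM; first by apply: measurableT_comp => //; exact: L1_meas Ls.
apply: (@measurableT_comp _ _ _ _ _ _ (@cos R)).
  by apply: continuous_measurable_fun; exact: continuous_cos.
by apply: measurable_funM => //; exact: measurable_fun_dotrV.
Qed.

(* kap (1 - s * .) : a generator of a compound Poisson process *)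
Definition gen (kap : R) s h x : R := kap * (h x - convol s h x).

Definition symbol (kap : R) s xi : R := kap * (1 - cosT s xi).

Variables (kap : R) (s : 'rV[R]_n -> R).
Hypotheses (kap0 : 0 <= kap) (ks : jump_kernel s).

Lemma symbol_ge0 xi : 0 <= symbol kap s xi.
Proof. by rewrite mulr_ge0// subr_ge0 (le_trans (ler_norm _))// norm_cosT_le. Qed.

Lemma symbol_bounded xi : `|symbol kap s xi| <= 2 * kap.
Proof.
rewrite normrM ger0_norm// mulrC ler_wpM2r// (le_trans (ler_normB _ _))// normr1.
by have := norm_cosT_le xi ks; lra.
Qed.

Lemma measurable_symbol : measurable_fun setT (symbol kap s).
Proof.
apply: measurable_funM => //; apply: measurable_funB => //.
by case: ks => Ls *; exact: measurable_cosT.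
Qed.

Lemma L1_gen h : L1 h -> L1 (gen kap s h).
Proof. by case: ks => Ls [M sM] _ _ _ Lh; apply/L1Z/L1B => //; exact: L1_conv Ls sM _ Lh. Qed.

Lemma L2_gen h : L1 h -> L2 h -> L2 (gen kap s h).
Proof. by case: ks => Ls [M sM] _ _ _ Lh L2h; apply/L2Z/L2B => //; exact: L2_conv Ls sM _ Lh. Qed.

Lemma hartley_gen h : L1 h -> hartley (gen kap s h) = fun xi => symbol kap s xi * hartley h xi.
Proof.
case: ks => Ls [M sM] se _ _ Lh.
have Lc := L1_conv Ls sM Lh.
rewrite hartleyZ; last exact: L1B.
rewrite hartleyB//; apply/funext => xi.
by rewrite (hartley_conv xi Ls sM se Lh) /symbol; ring.
Qed.

Lemma ip_gen h g : L1 h -> L2 h -> L1 g -> L2 g ->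
  ip (gen kap s h) g = Int (fun xi => symbol kap s xi * (hartley h xi * hartley g xi)).
Proof.
move=> Lh L2h Lg L2g; rewrite -hartley_ip//; [|exact: L1_gen|exact: L2_gen].
by rewrite hartley_gen// /ip; congr (Int _); apply/funext => xi; rewrite mulrA.
Qed.

End spectral.

(** * The sweeping process and its limit *)

Section balayage.
Context {R : realType} {n : nat}.
Local Notation leb := (lebesgue_rV n : {sigma_finite_measure set 'rV[R]_n -> \bar R}).
Local Notation L1 := (L1 leb).
Local Notation L2 := (L2 leb).
Local Notation Int := (Int leb).
Local Notation sq := (sq leb).
Local Notation ip := (ip leb).
Variables (s f : 'rV[R]_n -> R) (lam C : R).
Hypotheses (ks : jump_kernel s) (Lf : L1 f) (L2f : L2 f) (f0 : forall x, 0 <= f x) (lam0 : 0 < lam).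
Let m := Int f / lam.
Hypothesis C0 : 0 <= C.
Hypothesis gap : forall h, L1 h -> L2 h -> (leb [set x | (h x != 0)%R] <= m%:E)%E ->
  sq h <= C * ip h (fun x => h x - convol s h x).

Let Ls : L1 s. Proof. by case: ks. Qed.
Let s0 x : 0 <= s x. Proof. by case: ks. Qed.

Definition excess (g : 'rV[R]_n -> R) x := Num.max (g x - lam) 0.

Fixpoint sweep k : 'rV[R]_n -> R :=
  if k is k'.+1 then fun x => sweep k' x - excess (sweep k') x + convol s (excess (sweep k')) x
  else f.

(** As in the divisible sandpile, the odometer at x is the total mass emitted from x during the
    first k sweeps. *)
Fixpoint odometer k : 'rV[R]_n -> R :=
  if k is k'.+1 then fun x => odometer k' x + excess (sweep k') x else fun=> 0.

Lemma excess_ge0 g x : 0 <= excess g x.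
Proof. by rewrite le_max lexx orbT. Qed.

Lemma excess_le g x : 0 <= g x -> excess g x <= g x.
Proof. by move=> g0; rewrite ge_max g0 andbT gerBl ltW. Qed.

Lemma measurable_excess g : measurable_fun setT g -> measurable_fun setT (excess g).
Proof. by move=> mg; apply: measurable_maxr => //; exact: measurable_funB. Qed.

Lemma sweep_spec k : [/\ L1 (sweep k), L2 (sweep k), forall x, 0 <= sweep k x & Int (sweep k) <= Int f].
Proof.
elim: k => [|k [Lk L2k k0 Ik]] //=.
have [_ [M sM] _ _ s1] := ks.
have me := measurable_excess (L1_meas Lk).
have eb x : `|excess (sweep k) x| <= sweep k x.
  by rewrite ger0_norm ?excess_ge0// excess_le.
have Le : L1 (excess (sweep k)) by exact: L1_le me eb Lk.
have L2e : L2 (excess (sweep k)).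
  by apply: L2_le L2k => // x; rewrite (le_trans (eb x))// ler_norm.
have Lc := L1_conv Ls sM Le; have L2c := L2_conv Ls sM Le.
split.
- by apply: L1D => //; exact: L1B.
- by apply: L2D => //; exact: L2B.
- move=> x; rewrite addr_ge0//; last by apply: conv_ge0 => // y; exact: excess_ge0.
  by rewrite subr_ge0 excess_le.
rewrite intD//; last exact: L1B.
rewrite intB// (Int_conv Ls sM Le).
have I0 : 0 <= Int (excess (sweep k)) by apply: int_ge0 => x; exact: excess_ge0.
have := ler_wpM2r I0 s1; rewrite mul1r.
by move: Ik; lra.
Qed.

Lemma excess_spec k : L1 (excess (sweep k)) /\ L2 (excess (sweep k)).
Proof.
have [Lk L2k k0 _] := sweep_spec k.
have me := measurable_excess (L1_meas Lk).
have eb x : `|excess (sweep k) x| <= sweep k x.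
  by rewrite ger0_norm ?excess_ge0// excess_le.
split; first exact: L1_le me eb Lk.
by apply: L2_le L2k => // x; rewrite (le_trans (eb x))// ler_norm.
Qed.

(** The last clause rests on the order of operations: a point that emits is cut down to exactly
    [lam], and from then on it only receives mass or is cut to [lam] again. *)
Lemma odometer_spec k : [/\ L1 (odometer k), L2 (odometer k), forall x, 0 <= odometer k x,
  forall x, sweep k x = f x - odometer k x + convol s (odometer k) x &
  forall x, 0 < odometer k x -> lam <= sweep k x].
Proof.
have [_ [M sM] _ _ s1] := ks.
elim: k => [|k [Lk L2k k0 kE kl]] /=.
  split; [exact: L1_0|exact: L2_0|by []| |by move=> x; rewrite ltxx].
  move=> x; rewrite subr0 /convol; under [X in Int X]eq_fun do rewrite mulr0.
  by rewrite int0 addr0.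
have [Le L2e] := excess_spec k.
split; [exact: L1D|exact: L2D| | |].
- by move=> x; rewrite addr_ge0// excess_ge0.
- by move=> x; rewrite (convD Ls sM)// kE; ring.
- move=> x ux.
  have c0 : 0 <= convol s (excess (sweep k)) x by apply: conv_ge0 => // y; exact: excess_ge0.
  move: (kl x) ux; rewrite /excess; have [h|h] := leP (sweep k x - lam) 0.
    by rewrite addr0 => kl' ux; have := kl' ux; lra.
  by move=> _ _; lra.
Qed.

(** Chebyshev's inequality: every point that has emitted retains at least [lam], and sweeping never
    increases the total mass. *)
Lemma odometer_support k : (leb [set x | (odometer k x != 0)%R] <= m%:E)%E.
Proof.
have [Lk L2k k0 _ kl] := odometer_spec k; have [Lsw _ sw0 Isw] := sweep_spec k.
pose A := [set x | odometer k x != 0].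
have mA : measurable A by apply: measurable_neq0; exact: L1_meas Lk.
rewrite -/A.
have H : (lam%:E * leb A <= (Int f)%:E)%E.
  rewrite -integral_cst// -/(cst _).
  apply: (@le_trans _ _ (Int (sweep k))%:E); last by rewrite lee_fin.
  rewrite -L1_fin_num// integral_mkcond; apply: ge0_le_integral => //.
  - move=> x _; rewrite /patch; case: ifP => // _; rewrite lee_fin; exact: ltW.
  - by apply/measurable_restrict => //; exact: measurable_cst.
  - by apply/measurable_EFinP; exact: L1_meas Lsw.
  - move=> x _; rewrite /patch; case: ifPn; last by rewrite lee_fin.
    by rewrite inE /A /= => ux; rewrite lee_fin kl// lt_def ux k0.
by rewrite /m mulrC EFinM lee_pdivlMl.
Qed.

(** Test [odometer k - s * odometer k = f - sweep k] with the odometer itself: the term with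
    [sweep k] has a favourable sign, the gap bounds [sq] by C times the product with [f], and
    Cauchy-Schwarz closes the estimate uniformly in k. *)
Lemma odometer_bounded k : sq (odometer k) <= C ^+ 2 * sq f.
Proof.
have [Lk L2k k0 kE kl] := odometer_spec k; have [Lsw L2sw sw0 Isw] := sweep_spec k.
have H := gap Lk L2k (odometer_support k).
have E : ip (odometer k) (fun x => odometer k x - convol s (odometer k) x) <= ip (odometer k) f.
  rewrite (_ : (fun x => _) = fun x => f x - sweep k x); last by apply/funext => x; rewrite kE; ring.
  rewrite ipBr// gerBl; apply: int_ge0 => x; exact: mulr_ge0.
have {E H} : sq (odometer k) <= C * ip (odometer k) f.
  by apply: le_trans H _; rewrite ler_wpM2l.
have := cauchy_schwarz L2k L2f; have := sq_ge0 leb (odometer k); have := sq_ge0 leb f.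
set a := sq (odometer k); set b := ip (odometer k) f; set c := sq f => c0 a0 cs ab.
have [->|an0] := eqVneq a 0; first by rewrite mulr_ge0// sqr_ge0.
have ap : 0 < a by rewrite lt_def an0.
rewrite -(ler_pM2l ap).
apply: (@le_trans _ _ ((C * b) ^+ 2)); first by rewrite -expr2 lerXn2r ?nnegrE// (le_trans a0).
rewrite exprMn [leRHS]mulrCA; apply: ler_wpM2l => //; exact: sqr_ge0.
Qed.

(** The bound mu <= lam appears only in the limit: the excess at stage k is an increment of the
    odometer, and the odometer converges. Where U > 0, some stage already has a positive odometer,
    and from then on the swept density is at least lam. *)
Lemma balayage : exists U, [/\ L1 U, L2 U, forall x, 0 <= U x,
  (leb [set x | (0 < U x)%R] <= m%:E)%E &
  {ae leb, forall x, let mu := f x - (U x - convol s U x) in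
     0 <= mu <= lam /\ (0 < U x -> mu = lam)}].
Proof.
have [_ [M sM] _ _ s1] := ks.
have L2o k : L2 (odometer k) by case: (odometer_spec k).
have Lo k : L1 (odometer k) by case: (odometer_spec k).
have o0 k x : 0 <= odometer k x by case: (odometer_spec k).
have oS k x : odometer k x <= odometer k.+1 x by rewrite /= lerDl excess_ge0.
have [U L2U [U0 sqU oU Upos]] := monotone_L2_limit L2o o0 oS odometer_bounded.
have mU := L2_meas L2U.
pose A k := [set x | 0 < odometer k x].
have mA k : measurable (A k) by apply: measurable_superlevel; exact: L1_meas (Lo k).
have mP : measurable [set x | 0 < U x] by exact: measurable_superlevel.
have Um : (leb [set x | (0 < U x)%R] <= m%:E)%E.
  apply: (@le_trans _ _ (leb (\bigcup_k A k))).
    apply: le_measure; rewrite ?inE//; first exact: bigcup_measurable.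
    by move=> x /= /Upos[k ?]; exists k.
  have ndA : nondecreasing_seq A.
    apply/nondecreasing_seqP => k; rewrite subsetEset => x /= h.
    exact: lt_le_trans h (oS k x).
  have cv : leb (A k) @[k --> \oo] --> leb (\bigcup_k A k).
    by apply: nondecreasing_cvg_mu => //; exact: bigcup_measurable.
  rewrite -(cvg_lim (@ereal_hausdorff R) cv); apply: lime_le.
    by apply/cvg_ex; eexists; exact: cv.
  apply: nearW => k /=; apply: le_trans (odometer_support k).
  apply: le_measure; rewrite ?inE//; first by apply: measurable_neq0; exact: L1_meas (Lo k).
  by move=> x /=; rewrite /A /= => h; rewrite gt_eqF.
have LU : L1 U.
  apply: (L2_finite_support_L1 (m := m) L2U); rewrite (_ : [set x | _] = [set x | 0 < U x])//.
  by apply/seteqP; split => x /=; rewrite lt_def U0 andbT.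
exists U; split => //.
(* The odometers increase to [U] almost everywhere and the kernel is bounded by [M], so [M * U]
   dominates the integrands at every x. *)
have conv_cvg x : convol s (odometer k) x @[k --> \oo] --> convol s U x.
  apply: (@ae_int_dominated_cvg _ _ _ leb (fun k y => s (x - y) * odometer k y) _ (fun y => M * U y)).
  - by move=> k; exact: L1_meas (L1_conv_kernel Ls sM x (Lo k)).
  - exact: L1_meas (L1_conv_kernel Ls sM x LU).
  - by apply: filterS oU => y [h _]; apply: cvgMr.
  - exact: L1Z.
  - apply: filterS oU => y [_ h] k; rewrite normrM (ger0_norm (o0 _ _)).
    by apply: ler_pM => //; exact: le_trans (normr_ge0 _) (sM 0).
apply: filterS oU => x [ox oxle] /=.
have sw_cvg : sweep k x @[k --> \oo] --> f x - (U x - convol s U x).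
  rewrite opprB addrA addrAC.
  rewrite (_ : (fun k => sweep k x) = fun k => f x - odometer k x + convol s (odometer k) x); last first.
    by apply/funext => k; case: (odometer_spec k).
  by apply: cvgD => //; apply: cvgB => //; exact: cvg_cst.
have ex_cvg : excess (sweep k) x @[k --> \oo] --> (0 : R).
  rewrite (_ : (fun k => _) = fun k => odometer k.+1 x - odometer k x); last first.
    by apply/funext => k /=; ring.
  rewrite -(subrr (U x)); apply: cvgB => //.
  by rewrite (cvg_shiftS (fun k => odometer k x)).
have low : lam <= f x - (U x - convol s U x) \/ U x = 0.
  have [Ux|Ux] := ltP 0 (U x); last by right; apply/eqP; rewrite eq_le Ux U0.
  left; have [k0 hk0] := Upos x Ux.
  apply: cvg_ge_cst sw_cvg _; near=> k.
  have [_ _ _ _] := odometer_spec k; apply; apply: lt_le_trans hk0 _.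
  have : (k0 <= k)%N by near: k; exact: nbhs_infty_ge.
  by move=> jk; rewrite -(subnKC jk); elim: (k - k0)%N => [|i ih]; rewrite ?addn0// addnS (le_trans ih).
have up : f x - (U x - convol s U x) <= lam.
  have h : sweep k x - excess (sweep k) x @[k --> \oo] --> f x - (U x - convol s U x) - 0.
    exact: cvgB.
  rewrite -[leLHS]subr0; apply: cvg_le_cst h _; apply: nearW => k.
  by rewrite lerBlDr -lerBlDl le_max lexx.
split.
  rewrite up andbT; apply: cvg_ge_cst sw_cvg _; apply: nearW => k.
  by case: (sweep_spec k).
move=> Ux; apply/eqP; rewrite eq_le up /=; case: low => // U00.
by rewrite U00 ltxx in Ux.
Unshelve. all: by end_near. Qed.

End balayage.

(** * Jump kernels approximating fractional powers of the Laplacian *)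

Section binomial_series.
Context {R : realType}.
Variable b : R.
Hypotheses (b0 : 0 < b) (b1 : b < 1).

(* 1 - (1 - z)^b = \sum_j bincoef j * z^(j+1), with nonnegative coefficients *)
Fixpoint bincoef j : R := if j is j'.+1 then bincoef j' * ((j'.+1%:R - b) / j'.+2%:R) else b.

Lemma bincoef_ge0 j : 0 <= bincoef j.
Proof.
elim: j => [|j ih] /=; first exact: ltW.
by rewrite mulr_ge0// divr_ge0// subr_ge0 (le_trans (ltW b1))// ler1n.
Qed.

Lemma bincoefS j : bincoef j.+1 * j.+2%:R = bincoef j * (j.+1%:R - b).
Proof. by rewrite /= mulrA divfK// pnatr_eq0. Qed.

(** Exact tail of the coefficient sum. Nonnegativity of the right side gives [bincoef_sum_le1];
    nonnegativity of the sum gives [bincoef_le]. *)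
Lemma bincoef_sum N : b * (1 - \sum_(j < N) bincoef j) = bincoef N * N.+1%:R.
Proof.
elim: N => [|N ih]; first by rewrite big_ord0 subr0 mulr1.
rewrite big_ord_recr /= opprD addrA mulrDr ih bincoefS.
by ring.
Qed.

Lemma bincoef_sum_le1 N : \sum_(j < N) bincoef j <= 1.
Proof.
rewrite -subr_ge0 -(pmulr_rge0 _ b0) bincoef_sum mulr_ge0//.
exact: bincoef_ge0.
Qed.

Lemma bincoef_le N : bincoef N * N.+1%:R <= b.
Proof.
rewrite -bincoef_sum ger_pMr// gerBl; apply: sumr_ge0 => j _.
exact: bincoef_ge0.
Qed.

Definition binrem N z : R := 1 - \sum_(j < N) bincoef j * z ^+ j.+1.
Definition dbinrem N z : R := - \sum_(j < N) bincoef j * j.+1%:R * z ^+ j.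

Lemma is_derive_binrem N (z : R) : is_derive z 1 (binrem N) (dbinrem N z).
Proof.
elim: N => [|N ih].
  rewrite (_ : binrem 0 = fun=> 1); last by apply/funext => y; rewrite /binrem big_ord0 subr0.
  rewrite /dbinrem big_ord0 oppr0; exact: is_derive_cst.
have E : binrem N.+1 = fun y => binrem N y - bincoef N * y ^+ N.+1.
  by apply/funext => y; rewrite /binrem big_ord_recr /= opprD addrA.
have dX : is_derive z 1 (fun y : R => y ^+ N.+1) (N.+1%:R * z ^+ N).
  have := is_deriveX N.+1 (is_derive_id z (1 : R)).
  rewrite (_ : (id ^+ N.+1 : R -> R) = fun y => y ^+ N.+1); last first.
    by apply/funext => y; rewrite fctE.
  by rewrite /GRing.scale /= mulr1.
have := is_deriveB ih (is_derive_mul (is_derive_cst (bincoef N) z (1 : R)) dX).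
rewrite E => D; apply: is_derive_eq D _.
by rewrite mulr0 addr0 [in RHS]/dbinrem big_ord_recr /= opprD mulrA.
Qed.

(** The function (1 - z)^b solves (1 - z) y' + b y = 0. For the truncated series the recurrence of
    the coefficients cancels all powers but the last. *)
Lemma binrem_ode N z : (1 - z) * dbinrem N z + b * binrem N z = bincoef N * N.+1%:R * z ^+ N.
Proof.
elim: N => [|N ih]; first by rewrite /dbinrem /binrem !big_ord0 /=; ring.
have -> : dbinrem N.+1 z = dbinrem N z - bincoef N * N.+1%:R * z ^+ N.
  by rewrite /dbinrem big_ord_recr /= opprD.
have -> : binrem N.+1 z = binrem N z - bincoef N * z ^+ N.+1.
  by rewrite /binrem big_ord_recr /= opprD addrA.
rewrite mulrBr (mulrBr b) addrACA ih bincoefS exprS; ring.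
Qed.

(** Divided by (1 - y)^b, the truncated series has a derivative given by [binrem_ode] in closed
    form, and value 1 at 0; the mean value theorem on [0, z] then controls its distance from 1. *)
Lemma binrem_bound N z : 0 <= z -> z < 1 ->
  `|binrem N z - (1 - z) `^ b| <= b / (1 - z) * z ^+ N.
Proof.
move=> z0 z1.
have [->|zn0] := eqVneq z 0.
  have -> : binrem N 0 = 1.
    by rewrite /binrem big1 ?subr0// => j _; rewrite expr0n mulr0.
  by rewrite subr0 powR1 subrr normr0 divr1 mulr_ge0 ?exprn_ge0// ltW.
have zp : 0 < z by rewrite lt_def zn0.
pose G y := binrem N y * (1 - y) `^ (- b).
pose dG y := bincoef N * N.+1%:R * y ^+ N * (1 - y) `^ (- b - 1).
have dGP (y : R) : y < 1 -> is_derive y 1 G (dG y).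
  move=> y1; have y1' : 0 < 1 - y by rewrite subr_gt0.
  have dl : is_derive y 1 (fun t : R => 1 - t) (- 1).
    have := is_deriveB (is_derive_cst (1 : R) y (1 : R)) (is_derive_id y (1 : R)).
    by rewrite sub0r.
  have dp := @is_derive1_comp R (fun t => t `^ (- b)) (fun t => 1 - t) y _ _ (is_derive1_powR (- b) y1') dl.
  have := is_derive_mul (is_derive_binrem N y) dp.
  rewrite (_ : _ + _ = dG y)// /dG -binrem_ode /comp.
  have -> : (1 - y) `^ (- b) = (1 - y) * (1 - y) `^ (- b - 1).
    rewrite -{2}[1 - y]powRr1 ?(ltW y1')// -powRD; first by congr (_ `^ _); ring.
    by apply/implyP => _; rewrite gt_eqF.
  by ring.
have cG : {within `[0, z], continuous G}.
  apply: derivable_within_continuous => y; rewrite in_itv /= => /andP[_ yz].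
  have y1 : y < 1 by exact: le_lt_trans yz z1.
  exact: (@ex_derive _ _ _ _ _ _ _ (dGP y y1)).
have [|c] := @MVT R G dG 0 z zp _ cG.
  by move=> y; rewrite in_itv /= => /andP[_ yz]; apply: dGP; exact: lt_trans yz z1.
rewrite in_itv /= => /andP[c0 cz] E.
have G0 : G 0 = 1.
  rewrite /G subr0 powR1 mulr1 /binrem big1 ?subr0// => j _.
  by rewrite expr0n mulr0.
have z1' : 0 < 1 - z by rewrite subr_gt0.
have P : 0 < (1 - z) `^ b by rewrite powR_gt0.
have GE : binrem N z - (1 - z) `^ b = (1 - z) `^ b * (G z - G 0).
  by rewrite G0 mulrBr mulr1 /G powRN mulrCA mulfV ?mulr1// gt_eqF.
have c1 : 0 < 1 - c by rewrite subr_gt0 (lt_trans cz).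
have cd : 1 - z <= 1 - c by rewrite lerB// ltW.
rewrite GE E normrM ger0_norm ?powR_ge0// normrM ger0_norm; last first.
  by rewrite /dG !mulr_ge0 ?powR_ge0 ?exprn_ge0 ?bincoef_ge0// ltW.
rewrite subr0 (ger0_norm z0) /dG.
have h1 : (1 - c) `^ (- b - 1) <= (1 - z) `^ (- b) * (1 - z)^-1.
  have -> : (1 - c) `^ (- b - 1) = ((1 - c) `^ b * (1 - c))^-1.
    rewrite -opprD powRN; congr (_^-1).
    rewrite powRD ?powRr1 ?(ltW c1)//.
    by apply/implyP => _; rewrite gt_eqF.
  rewrite powRN -invfM lef_pV2 ?posrE ?mulr_gt0 ?powR_gt0//.
  apply: ler_pM; rewrite ?powR_ge0 ?(ltW z1')//.
  by rewrite ge0_ler_powR ?nnegrE ?(ltW b0) ?(ltW z1') ?(ltW c1).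
have h2 : bincoef N * N.+1%:R * c ^+ N <= b * z ^+ N.
  apply: ler_pM; rewrite ?exprn_ge0 ?mulr_ge0 ?bincoef_ge0 ?(ltW c0)//.
    exact: bincoef_le.
  by rewrite lerXn2r ?nnegrE ?(ltW c0) ?(ltW cz).
have h3 : bincoef N * N.+1%:R * c ^+ N * (1 - c) `^ (- b - 1) <=
    (b * z ^+ N) * ((1 - z) `^ (- b) * (1 - z)^-1).
  apply: ler_pM => //; rewrite ?powR_ge0//.
  by rewrite !mulr_ge0 ?bincoef_ge0 ?exprn_ge0// ltW.
apply: (@le_trans _ _ ((1 - z) `^ b * ((b * z ^+ N) * ((1 - z) `^ (- b) * (1 - z)^-1) * 1))).
  apply: ler_wpM2l; first exact: powR_ge0.
  apply: ler_pM => //; last exact: ltW.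
  by rewrite !mulr_ge0 ?powR_ge0 ?bincoef_ge0 ?exprn_ge0// ltW.
rewrite mulr1 powRN le_eqVlt; apply/orP; left; apply/eqP.
by field; rewrite !gt_eqF.
Qed.

Lemma binrem_cvg_lt1 z : 0 <= z -> z < 1 -> binrem N z @[N --> \oo] --> (1 - z) `^ b.
Proof.
move=> z0 z1; apply/subr_cvg0.
apply: squeeze0 (fun N => binrem_bound N z0 z1) _.
have : geometric (b / (1 - z)) z N @[N --> \oo] --> (0 : R) by apply: cvg_geometric; rewrite ger0_norm.
exact.
Qed.

Lemma binrem_anti N y z : 0 <= y -> y <= z -> binrem N z <= binrem N y.
Proof.
move=> y0 yz; rewrite lerB//; apply: ler_sum => j _; apply: ler_wpM2l; first exact: bincoef_ge0.
by rewrite lerXn2r ?nnegrE// (le_trans y0).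
Qed.

(** The endpoint z = 1 is the value of the Gaussian at xi = 0. There the previous bound blows up,
    and monotonicity in z is used: 0 <= binrem N 1 <= binrem N (1 - t), with limit t^b for small
    t. *)
Lemma binrem_cvg z : 0 <= z -> z <= 1 -> binrem N z @[N --> \oo] --> (1 - z) `^ b.
Proof.
move=> z0; rewrite le_eqVlt => /predU1P[->|]; last exact: binrem_cvg_lt1.
rewrite subrr powR0 ?gt_eqF//.
have r0 N : 0 <= binrem N 1.
  rewrite /binrem subr_ge0; under eq_bigr do rewrite expr1n mulr1.
  exact: bincoef_sum_le1.
apply/cvgrPdist_le => e e0.
(* The second argument makes t^b at most e/2; the minimum with 1 keeps 1 - t in [0, 1). *)
pose t := Num.min 1 ((e / 2) `^ b^-1).
have t0 : 0 < t by rewrite lt_min ltr01 powR_gt0// divr_gt0.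
have t1 : t <= 1 by rewrite ge_min lexx.
have tb : t `^ b <= e / 2.
  apply: (@le_trans _ _ (((e / 2) `^ b^-1) `^ b)).
    by rewrite ge0_ler_powR ?nnegrE ?powR_ge0 ?(ltW b0) ?(ltW t0)// ge_min lexx orbT.
  by rewrite -powRrM mulVf ?gt_eqF// powRr1// divr_ge0// ltW.
have := @binrem_cvg_lt1 (1 - t) _ _; rewrite subr_ge0 subKr => /(_ t1).
rewrite ltrBlDr ltrDl => /(_ t0) /cvgrPdist_le /(_ (e / 2)) H.
near=> N; rewrite sub0r normrN ger0_norm//.
have h1 : `|t `^ b - binrem N (1 - t)| <= e / 2 by near: N; apply: H; rewrite divr_gt0.
have h2 : binrem N 1 <= binrem N (1 - t).
  by apply: binrem_anti; rewrite ?subr_ge0// gerBl ltW.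
by move: h1; rewrite ler_norml => /andP[]; lra.
Unshelve. all: by end_near. Qed.

(** Write (1 + t)^b = (1 + t) (1 + t)^(b-1); since b < 1, the factor (1 + t)^(b-1) is at most 1 and
    at most t^(b-1). *)
Lemma powR_subadd1 (t : R) : 0 <= t -> (1 + t) `^ b <= 1 + t `^ b.
Proof.
move=> t0; have [->|tn0] := eqVneq t 0; first by rewrite addr0 powR1 lerDl powR_ge0.
have tp : 0 < t by rewrite lt_def tn0.
have tp1 : 0 < 1 + t by rewrite addr_gt0.
have E x : 0 < x -> x `^ b = x * (x `^ (1 - b))^-1.
  move=> x0; rewrite -powRN -{2}[x]powRr1 ?(ltW x0)// -powRD.
    by congr (_ `^ _); ring.
  by apply/implyP => _; rewrite gt_eqF.
have b1' : 0 <= 1 - b by rewrite subr_ge0 ltW.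
rewrite !E// mulrDl mul1r; apply: lerD.
  rewrite invf_le1 ?powR_gt0// -[leLHS](congr1 (fun h => h (1 - b)) (powR1 R)).
  by rewrite ge0_ler_powR ?nnegrE ?ler01 ?(ltW tp1)// lerDl.
rewrite ler_wpM2l// lef_pV2 ?posrE ?powR_gt0//.
by rewrite ge0_ler_powR ?nnegrE ?(ltW tp1)// lerDr.
Qed.

End binomial_series.

Section fractional_kernel.
Context {R : realType} {n : nat}.
Local Notation leb := (lebesgue_rV n : {sigma_finite_measure set 'rV[R]_n -> \bar R}).
Implicit Types (x xi : 'rV[R]_n).
Variables b eps : R.
Hypotheses (b0 : 0 < b) (b1 : b < 1) (eps0 : 0 < eps).

(** With z = [gaussn eps xi], the power z^(j+1) is the transform of [heat (eps * j.+1%:R)]; the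
    exponents start at 1, so no Dirac mass occurs. *)
Definition partial_kernel N x : R := \sum_(j < N) bincoef b j * heat (eps * j.+1%:R) x.

Let epsj j : 0 < eps * j.+1%:R. Proof. by rewrite mulr_gt0. Qed.

Let M : R := Num.sqrt (pi / eps) ^+ n.

Let heat_M j x : heat (eps * j.+1%:R) x <= M.
Proof.
apply: le_trans (heat_le (epsj j) x) _; rewrite lerXn2r ?nnegrE ?sqrtr_ge0//.
rewrite ler_wsqrtr// ler_wpM2l ?pi_ge0// lef_pV2 ?posrE//.
by rewrite ler_peMr ?(ltW eps0)// ler1n.
Qed.

Lemma L1_partial_kernel N : L1 leb (partial_kernel N).
Proof. by apply: L1_sum => j _; apply: L1Z; exact: L1_heat. Qed.

Lemma partial_kernel_ge0 N x : 0 <= partial_kernel N x.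
Proof. by apply: sumr_ge0 => j _; rewrite mulr_ge0 ?bincoef_ge0// heat_ge0. Qed.

Lemma partial_kernel_le N x : partial_kernel N x <= M.
Proof.
apply: (@le_trans _ _ (\sum_(j < N) bincoef b j * M)).
  by apply: ler_sum => j _; rewrite ler_wpM2l ?bincoef_ge0.
rewrite -mulr_suml ler_piMl ?exprn_ge0 ?sqrtr_ge0//.
exact: bincoef_sum_le1.
Qed.

Lemma Int_partial_kernel N : Int leb (partial_kernel N) <= 1.
Proof.
rewrite /partial_kernel int_sum; last by move=> j; apply: L1Z; exact: L1_heat.
under eq_bigr do rewrite (intZl _ (L1_heat (epsj _))) Int_heat// mulr1.
exact: bincoef_sum_le1.
Qed.

Definition fractional_kernel x : R := limn (partial_kernel^~ x).

Lemma partial_kernel_cvg x : partial_kernel N x @[N --> \oo] --> fractional_kernel x.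
Proof.
apply: nondecreasing_is_cvgn.
  apply/nondecreasing_seqP => N; rewrite /partial_kernel big_ord_recr /= lerDl.
  by rewrite mulr_ge0 ?bincoef_ge0// heat_ge0.
by exists M => _ [N _ <-]; exact: partial_kernel_le.
Qed.

Lemma partial_kernel_le_lim N x : partial_kernel N x <= fractional_kernel x.
Proof.
apply: (cvg_ge_cst (u := fun k => partial_kernel k x)) (@partial_kernel_cvg x) _; near=> k.
have : (N <= k)%N by near: k; exact: nbhs_infty_ge.
move=> Nk; rewrite -(subnKC Nk); elim: (k - N)%N => [|i ih]; rewrite ?addn0//.
rewrite addnS (le_trans ih)// /partial_kernel big_ord_recr /= lerDl.
by rewrite mulr_ge0 ?bincoef_ge0// heat_ge0.
Unshelve. all: by end_near. Qed.

(** The coefficients sum to at most 1 and the Gaussian of index 0 has the highest peak, which gives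
    the uniform bound; Fatou's lemma gives the mass. *)
Lemma kernel_fractional : jump_kernel fractional_kernel.
Proof.
have s0 x : 0 <= fractional_kernel x.
  apply: (cvg_ge_cst (u := fun k => partial_kernel k x)) (@partial_kernel_cvg x) _.
  by apply: nearW => N; exact: partial_kernel_ge0.
have ms : measurable_fun setT fractional_kernel.
  apply: (measurable_fun_cvg (h := partial_kernel)).
    by move=> N; exact: L1_meas (L1_partial_kernel N).
  by move=> x _; exact: partial_kernel_cvg.
have [] := @fatou_int _ _ _ leb partial_kernel fractional_kernel 1.
- exact: L1_partial_kernel.
- exact: partial_kernel_ge0.
- exact: ms.
- exact: s0.
- by apply: aeW => x; exact: partial_kernel_cvg.
- by apply: nearW => N; exact: Int_partial_kernel.
move=> Ls s1; split => //.
- exists M => x; rewrite ger0_norm//.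
  apply: (cvg_le_cst (u := fun k => partial_kernel k x)) (@partial_kernel_cvg x) _.
  by apply: nearW => N; exact: partial_kernel_le.
- move=> x; rewrite /fractional_kernel; congr (limn _); apply/funext => N.
  by apply: eq_bigr => j _; rewrite heatN.
Qed.

Lemma cosT_fractional xi : cosT fractional_kernel xi = 1 - (1 - gaussn eps xi) `^ b.
Proof.
have [Ls _ _ s0 _] := kernel_fractional.
have mc := @measurable_cos_dotrV R n xi.
have [] := @int_dominated_cvg _ _ _ leb (fun N x => partial_kernel N x * cos (2 * pi * dotrV x xi))
  (fun x => fractional_kernel x * cos (2 * pi * dotrV x xi)) fractional_kernel.
- by move=> N; apply: measurable_funM => //; exact: L1_meas (L1_partial_kernel N).
- by apply: measurable_funM => //; exact: L1_meas Ls.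
- by apply: aeW => x; apply: cvgMl; exact: partial_kernel_cvg.
- exact: Ls.
- move=> N x; rewrite normrM (ger0_norm (partial_kernel_ge0 _ _)).
  by rewrite (le_trans _ (partial_kernel_le_lim N x))// ler_piMr ?partial_kernel_ge0// cos_max.
move=> _ cv.
have z0 : 0 <= gaussn eps xi by exact: gaussn_ge0.
have z1 : gaussn eps xi <= 1 by apply: gaussn_le1; exact: ltW.
have cv2 : 1 - binrem b N (gaussn eps xi) @[N --> \oo] --> 1 - (1 - gaussn eps xi) `^ b.
  by apply: cvgB; [exact: cvg_cst|exact: binrem_cvg].
apply: cvg_unique cv _ => //.
rewrite (_ : (fun N => _) = fun N => 1 - binrem b N (gaussn eps xi))//.
apply/funext => N.
have E : (fun x => partial_kernel N x * cos (2 * pi * dotrV x xi)) =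
    fun x => \sum_(j < N) bincoef b j * (heat (eps * j.+1%:R) x * cos (2 * pi * dotrV x xi)).
  by apply/funext => x; rewrite mulr_suml; apply: eq_bigr => j _; rewrite mulrA.
have LH j := L1_cosT_kernel xi (L1_heat (n := n) (epsj j)).
rewrite E int_sum; last by move=> j; apply: L1Z; exact: LH.
rewrite /binrem subKr; apply: eq_bigr => j _.
rewrite (intZl _ (LH j)) -/(cosT _ _) cosT_heat//; congr (_ * _).
by rewrite /gaussn -expRM_natr; congr expR; rewrite -mulr_natr; ring.
Qed.

End fractional_kernel.

Section fractional_symbol.
Context {R : realType} {n : nat}.
Implicit Types (x xi : 'rV[R]_n).

Definition lapsym xi : R := 4 * pi ^+ 2 * dotrV xi xi.

Lemma lapsym_ge0 xi : 0 <= lapsym xi.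
Proof. by rewrite mulr_ge0 ?dotrV_ge0// mulr_ge0// sqr_ge0. Qed.

(** With w = t |2 pi xi|^2 and y = 1 - exp(-w), the two symbols are w^b / eta and y^b / eta. The
    bounds are the b-th powers of y <= w <= y (1 + w) and y <= 1, the middle one completed by (1 +
    w)^b <= 1 + w^b. *)
Lemma fractional_approximation (b eta : R) : 0 < b -> b < 1 -> 0 < eta ->
  exists2 s : 'rV[R]_n -> R, jump_kernel s & forall xi,
    let A := symbol eta^-1 s xi in let a := lapsym xi `^ b in
    [/\ A <= a, a <= A * (1 + eta * a) & eta * A <= 1].
Proof.
move=> b0 b1 eta0.
(* The time scale for which t^b = eta, so that the prefactor 1/eta restores the symbol a exactly. *)
pose t : R := eta `^ b^-1.
have t0 : 0 < t by rewrite powR_gt0.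
have tb : t `^ b = eta by rewrite -powRrM mulVf ?gt_eqF// powRr1// ltW.
have e0 : 0 < t * (4 * pi ^+ 2) :> R by rewrite !mulr_gt0 ?exprn_gt0 ?pi_gt0.
exists (fractional_kernel b (t * (4 * pi ^+ 2))); first exact: kernel_fractional.
move=> xi A a.
pose w := t * lapsym xi.
have w0 : 0 <= w by rewrite mulr_ge0 ?lapsym_ge0// ltW.
pose y := 1 - expR (- w).
have y0 : 0 <= y by rewrite subr_ge0 -[leRHS]expR0 ler_expR oppr_le0.
have AE : A = eta^-1 * y `^ b.
  rewrite /A /symbol cosT_fractional// subKr; congr (_ * (1 - _) `^ b).
  by rewrite /gaussn /w /lapsym; congr expR; ring.
have wb : w `^ b = eta * a by rewrite powRM ?lapsym_ge0 ?(ltW t0)// tb.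
have aE : a = eta^-1 * w `^ b by rewrite wb mulKf ?gt_eqF.
have ei : 0 <= eta^-1 by rewrite invr_ge0 ltW.
have yw : y <= w.
  have := expR_ge1Dx (- w); rewrite /y; lra.
have wy : w <= y * (1 + w).
  have h : 1 + w <= expR w by exact: expR_ge1Dx.
  have : expR (- w) * (1 + w) <= 1.
    by rewrite expRN mulrC ler_pdivrMr ?expR_gt0// mul1r.
  by rewrite /y mulrBl mul1r; lra.
split.
- by rewrite AE aE ler_wpM2l// ge0_ler_powR ?nnegrE// ltW.
- rewrite AE -wb aE -mulrA ler_wpM2l//.
  apply: (@le_trans _ _ ((y * (1 + w)) `^ b)).
    apply: ge0_ler_powR; rewrite ?nnegrE ?(ltW b0)//.
    exact: mulr_ge0 y0 (addr_ge0 ler01 w0).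
  have w1 : 0 <= 1 + w by rewrite addr_ge0.
  rewrite (powRM _ y0 w1); apply: ler_wpM2l; first exact: powR_ge0.
  exact: powR_subadd1.
- rewrite AE mulrA mulfV ?gt_eqF// mul1r -[leRHS](congr1 (fun h => h b) (powR1 R)) ge0_ler_powR ?nnegrE ?ler01 ?(ltW b0)//.
  by rewrite /y gerBl expR_ge0.
Qed.

End fractional_symbol.

Lemma cvg_harmonicM {R : realType} (c : R) : c * (k.+1%:R)^-1 @[k --> \oo] --> (0 : R).
Proof.
rewrite -[X in _ --> X](mulr0 c); apply: cvgM; first exact: cvg_cst.
exact: (@cvg_harmonic R).
Qed.

Lemma cvg0_le {R : realType} (u : nat -> R) e : u k @[k --> \oo] --> 0 -> 0 < e ->
  \forall k \near \oo, u k <= e.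
Proof.
move=> /cvgrPdist_le u0 e0; apply: filterS (u0 _ e0) => k.
by rewrite sub0r normrN; exact: le_trans (ler_norm _).
Qed.

(** * Convergence of the approximating symbols and multipliers *)

Section approximation.
Context {R : realType} {n : nat}.
Local Notation leb := (lebesgue_rV n : {sigma_finite_measure set 'rV[R]_n -> \bar R}).
Local Notation L1 := (L1 leb).
Local Notation L2 := (L2 leb).
Local Notation Int := (Int leb).
Local Notation sq := (sq leb).
Local Notation ip := (ip leb).
Implicit Types (f g h u v : 'rV[R]_n -> R) (x xi : 'rV[R]_n).

Definition approximates (s : nat -> 'rV[R]_n -> R) (a : 'rV[R]_n -> R) := forall j,
  jump_kernel (s j) /\ forall xi, let A := symbol j.+1%:R (s j) xi in
  [/\ A <= a xi, a xi <= A * (1 + a xi / j.+1%:R) & A <= j.+1%:R].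

(** [K] is not known to be a transform, as [hartley] is an integral and is an isometry only on
    functions in both L^1 and L^2. The isometry transfers the Cauchy property, and completeness is
    used before transforming. *)
Lemma hartley_cvg2_complete (F : nat -> 'rV[R]_n -> R) K : (forall k, L1 (F k)) ->
  (forall k, L2 (F k)) -> L2 K -> cvg2 leb (fun k => hartley (F k)) K ->
  exists2 v, L2 v & cvg2 leb F v.
Proof.
move=> LF L2F LK FK; apply: L2_complete => // e e0.
have [|N _ HN] := cvg0_le FK (e := e / 4); first by rewrite divr_gt0.
exists N => j l Nj Nl.
have LH k : L2 (hartley (F k)) by case: (hartley_plancherel (LF k) (L2F k)).
have [_ <-] := hartley_plancherel (L1B (LF j) (LF l)) (L2B (L2F j) (L2F l)).
rewrite hartleyB//.
rewrite (_ : (fun xi => _) = fun xi => (hartley (F j) xi - K xi) - (hartley (F l) xi - K xi));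
  last by apply/funext => xi; ring.
apply: le_trans (sqBle (L2B (LH j) LK) (L2B (LH l) LK)) _.
move: (HN _ Nj) (HN _ Nl) => /=.
by move: (sq _) (sq _) => p q; lra.
Qed.

Lemma fractional_approximates (b : R) : 0 < b -> b < 1 ->
  exists s, approximates s (fun xi => lapsym xi `^ b).
Proof.
move=> b0 b1.
suff /choice[s sP] : forall j : nat, exists s, jump_kernel s /\ forall xi,
    let A := symbol j.+1%:R s xi in let a := lapsym xi `^ b in
    [/\ A <= a, a <= A * (1 + a / j.+1%:R) & A <= j.+1%:R] by exists s.
move=> j.
have ei : 0 < j.+1%:R^-1 :> R by rewrite invr_gt0.
have [s ks sP] := @fractional_approximation R n b _ b0 b1 ei.
exists s; split => // xi A; have := sP xi; rewrite invrK => -[h1 h2 h3]; split => //.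
  by rewrite (mulrC (_ `^ b)).
by move: h3; rewrite mulrC ler_pdivrMr// mul1r.
Qed.

Variables (s : nat -> 'rV[R]_n -> R) (a : 'rV[R]_n -> R).
Hypothesis sa : approximates s a.
Local Notation A j := (symbol j.+1%:R (s j)).
Local Notation G j := (gen j.+1%:R (s j)).

Let ks j : jump_kernel (s j). Proof. by case: (sa j). Qed.

Lemma symbol_le j xi : A j xi <= a xi.
Proof. by have [_ /(_ xi)[]] := sa j. Qed.

Lemma approx_symbol_ge0 j xi : 0 <= A j xi.
Proof. exact: symbol_ge0. Qed.

Lemma limit_symbol_ge0 xi : 0 <= a xi.
Proof. exact: le_trans (approx_symbol_ge0 0 xi) (symbol_le 0 xi). Qed.

Lemma symbol_cvg xi : A j xi @[j --> \oo] --> a xi.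
Proof.
apply/subr_cvg0; apply: squeeze0 (cvg_harmonicM (a xi ^+ 2)) => j.
have [_ /(_ xi)[h1 h2 h3]] := sa j.
rewrite distrC ger0_norm ?subr_ge0// lerBlDl (le_trans h2)//.
rewrite mulrDr mulr1 lerD2l mulrA ler_wpM2r ?invr_ge0// expr2 ler_wpM2r//.
exact: limit_symbol_ge0.
Qed.

Lemma measurable_limit_symbol : measurable_fun setT a.
Proof.
apply: (measurable_fun_cvg (h := fun j => A j)); first by move=> j; exact: measurable_symbol.
by move=> x _; exact: symbol_cvg.
Qed.

(** Eliminate a between A_j <= a and a (1 - A_l / (l+1)) <= A_l; the bound A_l <= l + 1 makes the
    bracket nonnegative. *)
Lemma symbol_sub_le j l xi : A j xi - A l xi <= l.+1%:R^-1 * (A j xi * A l xi).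
Proof.
have [_ /(_ xi)[h1 _ _]] := sa j.
have [_ /(_ xi)[_ h2 h3]] := sa l.
have h4 : 0 <= 1 - A l xi / l.+1%:R by rewrite subr_ge0 ler_pdivrMr// mul1r.
have := ler_wpM2r h4 h1; set e := l.+1%:R^-1 in h4 *.
move: h2; rewrite -/e; nra.
Qed.

(** Since j + 1 >= 1, a <= A (1 + a), and a / (1 + a) is increasing in a. Coercivity of the limit
    symbol is thus inherited uniformly in j. *)
Lemma symbol_lower_bound j xi (c : R) : 0 <= c -> c <= a xi -> c / (1 + c) <= A j xi.
Proof.
move=> c0 ca; have [_ /(_ xi)[_ h2 _]] := sa j.
have a0 := limit_symbol_ge0 xi.
have A0 := approx_symbol_ge0 j xi.
have : a xi <= A j xi * (1 + a xi).
  apply: le_trans h2 _; apply: ler_wpM2l => //; rewrite lerD2l ler_piMr//.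
  by rewrite invf_le1// ler1n.
move=> h; rewrite ler_pdivrMr ?ltr_pwDl//; nra.
Qed.

Lemma L2_symbolM j h : L1 h -> L2 h -> L2 (fun xi => A j xi * hartley h xi).
Proof.
move=> Lh L2h; have [H _] := hartley_plancherel Lh L2h.
by apply: L2_bM H (measurable_symbol _ (ks j)) (symbol_bounded _ (ks j)).
Qed.

Lemma symbolM_cvg2 h : L1 h -> L2 h -> L2 (fun xi => a xi * hartley h xi) ->
  cvg2 leb (fun j xi => A j xi * hartley h xi) (fun xi => a xi * hartley h xi).
Proof.
move=> Lh L2h La; have mH := measurable_hartley Lh.
have [] := @int_dominated_cvg _ _ _ leb
  (fun j xi => (A j xi * hartley h xi - a xi * hartley h xi) ^+ 2) (fun=> 0)
  (fun xi => (a xi * hartley h xi) ^+ 2).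
- move=> j; apply: measurable_funX; apply: measurable_funB; last exact: L2_meas La.
  by apply: measurable_funM => //; exact: measurable_symbol.
- exact: measurable_cst.
- apply: aeW => xi; rewrite -[X in _ --> X](expr0n R 2) -(subrr (a xi * hartley h xi)).
  apply: (@continuous_cvg _ _ _ _ _ _ (fun y : R => y ^+ 2)); first exact: exprn_continuous.
  apply: cvgB; last exact: cvg_cst.
  by apply: cvgM; [exact: symbol_cvg|exact: cvg_cst].
- by case: La.
- move=> j xi; rewrite ger0_norm ?sqr_ge0// -mulrBl !exprMn ler_wpM2r ?sqr_ge0//.
  have := symbol_le j xi; have := approx_symbol_ge0 j xi; nra.
move=> _; rewrite int0; apply: cvg_trans; apply: near_eq_cvg; apply: nearW => j.
by rewrite sqE.
Qed.

Lemma gen_L2_cvg h : L1 h -> L2 h -> L2 (fun xi => a xi * hartley h xi) ->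
  exists2 v, L2 v & cvg2 leb (fun j => G j h) v.
Proof.
move=> Lh L2h La; apply: (hartley_cvg2_complete _ _ La).
- by move=> j; exact: L1_gen.
- by move=> j; exact: L2_gen.
- rewrite (_ : (fun k => hartley _) = fun k xi => A k xi * hartley h xi); first exact: symbolM_cvg2.
  by apply/funext => k; rewrite hartley_gen.
Qed.

(** Both sides are L^2 limits of the same functions A_j h^, which yields equality almost everywhere
    only. *)
Lemma hartley_limit h v : L1 h -> L2 h -> L2 (fun xi => a xi * hartley h xi) ->
  L1 v -> L2 v -> cvg2 leb (fun j => G j h) v ->
  {ae leb, forall xi, hartley v xi = a xi * hartley h xi}.
Proof.
move=> Lh L2h La Lv L2v cv.
have [L2H _] := hartley_plancherel Lv L2v.
have cv1 : cvg2 leb (fun j xi => A j xi * hartley h xi) (hartley v).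
  apply: cvg_trans cv; apply: near_eq_cvg; apply: nearW => j.
  have LG := L1_gen j.+1%:R (ks j) Lh.
  have L2G := L2_gen j.+1%:R (ks j) Lh L2h.
  have [_ <-] := hartley_plancherel (L1B LG Lv) (L2B L2G L2v).
  by rewrite hartleyB// hartley_gen.
have := cvg2_uniq_sq (fun j => L2_symbolM j Lh L2h) L2H La cv1 (symbolM_cvg2 Lh L2h La).
rewrite sqE => E0; have [_ LD] := L2B L2H La.
apply: filterS (int_eq0_ae LD (fun x => sqr_ge0 _) E0) => xi.
by move/eqP; rewrite sqrf_eq0 subr_eq0 => /eqP.
Qed.

(* tail splitting at [a <= p]: there the multiplier is bounded by p, elsewhere g is small *)
Lemma symbolM_weak_cvg (W : nat -> 'rV[R]_n -> R) g (C : R) : (forall j, L2 (W j)) ->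
  cvg2 leb W (fun=> 0) -> (forall j, L2 (fun xi => A j xi * W j xi)) ->
  (forall j, sq (fun xi => A j xi * W j xi) <= C) -> L2 g ->
  ip (fun xi => A j xi * W j xi) g @[j --> \oo] --> (0 : R).
Proof.
move=> LW W0 LA AC Lg.
have C0 : 0 <= C by apply: le_trans (AC 0); exact: sq_ge0.
pose Z (p : nat) := [set xi : 'rV[R]_n | p%:R < a xi].
have mZ p : measurable (Z p) by apply: measurable_superlevel; exact: measurable_limit_symbol.
pose g1 p xi := g xi * \1_(Z p) xi.
pose g2 p xi := g xi * \1_(~` Z p) xi.
have mi (B : set 'rV[R]_n) : measurable B -> measurable_fun setT (\1_B : _ -> R).
  by move=> mB; exact: measurable_indic.
have gle (B : set 'rV[R]_n) xi : `|g xi * \1_B xi| <= `|g xi|.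
  by rewrite normrM ler_piMr// norm_indic_le1.
have mg := L2_meas Lg.
have Lg1 p : L2 (g1 p) by apply: L2_le (gle _) Lg; apply: measurable_funM => //; exact: mi.
have Lg2 p : L2 (g2 p).
  by apply: L2_le (gle _) Lg; apply: measurable_funM => //; apply: mi; exact: measurableC.
have tail : sq (g1 p) @[p --> \oo] --> (0 : R).
  have [] := @int_dominated_cvg _ _ _ leb (fun p xi => g1 p xi ^+ 2) (fun=> 0) (fun xi => g xi ^+ 2).
  - by move=> p; apply: measurable_funX; exact: L2_meas (Lg1 p).
  - exact: measurable_cst.
  - apply: aeW => xi; apply: cvg_near_cst; near=> p.
    rewrite /g1 indicE memNset ?mulr0 ?expr0n//= /Z /=; apply/negP; rewrite -leNgt.
    by near: p; exact: nbhs_infty_ger.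
  - by case: Lg.
  - move=> p xi; rewrite ger0_norm ?sqr_ge0// -[leLHS]real_normK ?num_real//.
    by rewrite -[leRHS]real_normK ?num_real// lerXn2r ?nnegrE//; exact: gle.
  move=> _; rewrite int0; apply: cvg_trans; apply: near_eq_cvg; apply: nearW => p.
  by rewrite sqE.
have key p j : `|ip (fun xi => A j xi * W j xi) g| <=
    Num.sqrt C * Num.sqrt (sq (g1 p)) + p%:R * Num.sqrt (sq (W j)) * Num.sqrt (sq g).
  have -> : ip (fun xi => A j xi * W j xi) g =
      ip (fun xi => A j xi * W j xi) (g1 p) + ip (fun xi => A j xi * W j xi * \1_(~` Z p) xi) g.
    rewrite /ip -intD; last 2 first.
    - exact: L2_L1M (LA j) (Lg1 p).
    - rewrite (_ : (fun x => _) = fun x => (A j x * W j x) * g2 p x); last first.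
        by apply/funext => x; rewrite /g2; ring.
      exact: L2_L1M (LA j) (Lg2 p).
    congr (Int _); apply/funext => x; rewrite /g1 !indicE in_setC.
    by case: (_ \in _) => /=; ring.
  apply: le_trans (ler_normD _ _) _; apply: lerD.
    apply: le_trans (norm_ip_le (LA j) (Lg1 p)) _.
    by apply: ler_wpM2r; rewrite ?sqrtr_ge0// ler_wsqrtr.
  have bd x : `|A j x * W j x * \1_(~` Z p) x| <= `|p%:R * W j x|.
    rewrite (normrM _ (\1_ _ _)) (normrM (A j x)) (normrM p%:R) indicE in_setC; case: (boolP (x \in Z p)) => /= [_|].
      by rewrite normr0 mulr0 mulr_ge0.
    move=> xZ; have {xZ} : ~ Z p x by move=> Zx; rewrite mem_set in xZ.
    rewrite /Z /= => /negP; rewrite -leNgt => ap.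
    rewrite normr1 mulr1 ler_wpM2r// ger0_norm ?approx_symbol_ge0// normr_nat.
    exact: le_trans (symbol_le j x) ap.
  have mb : measurable_fun setT (fun x => A j x * W j x * \1_(~` Z p) x).
    by apply: measurable_funM; [exact: L2_meas (LA j)|apply: mi; exact: measurableC].
  have Lb := L2_le mb bd (L2Z p%:R (LW j)).
  apply: le_trans (norm_ip_le Lb Lg) _; apply: ler_wpM2r; first exact: sqrtr_ge0.
  apply: le_trans (ler_wsqrtr (sq_le mb bd (L2Z p%:R (LW j)))) _.
  by rewrite sqZ// sqrtrM ?sqr_ge0// sqrtr_sqr normr_nat.
apply/cvgrPdist_le => e e0.
have t1 : Num.sqrt C * Num.sqrt (sq (g1 p)) @[p --> \oo] --> (0 : R).
  rewrite -[X in _ --> X](mulr0 (Num.sqrt C)); apply: cvgM; first exact: cvg_cst.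
  exact: sqrt_cvg0.
have [|p _ /(_ p (leqnn p)) /= Hp] := cvg0_le (e := e / 2) t1; first by rewrite divr_gt0.
have t2 : p%:R * Num.sqrt (sq (W j)) * Num.sqrt (sq g) @[j --> \oo] --> (0 : R).
  rewrite -[X in _ --> X](mul0r (Num.sqrt (sq g))); apply: cvgM; last exact: cvg_cst.
  rewrite -[X in _ --> X](mulr0 p%:R); apply: cvgM; first exact: cvg_cst.
  apply: sqrt_cvg0; apply: cvg_trans W0; apply: near_eq_cvg; apply: nearW => j.
  by congr (sq _); apply/funext => x; rewrite subr0.
have e2 : 0 < e / 2 by rewrite divr_gt0.
apply: filterS (cvg0_le t2 e2) => j Hj.
rewrite sub0r normrN; apply: le_trans (key p j) _.
by rewrite (splitr e) lerD.
Unshelve. all: by end_near. Qed.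

End approximation.

(** * Passage to the limit in the obstacle problems *)

(** The pairing of the fluxes p x and q y with x - y controls the energy for the smaller symbol, up
    to squares of the fluxes. For p <= q the error is (q - p) y (x - y): the product p q in its
    bound is split over |x||y|, treated by the inequality of means, and y^2, where p q <= q^2. *)
Lemma two_symbol_energy {R : realType} (p q x y e : R) : 0 <= p -> 0 <= q -> 0 <= e ->
  p - q <= e * (p * q) -> q - p <= e * (p * q) ->
  Num.min p q * (x - y) ^+ 2 <=
  (p * x - q * y) * (x - y) + e * (2 * (p * x) ^+ 2 + 2 * (q * y) ^+ 2).
Proof.
wlog pq : p q x y / p <= q => [hw p0 q0 e0 h1 h2|p0 q0 e0 _ h].
  case: (boolP (p <= q)) => [pq|]; first exact: hw.
  rewrite -ltNge => /ltW qp.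
  have := hw q p y x qp q0 p0 e0; rewrite (mulrC q p) => /(_ h2 h1).
  rewrite minC (addrC (2 * _)) -[y - x]opprB sqrrN mulrN -mulNr opprB.
  by rewrite minEge qp.
rewrite (min_idPl pq).
have k : (q - p) * (y * (x - y)) <= e * (2 * (p * x) ^+ 2 + 2 * (q * y) ^+ 2).
  have b : (q - p) * `|y * (x - y)| <= e * (p * q) * (`|y| * (`|x| + `|y|)).
    apply: ler_pM => //; first by rewrite subr_ge0.
    by rewrite normrM ler_wpM2l// (le_trans (ler_normB _ _)).
  have qp0 : 0 <= q - p by rewrite subr_ge0.
  apply: le_trans (ler_wpM2l qp0 (ler_norm _)) _; apply: le_trans b _.
  rewrite -mulrA; apply: ler_wpM2l => //.
  rewrite !exprMn -(real_normK (num_real x)) -(real_normK (num_real y)).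
  move: `|x| `|y| (normr_ge0 x) (normr_ge0 y) => {}x {}y x0 y0.
  have h1 : p * q * (y * y) <= (q * y) ^+ 2.
    by rewrite expr2 mulrACA ler_wpM2r ?mulr_ge0// ler_wpM2r.
  have h2 := sqr_ge0 (p * x - q * y).
  rewrite -!exprMn; move: h1 h2; nra.
have -> : (p * x - q * y) * (x - y) = p * (x - y) ^+ 2 - (q - p) * (y * (x - y)) by ring.
by lra.
Qed.

Section limit.
Context {R : realType} {n : nat}.
Local Notation leb := (lebesgue_rV n : {sigma_finite_measure set 'rV[R]_n -> \bar R}).
Local Notation L1 := (L1 leb).
Local Notation L2 := (L2 leb).
Local Notation Int := (Int leb).
Local Notation sq := (sq leb).
Local Notation ip := (ip leb).
Implicit Types (f g h u v : 'rV[R]_n -> R) (x xi : 'rV[R]_n).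

Lemma ae_all_cubes (P : set 'rV[R]_n) :
  (forall N : nat, {ae leb, forall x, cube N%:R x -> P x}) -> {ae leb, forall x, P x}.
Proof.
move=> H; have /ae_foralln := H.
apply: filterS => x Hx.
have [N _ Nx] : (\bigcup_k cube k%:R) x by rewrite (@bigcup_cube R n).
exact: Hx Nx.
Qed.

(** Test with the indicator of {g < 0} inside a cube. Only the differences are assumed in L^2, so
    that the constant [lam], which is not in L^2, may be part of [F] and [g]. *)
Lemma weak_limit_ge0 (F : nat -> 'rV[R]_n -> R) g :
  (forall j, L2 (fun x => F j x - g x)) -> measurable_fun setT g ->
  (forall B, measurable B -> (leb B < +oo)%E -> L1 (fun x => g x * \1_B x)) ->
  (forall j, {ae leb, forall x, 0 <= F j x}) ->
  (forall h, L1 h -> L2 h -> ip (fun x => F j x - g x) h @[j --> \oo] --> (0 : R)) ->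
  {ae leb, forall x, 0 <= g x}.
Proof.
move=> LF mg Lg F0 W; apply: ae_all_cubes => N.
pose B := [set x | g x < 0] `&` cube N%:R.
have mB : measurable B.
  apply: measurableI; last exact: measurable_cube.
  rewrite [X in measurable X](_ : _ = g @^-1` `]-oo, 0%R[%classic); last first.
    by apply/seteqP; split => x /=; rewrite in_itv.
  by rewrite -[X in measurable X]setTI; exact: mg.
have fB : (leb B < +oo)%E.
  apply: le_lt_trans (cube_finite N%:R); apply: le_measure; rewrite ?inE//; first exact: measurable_cube.
  exact: subIsetr.
have LB := L1_indic mB fB; have L2B := L2_indic mB fB.
have LgB := Lg _ mB fB.
have key j : 0 <= ip (fun x => F j x - g x) \1_B + Int (fun x => g x * \1_B x).
  have L := L2_L1M (LF j) L2B.
  rewrite /ip -intD// -(int0 leb); apply: ae_int_le; [exact: L1_0|exact: L1D|].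
  apply: filterS (F0 j) => x Fx.
  by rewrite mulrBl subrK mulr_ge0// indicE ler0n.
have I0 : 0 <= Int (fun x => g x * \1_B x).
  have c : ip (fun x => F j x - g x) \1_B + Int (fun x => g x * \1_B x) @[j --> \oo] -->
      0 + Int (fun x => g x * \1_B x) by apply: cvgD; [exact: W|exact: cvg_cst].
  by rewrite -[leRHS]add0r; apply: cvg_ge_cst c _; exact: nearW.
have n0 x : 0 <= - (g x * \1_B x).
  rewrite oppr_ge0 indicE; case: (boolP (x \in B)) => [|_]; last by rewrite mulr0.
  by rewrite inE mulr1 => -[/ltW].
have E0 : Int (fun x => - (g x * \1_B x)) = 0.
  by apply/eqP; rewrite eq_le int_ge0// intN// oppr_le0 I0.
apply: filterS (int_eq0_ae (L1N LgB) n0 E0) => x.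
rewrite indicE => gx Nx; rewrite leNgt; apply/negP => g0.
by move: gx; rewrite mem_set// mulr1 => /eqP; rewrite oppr_eq0 lt_eqF.
Qed.

(* min(1, k u^2) increases to the indicator of u > 0 and is at most
   the indicator of w_j > 0 plus k (w_j - u)^2 *)
Lemma cvg2_support (w : nat -> 'rV[R]_n -> R) u (m : R) : (forall j, L2 (w j)) -> L2 u ->
  (forall j x, 0 <= w j x) -> (forall x, 0 <= u x) ->
  (forall j, (leb [set x | (0 < w j x)%R] <= m%:E)%E) -> cvg2 leb w u ->
  (leb [set x | (0 < u x)%R] <= m%:E)%E.
Proof.
move=> Lw Lu w0 u0 wm cv.
have mu' := measurable_superlevel 0 (L2_meas Lu); have mw j := measurable_superlevel 0 (L2_meas (Lw j)).
have fw j : (leb [set x | (0 < w j x)%R] < +oo)%E by rewrite (le_lt_trans (wm j))// ltry.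
pose F (k : nat) x := Num.min 1 (k%:R * u x ^+ 2).
have F0 k x : 0 <= F k x by rewrite le_min ler01 mulr_ge0// sqr_ge0.
have Lu2 : L1 (fun x => u x ^+ 2) by case: Lu.
have LF k : L1 (F k).
  apply: L1_le (L1Z k%:R Lu2); last by move=> x; rewrite ger0_norm// ge_min lexx orbT.
  by apply: measurable_minr => //; exact: L1_meas (L1Z k%:R Lu2).
have Ind j : Int \1_[set x | 0 < w j x] <= m.
  by rewrite -lee_fin -(L1_fin_num (L1_indic (mw j) (fw j))) integral_indic// setIT; exact: wm.
have FC k : Int (F k) <= m.
  have c : m + k%:R * sq (fun x => w j x - u x) @[j --> \oo] --> m + k%:R * 0.
    by apply: cvgD; [exact: cvg_cst|apply: cvgM; [exact: cvg_cst|exact: cv]].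
  rewrite mulr0 addr0 in c; apply: cvg_ge_cst c _; apply: nearW => j.
  have LD := L2B (Lw j) Lu; have [_ LD2] := LD.
  have L1j := L1_indic (mw j) (fw j).
  apply: (@le_trans _ _ (Int (fun x => \1_[set x | 0 < w j x] x + k%:R * (w j x - u x) ^+ 2))).
    apply: int_le => //; first by apply: L1D => //; exact: L1Z.
    move=> x; have := w0 j x; rewrite le_eqVlt eq_sym => /predU1P[wx|wx].
      rewrite wx sub0r sqrrN indicE memNset ?add0r; first by rewrite ge_min lexx orbT.
      by rewrite /= wx ltxx.
    rewrite indicE mem_set//= ge_min lerDl mulr_ge0// sqr_ge0//.
  by rewrite intD ?intZl -?sqE ?lerD2r//; exact: L1Z.
have mI : measurable_fun setT (\1_[set x | 0 < u x] : 'rV[R]_n -> R) by exact: measurable_indic.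
have [] := @fatou_int _ _ _ leb F \1_[set x | 0 < u x] m LF F0 mI.
- by move=> x; rewrite indicE.
- apply: aeW => x; have := u0 x; rewrite le_eqVlt eq_sym => /predU1P[ux|ux].
    rewrite indicE memNset /= ?ux ?ltxx//; apply: cvg_near_cst; apply: nearW => k.
    by rewrite /F ux expr0n mulr0 (min_idPr ler01).
  rewrite indicE mem_set//=; apply: cvg_near_cst.
  have u2 : 0 < u x ^+ 2 by rewrite exprn_gt0.
  near=> k; apply/min_idPl; rewrite -ler_pdivrMr// mul1r.
  by near: k; exact: nbhs_infty_ger.
- exact: nearW.
move=> LI; rewrite -lee_fin -L1_fin_num// integral_indic//.
by rewrite setIT.
Unshelve. all: by end_near. Qed.

End limit.

(** * Approximate solutions and their Cauchy estimate *)

Section balayage_limit.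
Context {R : realType} {n : nat}.
Local Notation leb := (lebesgue_rV n : {sigma_finite_measure set 'rV[R]_n -> \bar R}).
Local Notation L1 := (L1 leb).
Local Notation L2 := (L2 leb).
Local Notation Int := (Int leb).
Local Notation sq := (sq leb).
Local Notation ip := (ip leb).
Implicit Types (g h u v : 'rV[R]_n -> R) (x xi : 'rV[R]_n).
Hypothesis hn : (1 <= n)%N.
Variables (s : nat -> 'rV[R]_n -> R) (a : 'rV[R]_n -> R).
Hypothesis sa : approximates s a.
Hypothesis a_coercive : forall r, 0 < r -> exists2 c, 0 < c & forall xi, ~ cube r xi -> c <= a xi.
Hypothesis a_small : forall e, 0 < e -> exists2 r, 0 < r & forall xi, cube r xi -> a xi <= e.
Variables (f : 'rV[R]_n -> R) (lam : R).
Hypotheses (Lf : L1 f) (L2f : L2 f) (f0 : forall x, 0 <= f x) (lam0 : 0 < lam).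
Let m := Int f / lam.
Local Notation A j := (symbol j.+1%:R (s j)).
Local Notation G j := (gen j.+1%:R (s j)).

Let ks j : jump_kernel (s j). Proof. by case: (sa j). Qed.

Let m0 : 0 <= m. Proof. by rewrite divr_ge0 ?int_ge0// ltW. Qed.

(** Outside the cube of [spectral_gap] all approximate symbols exceed one constant c / (1 + c). The
    case j = l feeds the sweeping, the general case the comparison of two approximations; [E] is any
    integrable bound of the energy density. *)
Lemma two_symbol_gap (M : R) : 0 <= M -> exists2 K, 0 <= K & forall h E j l,
  L1 h -> L2 h -> (leb [set x | (h x != 0)%R] <= M%:E)%E -> L1 E ->
  (forall xi, Num.min (A j xi) (A l xi) * hartley h xi ^+ 2 <= E xi) -> sq h <= K * Int E.
Proof.
move=> M0; have [r r0 gap] := @spectral_gap R n hn M M0.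
have [c c0 ac] := a_coercive r0.
pose c' := c / (1 + c).
have c'0 : 0 < c' by rewrite divr_gt0// addr_gt0.
exists (2 / c'); first by rewrite divr_ge0// ltW.
move=> h E j l Lh L2h hM LE hE; apply: le_trans (gap h Lh L2h hM) _.
have [[_ LH2] _] := hartley_plancherel Lh L2h.
rewrite -mulrA ler_wpM2l// -intZl//; apply: int_le; last 1 first.
- move=> xi; rewrite indicE in_setC ler_pdivlMl//.
  have mn : 0 <= Num.min (A j xi) (A l xi) by rewrite le_min !(approx_symbol_ge0 sa).
  case: (boolP (xi \in cube r)) => /= [_|].
    by rewrite !mulr0 (le_trans _ (hE xi))// mulr_ge0// sqr_ge0.
  rewrite mulr1 notin_setE => nr; apply: le_trans (hE xi); rewrite ler_wpM2r ?sqr_ge0//.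
  by rewrite le_min !(symbol_lower_bound sa) ?(ltW c0)// ac.
- apply: (L1_bM (M := 1)) => //.
    by apply: measurable_indic; apply: measurableC; exact: measurable_cube.
  by move=> x; exact: norm_indic_le1.
- exact: L1Z.
Qed.

Lemma approximate_balayage : exists w : nat -> 'rV[R]_n -> R, forall j,
  [/\ L1 (w j), L2 (w j), forall x, 0 <= w j x,
      (leb [set x | (0 < w j x)%R] <= m%:E)%E &
      {ae leb, forall x, let mu := f x - G j (w j) x in
         0 <= mu <= lam /\ (0 < w j x -> mu = lam)}].
Proof.
have [K K0 gap] := two_symbol_gap m0.
suff H (j : nat) : exists w, [/\ L1 w, L2 w, forall x, 0 <= w x,
      (leb [set x | (0 < w x)%R] <= m%:E)%E &
      {ae leb, forall x, let mu := f x - G j w x in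
         0 <= mu <= lam /\ (0 < w x -> mu = lam)}].
  have /choice[w wP] := H; by exists w.
have [Ls [M sM] _ _ _] := ks j.
have k0 : 0 < j.+1%:R :> R by [].
(* The sweeping is governed by [h - convol (s j) h], which is [G j h] divided by j + 1; hence this
   gap constant, and the rescaling of [U] to [w] below. *)
have [] := @balayage R n (s j) f lam (K * j.+1%:R) (ks j) Lf L2f f0 lam0.
- by rewrite mulr_ge0.
- move=> h Lh L2h hm.
  have Lc := L1_conv Ls sM Lh; have L2c := L2_conv Ls sM Lh.
  have -> : K * j.+1%:R * ip h (fun x => h x - convol (s j) h x) = K * ip (G j h) h.
    by rewrite /gen ipZl//; [rewrite ipC; ring|exact: L2B].
  rewrite (ip_gen j.+1%:R (ks j))//.
  have LE : L1 (fun xi => A j xi * (hartley h xi * hartley h xi)).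
    have LH := hartley_plancherel Lh L2h.
    rewrite (_ : (fun _ => _) = fun xi => (A j xi * hartley h xi) * hartley h xi).
      by apply: L2_L1M; [exact: L2_symbolM|case: LH].
    by apply/funext => xi; rewrite mulrA.
  by apply: (gap h _ j j) => // xi; rewrite minxx expr2.
move=> U [LU L2U U0 Um Uae].
pose w x := j.+1%:R^-1 * U x.
have wpos x : (0 < w x) = (0 < U x) by rewrite pmulr_rgt0// invr_gt0.
exists w; split.
- exact: L1Z.
- exact: L2Z.
- by move=> x; rewrite mulr_ge0.
- by rewrite (_ : [set x | _] = [set x | 0 < U x])//; apply/seteqP; split => x /=; rewrite wpos.
- apply: filterS Uae => x; rewrite wpos.
  suff -> : G j w x = U x - convol (s j) U x by [].
  by rewrite /gen /w (convZ Ls sM)// -mulrBr mulrA mulfV ?mul1r// pnatr_eq0.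
Qed.

Section sequence.
Variable w : nat -> 'rV[R]_n -> R.
Hypothesis wP : forall j, [/\ L1 (w j), L2 (w j), forall x, 0 <= w j x,
      (leb [set x | (0 < w j x)%R] <= m%:E)%E &
      {ae leb, forall x, let mu := f x - G j (w j) x in
         0 <= mu <= lam /\ (0 < w j x -> mu = lam)}].

Let Lw j : L1 (w j). Proof. by case: (wP j). Qed.
Let L2w j : L2 (w j). Proof. by case: (wP j). Qed.
Let w0 j x : 0 <= w j x. Proof. by case: (wP j). Qed.
Let wm j : (leb [set x | (0 < w j x)%R] <= m%:E)%E. Proof. by case: (wP j). Qed.
Let wae j : {ae leb, forall x, let mu := f x - G j (w j) x in
         0 <= mu <= lam /\ (0 < w j x -> mu = lam)}.
Proof. by case: (wP j). Qed.

Let v j := G j (w j).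
Let Lv j : L1 (v j). Proof. exact: L1_gen. Qed.
Let L2v j : L2 (v j). Proof. exact: L2_gen. Qed.
Let C := 2 * sq f + 2 * (lam * Int f).

(** The kernel has mass at most 1 and w >= 0, so the flux has nonnegative integral. *)
Lemma approximate_mass j : Int (fun x => f x - v j x) <= Int f.
Proof.
have [Ls [M sM] _ s0 s1] := ks j.
rewrite intB// gerBl /v /gen intZl; last by apply: L1B => //; exact: L1_conv Ls sM _ (Lw j).
rewrite intB//; last exact: L1_conv Ls sM _ (Lw j).
by rewrite (Int_conv Ls sM (Lw j)) mulr_ge0// subr_ge0 ler_piMl// int_ge0.
Qed.

(** The flux is f minus the density mu, and 0 <= mu <= lam gives mu^2 <= lam mu, whose integral is
    at most lam times the mass of f. The bound does not depend on j. *)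
Lemma approximate_sq_le j : sq (v j) <= C.
Proof.
have Lmu := L1B Lf (Lv j); have L2mu := L2B L2f (L2v j).
have -> : sq (v j) = sq (fun x => f x - (f x - v j x)).
  by congr (sq _); apply/funext => x; rewrite subKr.
apply: le_trans (sqBle L2f L2mu) _; rewrite lerD2l ler_wpM2l//.
apply: (@le_trans _ _ (Int (fun x => lam * (f x - v j x)))).
  rewrite sqE; have [_ L] := L2mu; apply: ae_int_le => //; first exact: L1Z.
  by apply: filterS (wae j) => x /= [/andP[h1 h2] _]; rewrite expr2 ler_wpM2r.
by rewrite intZl// ler_wpM2l ?approximate_mass// ltW.
Qed.

Lemma support_sub_le g h : measurable_fun setT g -> measurable_fun setT h ->
  (forall x, 0 <= g x) -> (forall x, 0 <= h x) ->
  (leb [set x | (0 < g x)%R] <= m%:E)%E -> (leb [set x | (0 < h x)%R] <= m%:E)%E ->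
  (leb [set x | (g x - h x != 0)%R] <= (m + m)%:E)%E.
Proof.
move=> mg mh g0 h0 gm hm.
have mS : measurable [set x | g x - h x != 0].
  by apply: (@measurable_neq0 _ _ R (fun x => g x - h x)); exact: measurable_funB.
have mgs := measurable_superlevel 0 mg; have mhs := measurable_superlevel 0 mh.
apply: (@le_trans _ _ (leb ([set x | 0 < g x] `|` [set x | 0 < h x]))).
  apply: le_measure; rewrite ?inE//; first exact: measurableU.
  move=> x /=; apply: contra_neqP => /not_orP[/negP + /negP].
  rewrite -!leNgt => gx hx; have /eqP -> : g x == 0 by rewrite eq_le gx g0.
  by have /eqP -> : h x == 0 by [rewrite eq_le hx h0]; rewrite subrr.
by apply: le_trans (measureU2 leb mgs mhs) _; rewrite EFinD leeD.
Qed.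

(** Where w_j > w_l >= 0 the density mu_j is saturated, so mu_j = lam >= mu_l and v_j <= v_l: the
    integrand is nonpositive almost everywhere. *)
Lemma approximate_monotone j l :
  ip (fun x => v j x - v l x) (fun x => w j x - w l x) <= 0.
Proof.
rewrite -(int0 leb); apply: ae_int_le; [|exact: L1_0|].
  by apply: L2_L1M; exact: L2B.
apply: filterS2 (wae j) (wae l) => x /= [/andP[j0 j1] jl] [/andP[l0 l1] ll].
rewrite -/(v j) -/(v l) in j0 j1 jl l0 l1 ll.
have [ww|ww|->] := ltgtP (w j x) (w l x); last by rewrite subrr mulr0.
- by have := ll (le_lt_trans (w0 j x) ww); move: ww j1; nra.
- by have := jl (le_lt_trans (w0 l x) ww); move: ww l1; nra.
Qed.

(** The difference of two potentials lives on a set of measure at most 2m, so the gap applies. By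
    [two_symbol_energy] its energy is the pairing of [approximate_monotone], which is nonpositive,
    plus 1/(j+1) + 1/(l+1) times squares of the fluxes. *)
Lemma approximate_cauchy : exists2 K, 0 <= K & forall j l,
  sq (fun x => w j x - w l x) <= K * (j.+1%:R^-1 + l.+1%:R^-1).
Proof.
have [K K0 gap] := two_symbol_gap (addr_ge0 m0 m0).
have C0 : 0 <= C by apply: le_trans (approximate_sq_le 0); exact: sq_ge0.
exists (K * (4 * C)); first by rewrite !mulr_ge0.
move=> j l; pose e : R := j.+1%:R^-1 + l.+1%:R^-1.
have e0 : 0 <= e by rewrite addr_ge0.
have LD := L1B (Lw j) (Lw l); have L2D := L2B (L2w j) (L2w l).
have dm := support_sub_le (L1_meas (Lw j)) (L1_meas (Lw l)) (@w0 j) (@w0 l) (wm j) (wm l).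
have [L2Hj sj] := hartley_plancherel (Lv j) (L2v j).
have [L2Hl sl] := hartley_plancherel (Lv l) (L2v l).
have [L2HD _] := hartley_plancherel LD L2D.
have LHv := L2_L1M (L2B L2Hj L2Hl) L2HD.
have LHq : L1 (fun xi => e * (2 * hartley (v j) xi ^+ 2 + 2 * hartley (v l) xi ^+ 2)).
  by apply/L1Z/L1D; apply: L1Z; [case: L2Hj|case: L2Hl].
have LE := L1D LHv LHq.
apply: le_trans (gap _ _ j l LD L2D dm LE _) _.
  move=> xi; rewrite hartleyB// !hartley_gen//.
  apply: two_symbol_energy; rewrite ?(approx_symbol_ge0 sa)//.
  - apply: le_trans (symbol_sub_le sa j l xi) _.
    by apply: ler_wpM2r; rewrite ?lerDr// mulr_ge0// (approx_symbol_ge0 sa).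
  - apply: le_trans (symbol_sub_le sa l j xi) _.
    rewrite (mulrC (A l xi)).
    by apply: ler_wpM2r; rewrite ?lerDl// mulr_ge0// (approx_symbol_ge0 sa).
rewrite -!mulrA ler_wpM2l// intD// intZl; last first.
  by apply: L1D; apply: L1Z; [case: L2Hj|case: L2Hl].
have -> : Int (fun xi => (hartley (v j) xi - hartley (v l) xi) *
     hartley (fun x => w j x - w l x) xi) = ip (fun x => v j x - v l x) (fun x => w j x - w l x).
  rewrite -hartley_ip//; [|exact: L1B|exact: L2B].
  by rewrite (hartleyB (Lv j) (Lv l)).
have [_ Hj2] := L2Hj; have [_ Hl2] := L2Hl.
rewrite (intD (L1Z 2 Hj2) (L1Z 2 Hl2)) (intZl 2 Hj2) (intZl 2 Hl2) -(sqE leb (hartley (v j))) -(sqE leb (hartley (v l))) sj sl.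
rewrite -[leRHS]add0r; apply: lerD; first exact: approximate_monotone.
rewrite [leRHS]mulrA (mulrC _ e) -/e ler_wpM2l//.
move: (approximate_sq_le j) (approximate_sq_le l) => H1 H2.
have {H1 H2} : 2 * sq (v j) + 2 * sq (v l) <= 2 * C + 2 * C by rewrite lerD// ler_wpM2l.
by move=> /le_trans; apply; rewrite -mulrDl -natrD.
Qed.

End sequence.
End balayage_limit.

Lemma cvg_harmonic_cauchy {R : realType} (K e : R) : 0 <= K -> 0 < e -> exists N, forall j l : nat,
  (N <= j)%N -> (N <= l)%N -> K * (j.+1%:R^-1 + l.+1%:R^-1) <= e.
Proof.
move=> K0 e0; have [|N _ HN] := cvg0_le (cvg_harmonicM K) (e := e / 2); first by rewrite divr_gt0.
exists N => j l Nj Nl; rewrite mulrDr (splitr e).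
by apply: lerD; [exact: HN|exact: HN].
Qed.

(** * The limit potential, its flux and its density *)

Section obstacle.
Context {R : realType} {n : nat}.
Local Notation leb := (lebesgue_rV n : {sigma_finite_measure set 'rV[R]_n -> \bar R}).
Local Notation L1 := (L1 leb).
Local Notation L2 := (L2 leb).
Local Notation Int := (Int leb).
Local Notation sq := (sq leb).
Local Notation ip := (ip leb).
Implicit Types (g h u v : 'rV[R]_n -> R) (x xi : 'rV[R]_n).
Hypothesis hn : (1 <= n)%N.
Variables (s : nat -> 'rV[R]_n -> R) (a : 'rV[R]_n -> R).
Hypothesis sa : approximates s a.
Hypothesis a_coercive : forall r, 0 < r -> exists2 c, 0 < c & forall xi, ~ cube r xi -> c <= a xi.
Hypothesis a_small : forall e, 0 < e -> exists2 r, 0 < r & forall xi, cube r xi -> a xi <= e.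
Variables (f : 'rV[R]_n -> R) (lam : R).
Hypotheses (Lf : L1 f) (L2f : L2 f) (f0 : forall x, 0 <= f x) (lam0 : 0 < lam).
Let m := Int f / lam.
Local Notation A j := (symbol j.+1%:R (s j)).
Local Notation G j := (gen j.+1%:R (s j)).
Let ks j : jump_kernel (s j). Proof. by case: (sa j). Qed.
Variable w : nat -> 'rV[R]_n -> R.
Hypothesis wP : forall j, [/\ L1 (w j), L2 (w j), forall x, 0 <= w j x,
      (leb [set x | (0 < w j x)%R] <= m%:E)%E &
      {ae leb, forall x, let mu := f x - G j (w j) x in
         0 <= mu <= lam /\ (0 < w j x -> mu = lam)}].

Let Lw j : L1 (w j). Proof. by case: (wP j). Qed.
Let L2w j : L2 (w j). Proof. by case: (wP j). Qed.
Let w0 j x : 0 <= w j x. Proof. by case: (wP j). Qed.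
Let wm j : (leb [set x | (0 < w j x)%R] <= m%:E)%E. Proof. by case: (wP j). Qed.
Let wae j : {ae leb, forall x, let mu := f x - G j (w j) x in
         0 <= mu <= lam /\ (0 < w j x -> mu = lam)}.
Proof. by case: (wP j). Qed.

Let v j := G j (w j).
Let Lv j : L1 (v j). Proof. exact: L1_gen. Qed.
Let L2v j : L2 (v j). Proof. exact: L2_gen. Qed.
Let C := 2 * sq f + 2 * (lam * Int f).
Let vC j : sq (v j) <= C. Proof. exact: (approximate_sq_le sa Lf L2f lam0 wP). Qed.

Lemma odometer_limit : exists2 u, [/\ L1 u, L2 u, forall x, 0 <= u x &
  (leb [set x | (0 < u x)%R] <= m%:E)%E] & cvg2 leb w u.
Proof.
have [K K0 wK] := approximate_cauchy hn sa a_coercive Lf L2f f0 lam0 wP.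
have [u0 Lu0 cu0] : exists2 u, L2 u & cvg2 leb w u.
  apply: L2_complete => // e e0; have [N HN] := cvg_harmonic_cauchy K0 e0.
  by exists N => j l Nj Nl; apply: le_trans (wK j l) _; exact: HN.
(* The positive part makes the limit nonnegative at every point and is no further from the
   nonnegative [w j]. *)
pose u x := Num.max (u0 x) 0.
have u_ge0 x : 0 <= u x by rewrite le_max lexx orbT.
have mu : measurable_fun setT u by apply: measurable_maxr => //; exact: L2_meas Lu0.
have Lu : L2 u.
  apply: L2_le mu _ Lu0 => x; rewrite ger0_norm// ge_max normr_ge0 andbT.
  exact: ler_norm.
have cu : cvg2 leb w u.
  apply: squeeze0 cu0 => j; rewrite ger0_norm ?sq_ge0//; apply: sq_le.
  - by apply: measurable_funB => //; exact: L1_meas (Lw j).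
  - move=> x; rewrite /u; have [|u0x] := leP (u0 x) 0 => // u0x.
    by rewrite subr0 (ger0_norm (w0 j x)) (le_trans _ (ler_norm _))// lerBrDl gerDr.
  - exact: L2B.
have um := cvg2_support L2w Lu w0 u_ge0 wm cu.
exists u => //; split => //; apply: (L2_finite_support_L1 (m := m) Lu).
rewrite (_ : [set x | _] = [set x | 0 < u x])//.
by apply/seteqP; split => x /=; rewrite lt_def u_ge0 andbT.
Qed.

Variable u : 'rV[R]_n -> R.
Hypotheses (Lu : L1 u) (L2u : L2 u) (u0 : forall x, 0 <= u x).
Hypothesis um : (leb [set x | (0 < u x)%R] <= m%:E)%E.
Hypothesis cu : cvg2 leb w u.

(** The supports have measure at most m each, so Cauchy-Schwarz upgrades L^2 to L^1 convergence.
    This makes the transforms converge at every point. *)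
Lemma odometer_cvg_L1 : Int (fun x => `|w j x - u x|) @[j --> \oo] --> (0 : R).
Proof.
have c : Num.sqrt ((m + m) * sq (fun x => w j x - u x)) @[j --> \oo] --> (0 : R).
  apply: sqrt_cvg0; rewrite -[X in _ --> X](mulr0 (m + m)).
  by apply: cvgM; [exact: cvg_cst|exact: cu].
apply: squeeze0 c => j; rewrite ger0_norm ?int_ge0//.
have i0 : 0 <= Int (fun x => `|w j x - u x|) by exact: int_ge0.
rewrite -[leLHS]ger0_norm// -sqrtr_sqr ler_wsqrtr//.
apply: L1_support_le; [exact: L1B|exact: L2B|].
exact: support_sub_le (L1_meas (Lw j)) (L1_meas Lu) (@w0 j) u0 (wm j) um.
Qed.

Lemma odometer_hartley_cvg xi : hartley (w j) xi @[j --> \oo] --> hartley u xi.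
Proof.
apply/subr_cvg0; have c : 2 * Int (fun x => `|w j x - u x|) @[j --> \oo] --> (0 : R).
  rewrite -[X in _ --> X](mulr0 2); apply: cvgM; first exact: cvg_cst.
  exact: odometer_cvg_L1.
apply: squeeze0 c => j.
have -> : hartley (w j) xi - hartley u xi = hartley (fun x => w j x - u x) xi.
  by rewrite hartleyB.
by apply: norm_hartley_le; exact: L1B.
Qed.

(** The products A_j w_j^ are the transforms of the fluxes, bounded in L^2 by C, and they converge
    pointwise to a u^; Fatou's lemma applies. *)
Lemma L2_limit_symbolM : L2 (fun xi => a xi * hartley u xi).
Proof.
have ma := measurable_limit_symbol sa; have mu := measurable_hartley Lu.
split; first exact: measurable_funM.
have E j xi : A j xi * hartley (w j) xi = hartley (v j) xi by rewrite /v hartley_gen.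
have [] := @fatou_int _ _ _ leb (fun j xi => (A j xi * hartley (w j) xi) ^+ 2)
  (fun xi => (a xi * hartley u xi) ^+ 2) C => //.
- move=> j; under eq_fun do rewrite E.
  by have [[]] := hartley_plancherel (Lv j) (L2v j).
- by move=> j xi; exact: sqr_ge0.
- by apply: measurable_funX; exact: measurable_funM.
- by move=> xi; exact: sqr_ge0.
- apply: aeW => xi; apply: (@continuous_cvg _ _ _ _ _ _ (fun y : R => y ^+ 2)).
    exact: exprn_continuous.
  by apply: cvgM; [exact: symbol_cvg|exact: odometer_hartley_cvg].
- apply: nearW => j; under eq_fun do rewrite E.
  by have [_] := hartley_plancherel (Lv j) (L2v j); rewrite -sqE => ->.
Qed.

(** Split v_j - v0 = G_j (w_j - u) + (G_j u - v0). The second part tends to 0 strongly. The first is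
    bounded in L^2, and only weak convergence is available since the symbols A_j are not uniformly
    bounded. *)
Lemma flux_weak_cvg v0 h : L2 v0 -> cvg2 leb (fun j => G j u) v0 -> L1 h -> L2 h ->
  ip (fun x => v j x - v0 x) h @[j --> \oo] --> (0 : R).
Proof.
move=> Lv0 cv0 Lh L2h; have La := L2_limit_symbolM.
have [LHh _] := hartley_plancherel Lh L2h.
pose W j xi := hartley (w j) xi - hartley u xi.
have WE j : W j = hartley (fun x => w j x - u x) by rewrite hartleyB.
have LD j := L1B (Lw j) Lu; have L2D j := L2B (L2w j) L2u.
have LW j : L2 (W j) by rewrite WE; case: (hartley_plancherel (LD j) (L2D j)).
have LAW j : L2 (fun xi => A j xi * W j xi).
  by rewrite WE; apply: L2_symbolM.
have Lau j := L2_symbolM sa j Lu L2u.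
have c1 : ip (fun xi => A j xi * W j xi) (hartley h) @[j --> \oo] --> (0 : R).
  apply: (symbolM_weak_cvg sa (C := 2 * C + 2 * sq (fun xi => a xi * hartley u xi))) => //.
  - apply: cvg_trans cu; apply: near_eq_cvg; apply: nearW => j /=.
    have [_ <-] := hartley_plancherel (LD j) (L2D j); rewrite -WE.
    by congr (sq _); apply/funext => xi; rewrite subr0.
  - move=> j; have [L2Hv sv] := hartley_plancherel (Lv j) (L2v j).
    have -> : (fun xi => A j xi * W j xi) = (fun xi => hartley (v j) xi - A j xi * hartley u xi).
      by apply/funext => xi; rewrite /v hartley_gen// /W mulrBr.
    apply: le_trans (sqBle L2Hv (Lau j)) _; apply: lerD; rewrite ler_wpM2l ?sv//.
    apply: sq_le => //; first exact: L2_meas (Lau j).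
    move=> xi; rewrite (normrM (A j xi)) (normrM (a xi)) ler_wpM2r//.
    by rewrite (ger0_norm (approx_symbol_ge0 sa _ _)) (le_trans (symbol_le sa _ _))// ler_norm.
have c2 : Num.sqrt (sq (fun x => G j u x - v0 x)) * Num.sqrt (sq h) @[j --> \oo] --> (0 : R).
  rewrite -[X in _ --> X](mul0r (Num.sqrt (sq h))); apply: cvgM; last exact: cvg_cst.
  exact: sqrt_cvg0.
have LG j := L1_gen j.+1%:R (ks j) Lu.
have L2G j := L2_gen j.+1%:R (ks j) Lu L2u.
have c3 : ip (fun x => G j u x - v0 x) h @[j --> \oo] --> (0 : R).
  by apply: squeeze0 c2 => j; apply: norm_ip_le => //; exact: L2B.
have E j : ip (fun x => v j x - v0 x) h =
    ip (fun xi => A j xi * W j xi) (hartley h) + ip (fun x => G j u x - v0 x) h.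
  have -> : ip (fun xi => A j xi * W j xi) (hartley h) = ip (fun x => v j x - G j u x) h.
    rewrite -(hartley_ip (L1B (Lv j) (LG j)) (L2B (L2v j) (L2G j)) Lh L2h).
    congr (ip _ _); rewrite (hartleyB (Lv j) (LG j)) /v !hartley_gen//.
    by apply/funext => xi; rewrite /W mulrBr.
  rewrite -ipDl//; [|exact: L2B|exact: L2B].
  by congr (ip _ _); apply/funext => x; rewrite addrA subrK.
rewrite -[X in _ --> X](addr0 0); under eq_fun do rewrite E.
exact: cvgD c1 c3.
Qed.

(* The weak limit mu = f - v0 inherits 0 <= mu <= lam, and lam = mu on {u > 0} because
   the product of the weakly convergent mu_j and the strongly convergent w_j passes to the limit. *)
Lemma density_limit v0 : L2 v0 -> cvg2 leb (fun j => G j u) v0 ->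
  {ae leb, forall x, 0 <= f x - v0 x <= lam /\ (0 < u x -> f x - v0 x = lam)}.
Proof.
move=> Lv0 cv0; have Lmu := L2B L2f Lv0.
have mmu := L2_meas Lmu.
have wk := flux_weak_cvg Lv0 cv0.
have ge0 : {ae leb, forall x, 0 <= f x - v0 x}.
  apply: (@weak_limit_ge0 R n (fun j x => f x - v j x)) => //.
  - by move=> j; apply: L2B => //; exact: L2B.
  - by move=> B mB fB; exact: L2_indicM.
  - by move=> j; apply: filterS (wae j) => x /= [/andP[]].
  - move=> h Lh L2h; rewrite -[X in _ --> X]oppr0.
    have E j : ip (fun x => f x - v j x - (f x - v0 x)) h = - ip (fun x => v j x - v0 x) h.
      rewrite -mulN1r -ipZl//; last exact: L2B.
      by congr (ip _ _); apply/funext => x; ring.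
    by under eq_fun do rewrite E; apply: cvgN; exact: wk.
have le : {ae leb, forall x, 0 <= lam - (f x - v0 x)}.
  apply: (@weak_limit_ge0 R n (fun j x => lam - (f x - v j x))) => //.
  - move=> j; rewrite (_ : (fun x => _) = fun x => v j x - v0 x); first exact: L2B.
    by apply/funext => x; ring.
  - by apply: measurable_funB.
  - move=> B mB fB; rewrite (_ : (fun x => _) = fun x => lam * \1_B x - (f x - v0 x) * \1_B x).
      by apply: L1B; [apply: L1Z; exact: L1_indic|exact: L2_indicM].
    by apply/funext => x; ring.
  - by move=> j; apply: filterS (wae j) => x /= [/andP[_]]; rewrite subr_ge0.
  - move=> h Lh L2h; have E j : ip (fun x => lam - (f x - v j x) - (lam - (f x - v0 x))) h =
        ip (fun x => v j x - v0 x) h.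
      by congr (ip _ _); apply/funext => x; ring.
    by under eq_fun do rewrite E; exact: wk.
have Lmuu := L2_L1M Lmu L2u.
have Z : Int (fun x => (lam - (f x - v0 x)) * u x) = 0.
  have c1 : lam * Int (fun x => w j x - u x) @[j --> \oo] --> (0 : R).
    rewrite -[X in _ --> X](mulr0 lam); apply: cvgM; first exact: cvg_cst.
    apply: squeeze0 odometer_cvg_L1 => j; apply: norm_int_le; exact: L1B.
  have c2 : ip (fun x => v j x - v0 x) u @[j --> \oo] --> (0 : R) by exact: wk.
  have c3 : ip (fun x => f x - v j x) (fun x => w j x - u x) @[j --> \oo] --> (0 : R).
    have c4 : Num.sqrt (2 * sq f + 2 * C) * Num.sqrt (sq (fun x => w j x - u x)) @[j --> \oo] --> (0 : R).
      rewrite -[X in _ --> X](mulr0 (Num.sqrt (2 * sq f + 2 * C))).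
      by apply: cvgM; [exact: cvg_cst|exact: sqrt_cvg0].
    apply: squeeze0 c4 => j; have LD := L2B L2f (L2v j).
    apply: le_trans (norm_ip_le LD (L2B (L2w j) L2u)) _; apply: ler_wpM2r; first exact: sqrtr_ge0.
    by rewrite ler_wsqrtr// (le_trans (sqBle _ _))// lerD2l ler_wpM2l.
  (* The integral of (lam - mu_j) w_j vanishes and is subtracted. Each remaining term tends to 0:
     two by convergence of w_j to u in L^1 and L^2, one by weak convergence of v_j tested with u. *)
  have E j : Int (fun x => (lam - (f x - v0 x)) * u x) =
      - (lam * Int (fun x => w j x - u x)) - ip (fun x => v j x - v0 x) u
      + ip (fun x => f x - v j x) (fun x => w j x - u x).
    have LD := L2B L2f (L2v j).
    have LW := L1B (Lw j) Lu; have L2W := L2B (L2w j) L2u.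
    have z : Int (fun x => (lam - (f x - v j x)) * w j x) = 0.
      rewrite -(int0 leb); apply: ae_int_eq; [|exact: L1_0|].
        rewrite (_ : (fun x => _) = fun x => lam * w j x - (f x - v j x) * w j x).
          by apply: L1B; [exact: L1Z|exact: L2_L1M].
        by apply/funext => x; rewrite mulrBl.
      apply: filterS (wae j) => x /= [_ h]; have := w0 j x; rewrite le_eqVlt eq_sym.
      by case/predU1P => [->|/h ->]; rewrite ?mulr0// subrr mul0r.
    rewrite -[LHS]subr0 -{1}z /ip -(intZl lam LW) -intN; last exact: L1Z.
    have La : L1 (fun x => lam * u x - (f x - v0 x) * u x) by apply: L1B => //; exact: L1Z.
    have Lb : L1 (fun x => lam * w j x - (f x - v j x) * w j x).
      by apply: L1B; [exact: L1Z|exact: L2_L1M].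
    have Lc := L2_L1M (L2B (L2v j) Lv0) L2u.
    have Ld := L2_L1M LD L2W.
    rewrite -(intB (L1N (L1Z lam LW)) Lc) -intD//; last by apply: L1B => //; exact/L1N/L1Z.
    rewrite -intB.
    - by congr (Int _); apply/funext => x; ring.
    - by rewrite (_ : (fun x => _) = fun x => lam * u x - (f x - v0 x) * u x)//; apply/funext => x; ring.
    - by rewrite (_ : (fun x => _) = fun x => lam * w j x - (f x - v j x) * w j x)//; apply/funext => x; ring.
  have : (fun j : nat => Int (fun x => (lam - (f x - v0 x)) * u x)) j @[j --> \oo] --> (- 0 - 0 + 0 : R).
    under eq_fun => j do rewrite (E j).
    by apply: cvgD => //; apply: cvgB => //; exact: cvgN.
  rewrite oppr0 !addr0 => c.
  by apply: (cvg_unique _ (cvg_cst _) c).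
(* The integrand is nonnegative only almost everywhere; its positive part allows the vanishing
   integral to be exploited. *)
pose p x := Num.max ((lam - (f x - v0 x)) * u x) 0.
have L0 : L1 (fun x => (lam - (f x - v0 x)) * u x).
  rewrite (_ : (fun x => _) = fun x => lam * u x - (f x - v0 x) * u x).
    by apply: L1B => //; exact: L1Z.
  by apply/funext => x; ring.
have pE : {ae leb, forall x, p x = (lam - (f x - v0 x)) * u x}.
  by apply: filterS le => x h; rewrite /p; apply/max_idPl; exact: mulr_ge0.
have Lp : L1 p.
  by apply: (ae_L1 _ pE L0); apply: measurable_maxr => //; exact: L1_meas L0.
have p0 : {ae leb, forall x, p x = 0}.
  apply: int_eq0_ae => //; first by move=> x; rewrite le_max lexx orbT.
  by rewrite (ae_int_eq Lp L0 pE).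
have last : {ae leb, forall x : 'rV[R]_n, 0 < u x -> f x - v0 x = lam}.
  apply: filterS2 pE p0 => x h3 h4 ux.
  move: h4; rewrite h3 => /eqP; rewrite mulf_eq0 (gt_eqF ux) orbF subr_eq0.
  by move/eqP.
by apply: filterS3 ge0 le last => x h1 h2 h3; rewrite h1 -subr_ge0.
Qed.

(** So far the density is only in L^2. On a cube, weak convergence tested with the indicator bounds
    its integral by the mass of f; the cubes then grow. *)
Lemma density_limit_L1 v0 : L2 v0 -> cvg2 leb (fun j => G j u) v0 -> L1 (fun x => f x - v0 x).
Proof.
move=> Lv0 cv0; have ae0 := density_limit Lv0 cv0.
have Lmu := L2B L2f Lv0; have mmu := L2_meas Lmu.
pose q x := Num.max (f x - v0 x) 0.
have mq : measurable_fun setT q by exact: measurable_maxr.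
have q0 x : 0 <= q x by rewrite le_max lexx orbT.
have qE : {ae leb, forall x, f x - v0 x = q x}.
  by apply: filterS ae0 => x [/andP[h _] _]; rewrite /q; apply/esym/max_idPl.
suff Lq : L1 q by exact: ae_L1 mmu qE Lq.
have ind (N : nat) x : 0 <= (\1_(@cube R n N%:R) x : R) <= 1.
  by rewrite indicE ler0n lern1 leq_b1.
have mc (N : nat) : measurable_fun setT (\1_(cube N%:R) : 'rV[R]_n -> R).
  by apply: measurable_indic; exact: measurable_cube.
have Lc (N : nat) : L1 (\1_(cube N%:R) : 'rV[R]_n -> R).
  by apply: L1_indic; [exact: measurable_cube|exact: cube_finite].
have L2c (N : nat) : L2 (\1_(cube N%:R) : 'rV[R]_n -> R).
  by apply: L2_indic; [exact: measurable_cube|exact: cube_finite].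
have LF (N : nat) : L1 (fun x => q x * \1_(cube N%:R) x).
  have qL : L1 (fun x => (f x - v0 x) * \1_(cube N%:R) x) by exact: L2_L1M Lmu (L2c N).
  apply: ae_L1 _ _ qL; first exact: measurable_funM.
  by apply: filterS qE => x ->.
have [] := @fatou_int _ _ _ leb (fun N x => q x * \1_(cube N%:R) x) q (Int f) LF _ mq q0 => //.
- by move=> N x; have /andP[] := ind N x => h _; rewrite mulr_ge0.
- apply: aeW => x; apply: cvg_near_cst.
  have [N _ Nx] : (\bigcup_k cube k%:R) x by rewrite (@bigcup_cube R n).
  near=> k; rewrite indicE mem_set ?mulr1//; apply: cube_mono Nx.
  by rewrite ler_nat; near: k; exact: nbhs_infty_ge.
- apply: nearW => N.
  have E : Int (fun x => q x * \1_(cube N%:R) x) = ip (fun x => f x - v0 x) \1_(cube N%:R).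
    by apply: ae_int_eq => //; [exact: L2_L1M Lmu (L2c N)|apply: filterS qE => x ->].
  have c : ip (fun x => f x - v0 x) \1_(cube N%:R) + - ip (fun x => v j x - v0 x) \1_(cube N%:R)
      @[j --> \oo] --> ip (fun x => f x - v0 x) \1_(cube N%:R) + - (0 : R).
    by apply: cvgD; [exact: cvg_cst|apply: cvgN; exact: (flux_weak_cvg Lv0 cv0)].
  rewrite oppr0 addr0 in c; rewrite E; apply: cvg_le_cst c _; apply: nearW => j.
  rewrite -(ipBl Lmu (L2B (L2v j) Lv0) (L2c N)).
  rewrite (_ : (fun x => _) = fun x => f x - v j x); last by apply/funext => x; ring.
  have mass : Int (fun x => f x - v j x) <= Int f := approximate_mass sa Lf wP j.
  apply: le_trans mass; apply: ae_int_le.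
  - exact: L2_L1M (L2B L2f (L2v j)) (L2c N).
  - exact: L1B.
  - apply: filterS (wae j) => x /= [/andP[h _] _].
    by have /andP[h1 h2] := ind N x; rewrite ler_piMr.
Unshelve. all: by end_near. Qed.

(** The identity v0^ = a u^ holds almost everywhere, possibly not at 0. As cubes around 0 have
    positive measure, it holds at points xi_k tending to 0, where a is small and u^ bounded; by
    dominated convergence v0^(xi_k) also tends to the integral of v0. *)
Lemma mean_zero v0 : L1 v0 -> L2 v0 -> cvg2 leb (fun j => G j u) v0 -> Int v0 = 0.
Proof.
move=> Lv0 L2v0 cv0.
have aeE := hartley_limit sa Lu L2u L2_limit_symbolM Lv0 L2v0 cv0.
pose M := 2 * Int (fun x => `|u x|) + 1.
have M0 : 0 < M by rewrite ltr_pwDr// mulr_ge0// int_ge0.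
have pick (k : nat) : exists xi : 'rV[R]_n, cube k.+1%:R^-1 xi /\ `|hartley v0 xi| <= k.+1%:R^-1.
  have e0 : 0 < k.+1%:R^-1 / M :> R by rewrite divr_gt0.
  have [r r0 ar] := a_small e0.
  pose t := Num.min r k.+1%:R^-1.
  have t0 : 0 < t by rewrite lt_min r0 invr_gt0 ltr0Sn.
  apply: contrapT => nx.
  have sub : cube t `<=` [set xi | ~ (hartley v0 xi = a xi * hartley u xi)].
    move=> xi tx E; apply: nx; exists xi; split.
      by apply: cube_mono tx; rewrite ge_min lexx orbT.
    rewrite E normrM (ger0_norm (limit_symbol_ge0 sa _)).
    have h1 : a xi <= k.+1%:R^-1 / M by apply: ar; apply: cube_mono tx; rewrite ge_min lexx.
    have h2 : `|hartley u xi| <= M by rewrite (le_trans (norm_hartley_le _ Lu))// lerDl.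
    apply: (@le_trans _ _ (k.+1%:R^-1 / M * M)); last by rewrite divfK// gt_eqF.
    by apply: ler_pM => //; exact: (limit_symbol_ge0 sa).
  have N : leb.-negligible (cube t) by apply: negligibleS sub _; exact: aeE.
  have := @measurable_cube R n t => mt.
  move/(negligibleP leb mt) : N => N; have := lebesgue_cube (n := n) (ltW t0); rewrite [LHS]N.
  have : 0 < (2 * t) ^+ n by rewrite exprn_gt0// mulr_gt0.
  by move=> tn [] /esym E; rewrite E ltxx in tn.
have [xi xiP] := choice pick.
have c0 : hartley v0 (xi k) @[k --> \oo] --> (0 : R).
  apply: squeeze0 (@cvg_harmonic R) => k; exact: (xiP k).2.
have [] := @int_dominated_cvg _ _ _ leb (fun k x => v0 x * cas (2 * pi * dotrV x (xi k))) v0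
   (fun x => 2 * `|v0 x|).
- by move=> k; exact: L1_meas (L1_hartley_kernel (xi k) Lv0).
- exact: L1_meas Lv0.
- apply: aeW => x; rewrite -[X in _ --> X]mulr1; apply: cvgM; first exact: cvg_cst.
  have cd : dotrV x (xi k) @[k --> \oo] --> (0 : R).
    apply: squeeze0 (cvg_harmonicM (\sum_i `|x 0 i|)) => k.
    rewrite /dotrV mulr_suml (le_trans (ler_norm_sum _ _ _))//; apply: ler_sum => i _.
    by rewrite normrM ler_wpM2l// ltW//; exact: (xiP k).1.
  have c2 : 2 * pi * dotrV x (xi k) @[k --> \oo] --> (2 * pi * 0 : R).
    exact: cvgM (@cvg_cst _ _ _ _ _) cd.
  have cc : cas y @[y --> (2 * pi * 0 : R)] --> cas (2 * pi * 0 : R) by exact: continuous_cas.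
  have := cvg_comp _ _ c2 cc.
  by rewrite [cas (2 * pi * 0)](_ : _ = 1)// mulr0 /cas cos0 sin0 addr0.
- by apply: L1Z; exact: L1_norm.
- by move=> k x; rewrite normrM mulrC ler_wpM2r// norm_cas.
by move=> _ c; apply: cvg_unique c c0.
Qed.

End obstacle.

(** * Fourier transforms and fractional Laplacians *)

Section lapsym.
Context {R : realType} {n : nat}.
Local Notation leb := (lebesgue_rV n : {sigma_finite_measure set 'rV[R]_n -> \bar R}).
Local Notation L1 := (L1 leb).
Local Notation L2 := (L2 leb).
Local Notation Int := (Int leb).
Local Notation sq := (sq leb).
Implicit Types (f g h u v : 'rV[R]_n -> R) (x xi : 'rV[R]_n).

Lemma lapsym_powR (al : R) xi : 0 < al ->
  lapsym xi `^ (al / 2) = (2 * pi * euclidean_norm xi) `^ al.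
Proof.
move=> al0; have -> : lapsym xi = (2 * pi * euclidean_norm xi) `^ 2%:R.
  rewrite powR_mulrn; last by rewrite !mulr_ge0 ?pi_ge0 ?sqrtr_ge0.
  by rewrite !exprMn sqr_sqrtr ?dotrV_ge0// /lapsym -natrX.
by rewrite -powRrM; congr (_ `^ _); field.
Qed.

Lemma lapsym_coercive (b r : R) : 0 < b -> 0 < r ->
  exists2 c, 0 < c & forall xi, ~ cube r xi -> c <= lapsym xi `^ b.
Proof.
move=> b0 r0; exists ((4 * pi ^+ 2 * r ^+ 2) `^ b).
  by rewrite powR_gt0// !mulr_gt0 ?exprn_gt0 ?pi_gt0.
move=> xi nr; apply: ge0_ler_powR; rewrite ?nnegrE ?(ltW b0) ?lapsym_ge0//.
  by rewrite mulr_ge0 ?sqr_ge0// mulr_ge0 ?sqr_ge0.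
rewrite /lapsym ler_wpM2l//; first by rewrite mulr_ge0 ?sqr_ge0.
have [i ri] : exists i, r <= `|xi 0 i|.
  apply: contrapT => ne; apply: nr => i; rewrite ltNge; apply/negP => ri.
  by apply: ne; exists i.
apply: le_trans (sqr_coord_le_dotrV xi i).
by rewrite -[leRHS]real_normK ?num_real// lerXn2r ?nnegrE// ltW.
Qed.

Lemma lapsym_small (b e : R) : 0 < b -> 0 < e ->
  exists2 r, 0 < r & forall xi, cube r xi -> lapsym xi `^ b <= e.
Proof.
move=> b0 e0; pose d := e `^ b^-1.
have d0 : 0 < d by rewrite powR_gt0.
(* [n.+1] rather than [n] keeps [c] positive in every dimension. *)
pose c : R := 4 * pi ^+ 2 * n.+1%:R.
have c0 : 0 < c by rewrite !mulr_gt0 ?exprn_gt0 ?pi_gt0.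
exists (Num.sqrt (d / c)); first by rewrite sqrtr_gt0 divr_gt0.
move=> xi hx; apply: (@le_trans _ _ (d `^ b)); last first.
  by rewrite -powRrM mulVf ?gt_eqF// powRr1// ltW.
apply: ge0_ler_powR; rewrite ?nnegrE ?(ltW b0) ?(ltW d0) ?lapsym_ge0//.
have h : dotrV xi xi <= n.+1%:R * (d / c).
  apply: (@le_trans _ _ (\sum_(i < n) (d / c))); last first.
    rewrite sumr_const card_ord -[leLHS]mulr_natl; apply: ler_wpM2r; last by rewrite ler_nat.
    by rewrite divr_ge0 ?(ltW d0)// ltW.
  apply: ler_sum => i _; rewrite -expr2 -[leLHS]real_normK ?num_real//.
  rewrite -[leRHS]sqr_sqrtr ?divr_ge0 ?(ltW d0) ?(ltW c0)//.
  by rewrite lerXn2r ?nnegrE ?sqrtr_ge0// ltW.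
rewrite /lapsym; apply: (@le_trans _ _ (4 * pi ^+ 2 * (n.+1%:R * (d / c)))).
  by rewrite ler_wpM2l// mulr_ge0 ?sqr_ge0.
by rewrite mulrA -/c mulrC divfK// gt_eqF.
Qed.

Lemma lapsym_powR_le (b b' : R) xi : 0 < b -> b <= b' ->
  lapsym xi `^ b <= 1 + lapsym xi `^ b'.
Proof.
move=> b0 bb; have p0 : 0 <= lapsym xi `^ b' by exact: powR_ge0.
have [h|h] := leP (lapsym xi) 1.
  apply: (@le_trans _ _ 1); last by rewrite lerDl.
  rewrite -[leRHS](congr1 (fun p : R -> R => p b) (powR1 R)).
  by apply: ge0_ler_powR; rewrite ?nnegrE ?lapsym_ge0 ?(ltW b0).
apply: (@le_trans _ _ (lapsym xi `^ b')); last by rewrite lerDr.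
by apply: ler_powR => //; exact: ltW.
Qed.

Lemma hartleyN h xi : L1 h -> hartley h (- xi) =
  Int (fun x => h x * cos (2 * pi * dotrV x xi)) - Int (fun x => h x * sin (2 * pi * dotrV x xi)).
Proof.
move=> Lh; rewrite -intB; [|exact: L1_cosT_kernel|exact: L1_sinT_kernel].
congr (Int _); apply/funext => x.
by rewrite dotrVNr mulrN /cas cosN sinN mulrBr.
Qed.

Lemma hartleyE h xi : L1 h -> hartley h xi =
  Int (fun x => h x * cos (2 * pi * dotrV x xi)) + Int (fun x => h x * sin (2 * pi * dotrV x xi)).
Proof.
move=> Lh; rewrite -intD; [|exact: L1_cosT_kernel|exact: L1_sinT_kernel].
by congr (Int _); apply/funext => x; rewrite -mulrDr.
Qed.

(** For g = [hartley h] the even part is the cosine transform of h and the odd part is its sine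
    transform. *)
Definition evenp g xi : R := (g xi + g (- xi)) / 2.
Definition oddp g xi : R := (g xi - g (- xi)) / 2.

Lemma fourier_hartley h xi : L1 h ->
  fourier h xi = (evenp (hartley h) xi +i* - oddp (hartley h) xi)%C.
Proof.
move=> Lh; rewrite /evenp /oddp hartleyN// hartleyE//.
by congr (_ +i* - _)%C; rewrite -?/(Int _); field.
Qed.

Lemma L2_evenp g : L2 g -> L2 (evenp g).
Proof.
move=> Lg; rewrite (_ : evenp g = fun xi => 2^-1 * (g xi + g (- xi))).
  by apply/L2Z/L2D => //; exact: L2_oppr.
by apply/funext => xi; rewrite /evenp mulrC.
Qed.

Lemma L2_oddp g : L2 g -> L2 (oddp g).
Proof.
move=> Lg; rewrite (_ : oddp g = fun xi => 2^-1 * (g xi - g (- xi))).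
  by apply/L2Z/L2B => //; exact: L2_oppr.
by apply/funext => xi; rewrite /oddp mulrC.
Qed.

Lemma sq_evenp_oddp g : L2 g ->
  Int (fun xi => evenp g xi ^+ 2 + oddp g xi ^+ 2) = sq g.
Proof.
move=> Lg; have Lo := L2_oppr Lg; have [_ L] := Lg; have [_ L'] := Lo.
rewrite (_ : (fun xi => _) = fun xi => 2^-1 * (g xi ^+ 2 + g (- xi) ^+ 2)); last first.
  by apply/funext => xi; rewrite /evenp /oddp; field.
rewrite intZl ?intD//; last exact: L1D.
rewrite -!sqE (sq_oppr Lg); by field.
Qed.

End lapsym.

Section Lfun_real.
Context d (T : measurableType d) (R : realType) (mu : {measure set T -> \bar R}).
Implicit Types f g : T -> R.

Lemma Lnorm2E f : L2 mu f -> ('N[mu]_2%:E[EFin \o f] = (Num.sqrt (sq mu f))%:E)%E.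
Proof.
move=> [mf Lf]; rewrite unlock /=.
under eq_integral => x _ do rewrite powR_mulrn// real_normK ?num_real//.
by rewrite L1_fin_num// poweR_EFin powR12_sqrt ?int_ge0// => x; rewrite ?sqr_ge0// -sqE.
Qed.

Lemma Lfun2P f : f \in Lfun mu 2%:E <-> L2 mu f.
Proof.
split=> [Lf|Lf].
  split; last exact: Lfun2_integrable_sqr.
  by move: Lf; rewrite inE => /andP[]; rewrite inE.
rewrite inE; apply/andP; split; first by rewrite inE; case: Lf.
by rewrite inE /finite_norm /= Lnorm2E// ltry.
Qed.

End Lfun_real.

(** * From Hartley to Fourier transforms on L^2 *)

Section fourierL2.
Context {R : realType} {n : nat}.
Local Notation leb := (lebesgue_rV n : {sigma_finite_measure set 'rV[R]_n -> \bar R}).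
Local Notation L1 := (L1 leb).
Local Notation L2 := (L2 leb).
Local Notation Int := (Int leb).
Local Notation sq := (sq leb).
Implicit Types (f g h u v K : 'rV[R]_n -> R) (x xi : 'rV[R]_n).

Lemma Lnorm2_cvg0 (F : nat -> 'rV[R]_n -> R) : (forall k, L2 (F k)) ->
  sq (F k) @[k --> \oo] --> (0 : R) ->
  ('N[leb]_2%:E[EFin \o F k])%E @[k --> \oo] --> 0%E.
Proof.
move=> LF F0; under eq_fun do rewrite Lnorm2E//.
by apply: cvg_EFin; [exact: nearW|exact: sqrt_cvg0].
Qed.

(* the Fourier transform of a real function whose Hartley transform is K *)
Definition fourier_of K xi : R[i] := (evenp K xi +i* - oddp K xi)%C.

Lemma normc_fourier_of K xi : Normc.normc (fourier_of K xi) = Num.sqrt (evenp K xi ^+ 2 + oddp K xi ^+ 2).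
Proof. by rewrite /= sqrrN. Qed.

Lemma fourier_ofB K K' xi : fourier_of K xi - fourier_of K' xi = fourier_of (fun x => K x - K' x) xi.
Proof. by apply/eqP; rewrite eq_complex /= /evenp /oddp; apply/andP; split; apply/eqP; field. Qed.

Lemma L2_normc_fourier_of K : L2 K ->
  L2 (fun xi => Normc.normc (fourier_of K xi)) /\ sq (fun xi => Normc.normc (fourier_of K xi)) = sq K.
Proof.
move=> LK; have [me Le] := L2_evenp LK; have [mo Lo] := L2_oddp LK.
have E : (fun xi => Normc.normc (fourier_of K xi) ^+ 2) = (fun xi => evenp K xi ^+ 2 + oddp K xi ^+ 2).
  by apply/funext => xi; rewrite normc_fourier_of sqr_sqrtr// addr_ge0 ?sqr_ge0.
split; last by rewrite sqE E sq_evenp_oddp.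
split; last by rewrite E; exact: L1D.
under eq_fun do rewrite normc_fourier_of.
apply: (@measurableT_comp _ _ _ _ _ _ (@Num.sqrt R)).
  by apply: continuous_measurable_fun; exact: sqrt_continuous.
by apply: measurable_funD; exact: measurable_funX.
Qed.

Lemma is_fourierL2_limit u K (g : nat -> 'rV[R]_n -> R) : L2 u -> L2 K ->
  (forall k, L1 (g k)) -> (forall k, L2 (g k)) -> cvg2 leb g u ->
  cvg2 leb (fun k => hartley (g k)) K -> is_fourierL2 u (fourier_of K).
Proof.
move=> Lu LK Lg L2g gu gK; split.
- exact/Lfun2P.
- split; first by apply/Lfun2P; exact: L2_evenp.
  by apply/Lfun2P; exact/L2N/L2_oddp.
- exists g; split.
  + by move=> k; split; [apply/Lfun1_integrable; exact: Lg|apply/Lfun2P; exact: L2g].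
  + by apply: Lnorm2_cvg0 => // k; exact: L2B.
  + have E k : (fun xi => Normc.normc (fourier (g k) xi - fourier_of K xi)) =
        fun xi => Normc.normc (fourier_of (fun x => hartley (g k) x - K x) xi).
      by apply/funext => xi; rewrite fourier_hartley// -fourier_ofB.
    have LD k : L2 (fun x => hartley (g k) x - K x).
      by apply: L2B => //; case: (hartley_plancherel (Lg k) (L2g k)).
    under eq_fun do rewrite E.
    apply: Lnorm2_cvg0; first by move=> k; case: (L2_normc_fourier_of (LD k)).
    apply: cvg_trans gK; apply: near_eq_cvg; apply: nearW => k.
    by case: (L2_normc_fourier_of (LD k)).
Qed.

Lemma cvg2_cst h : cvg2 leb (fun=> h) h.
Proof.
rewrite /cvg2; under eq_fun => k.
  rewrite (_ : (fun x => h x - h x) = fun=> 0); last by apply/funext => x; rewrite subrr.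
  rewrite sqE (_ : (fun=> 0 ^+ 2) = fun=> 0) ?int0; last by apply/funext => x; rewrite expr0n.
  over.
exact: cvg_cst.
Qed.

(** [v] is only in L^2, so its transform is reached through the approximants [g]; for [u], which is
    also integrable, a constant sequence serves. The symbol is even, hence multiplies even and odd
    parts separately. *)
Lemma is_frac_laplacian_limit (al : R) u v (g : nat -> 'rV[R]_n -> R) : 0 < al ->
  L1 u -> L2 u -> L2 v -> L2 (fun xi => lapsym xi `^ (al / 2) * hartley u xi) ->
  (forall k, L1 (g k)) -> (forall k, L2 (g k)) -> cvg2 leb g v ->
  cvg2 leb (fun k => hartley (g k)) (fun xi => lapsym xi `^ (al / 2) * hartley u xi) ->
  is_frac_laplacian al u v.
Proof.
move=> al0 Lu L2u Lv La Lg L2g gv gK.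
have [LH _] := hartley_plancherel Lu L2u.
exists (fourier_of (hartley u)), (fourier_of (fun xi => lapsym xi `^ (al / 2) * hartley u xi)).
split.
- exact: (is_fourierL2_limit L2u LH (g := fun=> u) _ _ (@cvg2_cst _) (@cvg2_cst _)).
- exact: is_fourierL2_limit gv gK.
- apply: aeW => xi; rewrite -lapsym_powR//.
  have lN : lapsym (- xi) = lapsym xi by rewrite /lapsym dotrVNl dotrVNr opprK.
  apply/eqP; rewrite eq_complex /= /evenp /oddp lN.
  by apply/andP; split; apply/eqP; field.
Qed.

End fourierL2.

(** * The weak gradient *)

Section lipschitz.
Context {R : realType}.

Lemma derive_bounded_lipschitz (f df : R -> R) (M s t : R) :
  (forall x, is_derive x (1 : R) f (df x)) -> (forall x, `|df x| <= M) ->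
  `|f t - f s| <= M * `|t - s|.
Proof.
move=> dfP dM.
wlog st : s t / s < t => [hw|].
  have [ts|st|->] := ltgtP t s; [|exact: hw|].
    by rewrite distrC (distrC t); exact: hw.
  by rewrite !subrr !normr0 mulr0.
have [c _ ->] := MVT st (fun r _ => dfP r) (continuous_subspaceT (is_derive_continuous dfP)).
by rewrite normrM ler_wpM2r.
Qed.

Lemma normr_sin_le (t : R) : `|sin t| <= `|t|.
Proof.
have := @derive_bounded_lipschitz sin cos 1 0 t (@is_derive_sin R).
by rewrite sin0 !subr0 mul1r; apply => x; exact: cos_max.
Qed.

Lemma normr_cosB1_le (t : R) : `|cos t - 1| <= `|t|.
Proof.
have := @derive_bounded_lipschitz cos (fun x => - sin x) 1 0 t (@is_derive_cos R).
by rewrite cos0 subr0 mul1r; apply => x; rewrite normrN; exact: sin_max.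
Qed.

Lemma difference_quotient_cvg (V : normedModType R) (phi : V -> R) x e (t : nat -> R) :
  derivable phi x e ->
  (forall k, t k != 0) -> t k @[k --> \oo] --> 0 ->
  (t k)^-1 * (phi (x + t k *: e) - phi x) @[k --> \oo] --> 'D_e phi x.
Proof.
move=> dphi t0 tc.
have t' : t k @[k --> \oo] --> 0^'.
  move=> A /= [d d0 dA]; move/cvgrPdist_lt : tc => /(_ d d0); apply: filterS => k.
  by move=> h; apply: dA => //=; rewrite t0.
have := cvg_comp _ _ t' dphi.
apply: cvg_trans; apply: near_eq_cvg; apply: nearW => k /=.
by rewrite [t k *: e + x]addrC.
Qed.

End lipschitz.

Section compact_support.
Context {R : realType} {n : nat}.
Local Notation leb := (lebesgue_rV n : {sigma_finite_measure set 'rV[R]_n -> \bar R}).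
Local Notation L1 := (L1 leb).
Local Notation L2 := (L2 leb).
Implicit Types (f g phi : 'rV[R]_n -> R) (x e : 'rV[R]_n).

Lemma continuous_compact_bounded f (K : set 'rV[R]_n) : continuous f -> compact K ->
  exists2 M, 0 <= M & forall x, K x -> `|f x| <= M.
Proof.
move=> cf cK; have : compact (f @` K).
  by apply: continuous_compact cK; exact: continuous_subspaceT.
move/compact_bounded => [M [Mr HM]].
exists (`|M| + 1); first by rewrite addr_ge0.
move=> x Kx; apply: (HM (`|M| + 1)); last by exists x.
by rewrite (le_lt_trans (ler_norm M))// ltrDl.
Qed.

Lemma compact_sub_cube (K : set 'rV[R]_n) : compact K -> exists N : nat, K `<=` cube N%:R.
Proof.
move=> cK.
have /choice[M MP] : forall i : 'I_n, exists M, forall x, K x -> `|x 0 i| <= M.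
  move=> i; have [M _ MK] := continuous_compact_bounded (@coord_continuous _ _ _ 0 i) cK.
  by exists M.
have S0 : 0 <= \sum_i `|M i| by exact: sumr_ge0.
exists (Num.bound (\sum_i `|M i|)) => x Kx i.
apply: le_lt_trans (archi_boundP S0); apply: le_trans (MP i x Kx) _.
apply: le_trans (ler_norm _) _; rewrite (bigD1 i)//= lerDl.
exact: sumr_ge0.
Qed.

Lemma L2_locally_integrable g : L2 g -> locally_integrable_rV g.
Proof.
move=> Lg; split; first exact: L2_meas Lg.
move=> K cK; have [N KN] := compact_sub_cube cK.
have mK : measurable K by apply: closed_measurable_rV; apply: compact_closed cK; exact: norm_hausdorff.
have fK : (leb K < +oo)%E.
  apply: le_lt_trans (cube_finite N%:R); apply: le_measure; rewrite ?inE//; exact: measurable_cube.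
have L := L1_norm (L2_indicM mK fK Lg).
have ge0 x : 0 <= `|g x * \1_K x| by [].
have := (L1_ge0P leb (L1_meas L) ge0).1 L; apply: le_lt_trans.
rewrite [leLHS]integral_mkcond le_eqVlt; apply/orP; left; apply/eqP; apply: eq_integral => x _.
by rewrite patchE indicE; case: (x \in K); rewrite ?mulr1// mulr0 normr0.
Qed.

Lemma is_derive_line phi x e (r : R) : differentiable phi (x + r *: e) ->
  is_derive r (1 : R) (fun t : R => phi (x + t *: e)) ('D_e phi (x + r *: e)).
Proof.
move=> /(@diff_derivable _ _ _ _ _ e) dphi.
have E : (fun k : R => k^-1 *: (((fun t : R => phi (x + t *: e)) \o shift r) (k *: 1) - phi (x + r *: e))) =
    (fun k : R => k^-1 *: ((phi \o shift (x + r *: e)) (k *: e) - phi (x + r *: e))).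
  apply/funext => k; congr (_ *: (phi _ - _)).
  by rewrite /shift /= [k *: 1]mulr1 scalerDl addrCA addrC.
by split; [rewrite /derivable E|rewrite /derive E].
Qed.

Lemma test_function_bounds phi i : test_function phi ->
  [/\ forall x, differentiable phi x, L2 phi, measurable_fun setT ('D_(delta_mx 0 i) phi) &
   exists M, forall x, `|'D_(delta_mx 0 i) phi x| <= M].
Proof.
move=> [sm cK]; set K := closure _ in cK.
have dphi x : differentiable phi x by exact: (sm [::] x).
have dd x : differentiable ('D_(delta_mx 0 i) phi) x by exact: (sm [:: i] x).
have cphi : continuous phi by move=> x; exact: differentiable_continuous.
have cd : continuous ('D_(delta_mx 0 i) phi) by move=> x; exact: differentiable_continuous.
have [M M0 HM] := continuous_compact_bounded cphi cK.
have [M' M'0 HM'] := continuous_compact_bounded cd cK.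
have [N KN] := compact_sub_cube cK.
have out x : ~ K x -> phi x = 0.
  by move=> nK; apply/eqP; apply: contrapT => px; apply: nK; apply: subset_closure; exact/negP.
split => //; last 1 first.
- exists M' => x; have [Kx|nKx] := pselect (K x); first exact: HM'.
  (* Off the closed support, phi vanishes in a whole neighbourhood, and so does its derivative. *)
  rewrite (@near_eq_derive _ _ _ _ (cst 0)) ?derive_cst ?normr0//.
  have oK : open (~` K) by apply: closed_openC; exact: closed_closure.
  by apply: filterS (open_nbhs_nbhs (conj oK nKx)) => y; exact: out.
- apply: L2_le (continuous_measurable_rV cphi) _ (L2Z M (L2_indic (measurable_cube N%:R) (cube_finite N%:R))).
  move=> x; have [Kx|nKx] := pselect (K x); last by rewrite out// normr0.
  by rewrite indicE mem_set ?mulr1 ?(ger0_norm M0)//; [exact: HM|exact: KN].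
- exact: continuous_measurable_rV.
Qed.

End compact_support.

Section weak_gradient.
Context {R : realType} {n : nat}.
Local Notation leb := (lebesgue_rV n : {sigma_finite_measure set 'rV[R]_n -> \bar R}).
Local Notation L1 := (L1 leb).
Local Notation L2 := (L2 leb).
Local Notation Int := (Int leb).
Local Notation sq := (sq leb).
Local Notation ip := (ip leb).
Implicit Types (f g h phi : 'rV[R]_n -> R) (x e xi : 'rV[R]_n).

(** Translations are not even, so the Hartley transform does not diagonalize them: they mix the
    frequencies xi and -xi. *)
Lemma hartley_shift h e xi : L1 h -> hartley (fun x => h (x + e)) xi =
  cos (2 * pi * dotrV e xi) * hartley h xi - sin (2 * pi * dotrV e xi) * hartley h (- xi).
Proof.
move=> Lh; set th := 2 * pi * dotrV e xi.
have K1 := L1_hartley_kernel xi Lh; have K2 := L1_hartley_kernel (- xi) Lh.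
pose q (y : 'rV[R]_n) := cos th * (h y * cas (2 * pi * dotrV y xi)) -
  sin th * (h y * cas (2 * pi * dotrV y (- xi))).
have Lq : L1 q by apply: L1B; exact: L1Z.
have -> : hartley (fun x => h (x + e)) xi = Int (fun x => q (x + e)).
  congr (Int _); apply/funext => x; rewrite /q dotrVNr mulrN dotrVDl [2 * pi * (_ + _)]mulrDr -/th.
  set b := 2 * pi * dotrV x xi.
  have -> : cas b = cas (- th + (b + th)) by congr cas; ring.
  by rewrite casD cosN sinN /cas cosN sinN; ring.
by rewrite Int_shift// intB ?intZl//; exact: L1Z.
Qed.

Variable u : 'rV[R]_n -> R.
Hypotheses (Lu : L1 u) (L2u : L2 u) (u0 : forall x, 0 <= u x).
Hypothesis Lhalf : L2 (fun xi => lapsym xi `^ (1 / 2) * hartley u xi).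
Variable i : 'I_n.
Local Notation e := (delta_mx 0 i : 'rV[R]_n).

(* steps of alternating sign, so that one limit sees both one-sided quotients *)
Let t k : R := (-1) ^+ k * k.+1%:R^-1.
Let t_neq0 k : t k != 0.
Proof. by rewrite mulf_neq0 ?signr_eq0// invr_neq0// pnatr_eq0. Qed.
Let t_cvg : t k @[k --> \oo] --> (0 : R).
Proof.
apply: squeeze0 (@cvg_harmonic R) => k.
by rewrite /t normrM normrX normrN normr1 expr1n mul1r ger0_norm.
Qed.

Definition quotient k (x : 'rV[R]_n) : R := (t k)^-1 * (u (x + t k *: e) - u x).

Let Lq k : L1 (quotient k). Proof. by apply/L1Z/L1B => //; exact: L1_shift. Qed.
Let L2q k : L2 (quotient k). Proof. by apply/L2Z/L2B => //; exact: L2_shift. Qed.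

Let dotrVe xi : dotrV e xi = xi 0 i.
Proof.
rewrite /dotrV (bigD1 i)//= big1 ?addr0 => [|j ji].
  by rewrite mxE !eqxx mul1r.
by rewrite mxE (negbTE ji) andbF mul0r.
Qed.

Lemma hartley_quotient k xi : hartley (quotient k) xi =
  (t k)^-1 * (cos (2 * pi * xi 0 i * t k) - 1) * hartley u xi -
  (t k)^-1 * sin (2 * pi * xi 0 i * t k) * hartley u (- xi).
Proof.
have Ls := L1_shift (t k *: e) Lu.
rewrite hartleyZ; last exact: L1B.
rewrite hartleyB// hartley_shift//.
have -> : 2 * pi * dotrV (t k *: e) xi = 2 * pi * xi 0 i * t k.
  have -> : dotrV (t k *: e) xi = t k * xi 0 i.
    by rewrite -dotrVe /dotrV mulr_sumr; apply: eq_bigr => j _; rewrite !mxE mulrA.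
  by rewrite mulrCA mulrC.
by ring.
Qed.

Let slope_le xi : `|2 * pi * xi 0 i| <= lapsym xi `^ (1 / 2).
Proof.
rewrite lapsym_powR// powRr1; last by rewrite !mulr_ge0 ?pi_ge0 ?sqrtr_ge0.
rewrite normrM ger0_norm; last by rewrite mulr_ge0 ?pi_ge0.
rewrite ler_wpM2l ?mulr_ge0 ?pi_ge0// -sqrtr_sqr ler_wsqrtr//.
exact: sqr_coord_le_dotrV.
Qed.

(** By |cos s - 1| <= |s| and |sin s| <= |s| the quotients are dominated by |2 pi xi_i| times |u^|
    at xi and -xi, which is square integrable. Pointwise the cosine part vanishes in the limit, and
    the sine part leaves -2 pi xi_i u^(-xi). *)
Lemma quotient_hartley_cvg2 : exists2 K, L2 K & cvg2 leb (fun k => hartley (quotient k)) K.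
Proof.
pose l xi := lapsym xi `^ (1 / 2) : R.
pose Q xi := l xi * hartley u xi.
have lN xi : l (- xi) = l xi by rewrite /l /lapsym dotrVNl dotrVNr opprK.
have l0 xi : 0 <= l xi by exact: powR_ge0.
have LQ : L2 Q by [].
have LQN := L2_oppr LQ.
pose K xi := - (2 * pi * xi 0 i * hartley u (- xi)).
have mHN : measurable_fun setT (fun xi : 'rV[R]_n => hartley u (- xi)).
  apply: measurableT_comp; first exact: measurable_hartley.
  by apply: measurable_fun_opprV; exact: measurable_id.
have KQ xi : `|K xi| <= `|Q (- xi)|.
  by rewrite /K normrN (normrM (2 * pi * _)) /Q lN (normrM (l xi)) (ger0_norm (l0 xi)) ler_wpM2r.
have LK : L2 K.
  apply: L2_le KQ LQN; apply: measurableT_comp => //; apply: measurable_funM => //.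
  by apply: measurable_funM => //; exact: measurable_coord.
exists K => //.
have qb k xi : `|hartley (quotient k) xi| <= `|Q xi| + `|Q (- xi)|.
  have tp : 0 < `|t k| by rewrite normr_gt0.
  have aux (z : R) : `|z| <= `|2 * pi * xi 0 i * t k| -> `|(t k)^-1 * z| <= l xi.
    rewrite (normrM (2 * pi * _)) (normrM (t k)^-1) normfV => h; rewrite ler_pdivrMl//.
    by rewrite mulrC; apply: le_trans h _; rewrite ler_wpM2r// slope_le.
  rewrite hartley_quotient (le_trans (ler_normB _ _))// /Q lN !(normrM (l xi)) (ger0_norm (l0 _)).
  apply: lerD; rewrite (normrM (_^-1 * _)) ler_wpM2r// aux//; [exact: normr_cosB1_le|exact: normr_sin_le].
have LHq k : L2 (hartley (quotient k)) by case: (hartley_plancherel (Lq k) (L2q k)).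
have [_ LQ2] := LQ; have [_ LQN2] := LQN.
(* The bound comes from |Q(xi)| + 2 |Q(-xi)| and (b + 2c)^2 <= 2 b^2 + 8 c^2. *)
have [] := @int_dominated_cvg _ _ _ leb (fun k xi => (hartley (quotient k) xi - K xi) ^+ 2) (fun=> 0)
  (fun xi => 2 * Q xi ^+ 2 + 8 * Q (- xi) ^+ 2).
- by move=> k; have [_ /L1_meas] := L2B (LHq k) LK.
- exact: measurable_cst.
- apply: aeW => xi.
  have dc : is_derive (0 : R) (1 : R) (fun r : R => cos (2 * pi * xi 0 i * r)) 0.
    have := is_derive_comp_cos (is_derive_mulk (2 * pi * xi 0 i) 0).
    by rewrite mulr0 sin0 oppr0 ?mulr0 ?mul0r.
  have ds : is_derive (0 : R) (1 : R) (fun r : R => sin (2 * pi * xi 0 i * r)) (2 * pi * xi 0 i).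
    have := is_derive_comp_sin (is_derive_mulk (2 * pi * xi 0 i) 0).
    by rewrite mulr0 cos0 ?mulr1 ?mul1r.
  have c1 := difference_quotient_cvg (@ex_derive _ _ _ _ _ _ _ dc) t_neq0 t_cvg.
  have c2 := difference_quotient_cvg (@ex_derive _ _ _ _ _ _ _ ds) t_neq0 t_cvg.
  rewrite derive_val mulr0 cos0 in c1; rewrite derive_val mulr0 sin0 in c2.
  have c : hartley (quotient k) xi - K xi @[k --> \oo] --> (0 : R).
    rewrite [X in _ --> X](_ : 0 = (0 * hartley u xi - 2 * pi * xi 0 i * hartley u (- xi)) - K xi); last first.
      by rewrite /K; ring.
    apply: cvgB; last exact: cvg_cst.
    under eq_fun do rewrite hartley_quotient.
    apply: cvgB; apply: cvgM; try exact: cvg_cst.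
      apply: cvg_trans c1; apply: near_eq_cvg; apply: nearW => k.
      by rewrite add0r [t k *: 1]mulr1.
    apply: cvg_trans c2; apply: near_eq_cvg; apply: nearW => k.
    by rewrite add0r [t k *: 1]mulr1 subr0.
  rewrite -[X in _ --> X](expr0n R 2).
  by apply: (@continuous_cvg _ _ _ _ _ _ (fun y : R => y ^+ 2)) c; exact: exprn_continuous.
- by apply: L1D; exact: L1Z.
- move=> k xi; rewrite ger0_norm ?sqr_ge0//.
  have h : `|hartley (quotient k) xi - K xi| <= `|Q xi| + 2 * `|Q (- xi)|.
    apply: le_trans (ler_normB _ _) _; rewrite mulr_natl mulr2n addrA.
    by apply: lerD; [exact: qb|exact: KQ].
  rewrite -(real_normK (num_real (_ - _))) -(real_normK (num_real (Q xi))) -(real_normK (num_real (Q (- xi)))).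
  move: h; move: `|_ - _| `|Q xi| `|Q (- xi)| (normr_ge0 (hartley (quotient k) xi - K xi)) => a b c a0 h.
  apply: (@le_trans _ _ ((b + 2 * c) ^+ 2)); first by rewrite lerXn2r ?nnegrE// (le_trans a0).
  by have := sqr_ge0 (b - 2 * c); nra.
move=> _; rewrite int0; apply: cvg_trans; apply: near_eq_cvg; apply: nearW => k.
by rewrite sqE.
Qed.

Lemma partial_derivative : exists g, [/\ L2 g,
  {ae leb, forall x, u x = 0 -> g x = 0} &
  forall phi, test_function phi -> Int (fun x => u x * 'D_e phi x) = - Int (fun x => g x * phi x)].
Proof.
have [K LK cK] := quotient_hartley_cvg2.
have [g Lg cg] := hartley_cvg2_complete Lq L2q LK cK.
exists g; split => //.
- have mZ : measurable [set x | u x = 0].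
    by rewrite -[X in measurable X]setTI; exact: (L1_meas Lu) (measurable_set1 0).
  have sub (p : nat -> nat) : (forall k, (k <= p k)%N) -> cvg2 leb (fun k => quotient (p k)) g.
    move=> kp; have pc : p k @[k --> \oo] --> \oo.
      apply/cvgnyPge => A; near=> k; apply: leq_trans (kp k).
      by near: k; exact: nbhs_infty_ge.
    exact: cvg_comp _ _ pc cg.
  have gp : {ae leb, forall x, u x = 0 -> 0 <= g x}.
    apply: (@cvg2_ge0 _ _ _ leb (fun k => quotient k.*2) g [set x | u x = 0]) => //.
    + by move=> k; exact: L2B.
    + exact: L2_meas Lg.
    + move=> k; apply: aeW => x ux; rewrite /quotient /t -signr_odd odd_double expr0 mul1r invrK.
      by rewrite mulr_ge0// ux subr0.
    + by apply: sub => k; rewrite -addnn leq_addr.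
  have gn : {ae leb, forall x, u x = 0 -> 0 <= - g x}.
    apply: (@cvg2_ge0 _ _ _ leb (fun k x => - quotient k.*2.+1 x) (fun x => - g x) [set x | u x = 0]) => //.
    + by move=> k; apply: L2B; exact: L2N.
    + exact: L2_meas (L2N Lg).
    + move=> k; apply: aeW => x ux; rewrite /quotient /t -signr_odd /= odd_double expr1.
      by rewrite mulN1r invrN invrK mulNr opprK mulr_ge0// ux subr0.
    + have odd_ge k : (k <= k.*2.+1)%N by rewrite -addnn ltnW// ltnS leq_addr.
      apply: cvg_trans (sub _ odd_ge); apply: near_eq_cvg; apply: nearW => k.
      rewrite !sqE; congr (Int _); apply/funext => x; ring.
  by apply: filterS2 gp gn => x h1 h2 ux; apply/eqP; rewrite eq_le h1// -oppr_ge0 h2.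
- move=> phi tphi; have [dphi Lphi mD [M DM]] := test_function_bounds i tphi.
  have c1 := cvg2_ip L2q Lg Lphi cg.
  (* Discrete integration by parts: translation invariance moves the quotient to [phi], with the
     opposite step. *)
  have E k : ip (quotient k) phi =
      - Int (fun x => u x * ((- t k)^-1 * (phi (x + (- t k) *: e) - phi x))).
    have Lp := L2_L1M (L2_shift (t k *: e) L2u) Lphi.
    have Lp0 := L2_L1M L2u Lphi.
    have Lps := L2_L1M L2u (L2_shift (- (t k *: e)) Lphi).
    transitivity ((t k)^-1 * (Int (fun x => u (x + t k *: e) * phi x) - Int (fun x => u x * phi x))).
      rewrite -intB// -intZl; last exact: L1B.
      by congr (Int _); apply/funext => x; rewrite /quotient; ring.
    have -> : Int (fun x => u (x + t k *: e) * phi x) = Int (fun x => u x * phi (x - t k *: e)).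
      rewrite -(Int_shift (t k *: e) Lps); congr (Int _); apply/funext => x.
      by rewrite addrK.
    rewrite -intB// -intZl; last exact: L1B.
    rewrite -intN; last first.
      rewrite (_ : (fun x => _) = fun x => (- t k)^-1 * (u x * phi (x - t k *: e) - u x * phi x)).
        by apply: L1Z; exact: L1B.
      by apply/funext => x; rewrite scaleNr; ring.
    by congr (Int _); apply/funext => x; rewrite scaleNr invrN; ring.
  have [] := @int_dominated_cvg _ _ _ leb
    (fun k x => u x * ((- t k)^-1 * (phi (x + (- t k) *: e) - phi x)))
    (fun x => u x * 'D_e phi x) (fun x => M * `|u x|).
  + move=> k; apply: measurable_funM; first exact: L1_meas Lu.
    apply: measurable_funM => //; apply: measurable_funB; last exact: L2_meas Lphi.
    by apply: measurable_shift; exact: L2_meas Lphi.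
  + by apply: measurable_funM => //; exact: L1_meas Lu.
  + apply: aeW => x; apply: cvgM; first exact: cvg_cst.
    apply: difference_quotient_cvg; first exact: diff_derivable.
      by move=> k; rewrite oppr_eq0.
    by rewrite -[X in _ --> X]oppr0; apply: cvgN.
  + by apply: L1Z; exact: L1_norm.
  + move=> k x; rewrite normrM mulrC ler_wpM2r// normrM normfV ler_pdivrMl ?normr_gt0 ?oppr_eq0//.
    rewrite mulrC.
    have := @derive_bounded_lipschitz R (fun r : R => phi (x + r *: e))
      (fun r => 'D_e phi (x + r *: e)) M 0 (- t k).
    by rewrite scale0r addr0 subr0; apply => // r; exact: is_derive_line.
  move=> _ c2.
  have c4 : ip (quotient k) phi @[k --> \oo] --> - Int (fun x => u x * 'D_e phi x).
    by under eq_fun do rewrite E; exact: cvgN.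
  have := cvg_unique _ c4 c1; rewrite /ip => <- //.
  by rewrite opprK.
Unshelve. all: by end_near. Qed.

End weak_gradient.

(** * Existence of the balayage *)

Section fractional_obstacle.
Context {R : realType} {n : nat}.
Local Notation leb := (lebesgue_rV n : {sigma_finite_measure set 'rV[R]_n -> \bar R}).
Local Notation L1 := (L1 leb).
Local Notation L2 := (L2 leb).
Local Notation Int := (Int leb).
Implicit Types (f u v : 'rV[R]_n -> R).

Lemma is_frac_laplacian_gen (al : R) (s : nat -> 'rV[R]_n -> R) u v : 0 < al ->
  approximates s (fun xi => lapsym xi `^ (al / 2)) -> L1 u -> L2 u -> L2 v ->
  L2 (fun xi => lapsym xi `^ (al / 2) * hartley u xi) ->
  cvg2 leb (fun j => gen j.+1%:R (s j) u) v -> is_frac_laplacian al u v.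
Proof.
move=> al0 sa Lu L2u Lv La cv.
have ks j : jump_kernel (s j) by case: (sa j).
apply: (is_frac_laplacian_limit al0 Lu L2u Lv La _ _ cv).
- by move=> j; exact: L1_gen.
- by move=> j; exact: L2_gen.
- rewrite (_ : (fun k => hartley _) = fun k xi => symbol k.+1%:R (s k) xi * hartley u xi).
    exact: symbolM_cvg2 sa _ Lu L2u La.
  by apply/funext => k; rewrite hartley_gen.
Qed.

Lemma sobolev_symbol (al : R) u : 0 < al -> al < 2 -> L1 u -> L2 u ->
  L2 (fun xi => lapsym xi `^ (al / 2) * hartley u xi) -> sobolev al u.
Proof.
move=> al0 al2 Lu L2u La.
have [||s sa] := @fractional_approximates R n (al / 2); [lra|lra|].
have [v Lv cv] := gen_L2_cvg sa Lu L2u La.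
by exists v; exact: is_frac_laplacian_gen cv.
Qed.

Lemma fractional_obstacle (hn : (1 <= n)%N) (al lam : R) f : 0 < al -> al < 2 -> 0 < lam ->
  L1 f -> L2 f -> (forall x, 0 <= f x) ->
  exists u v, [/\ L1 u, L2 u, forall x, 0 <= u x,
      (leb [set x | (0 < u x)%R] <= (Int f / lam)%:E)%E &
      L2 (fun xi => lapsym xi `^ (al / 2) * hartley u xi)] /\
    [/\ L1 v, L2 v, Int v = 0, is_frac_laplacian al u v &
      {ae leb, forall x, 0 <= f x - v x <= lam /\ (0 < u x -> f x - v x = lam)}].
Proof.
move=> al0 al2 lam0 Lf L2f f0.
have b0 : 0 < al / 2 by lra.
have b1 : al / 2 < 1 by lra.
have [s sa] := @fractional_approximates R n (al / 2) b0 b1.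
have ac r : 0 < r -> _ := @lapsym_coercive R n (al / 2) r b0.
have small e : 0 < e -> _ := @lapsym_small R n (al / 2) e b0.
have [w wP] := approximate_balayage hn sa ac Lf L2f f0 lam0.
have [u [Lu L2u u0 um] cu] := odometer_limit hn sa ac Lf L2f f0 lam0 wP.
have La := L2_limit_symbolM sa Lf L2f lam0 wP Lu L2u u0 um cu.
have [v Lv cv] := gen_L2_cvg sa Lu L2u La.
have mu := density_limit sa Lf L2f lam0 wP Lu L2u u0 um cu Lv cv.
have L1mu := density_limit_L1 sa Lf L2f lam0 wP Lu L2u u0 um cu Lv cv.
have L1v : L1 v.
  rewrite (_ : v = fun x => f x - (f x - v x)); first exact: L1B.
  by apply/funext => x; rewrite subKr.
exists u, v; split; split => //.
- exact: (mean_zero sa small Lf L2f lam0 wP Lu L2u u0 um cu L1v Lv cv).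
- exact: is_frac_laplacian_gen cv.
Qed.

End fractional_obstacle.

Theorem theorem1p2 (R : realType) (n : nat) (hn : (1 <= n)%N)
    (f : 'rV[R]_n -> R)
    (fL1 : f \in Lfun (lebesgue_rV n) 1%E)
    (fL2 : f \in Lfun (lebesgue_rV n) 2%:E)
    (f0 : {ae lebesgue_rV n, forall x, 0 <= f x})
    (lambda : R) (lambda0 : 0 < lambda)
    (alpha : R) (alpha0 : 0 < alpha) (alpha2 : alpha < 2) :
  exists mu u : 'rV[R]_n -> R,
    let Omega := [set x | 0 < u x] in
    [/\ [/\ {ae lebesgue_rV n, forall x, 0 <= mu x},
            mu \in Lfun (lebesgue_rV n) 1%E &
            mu \in Lfun (lebesgue_rV n) +oo%E],
        [/\ {ae lebesgue_rV n, forall x, 0 <= u x},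
            sobolev alpha u &
            u \in Lfun (lebesgue_rV n) 1%E],
        exists2 v, is_frac_laplacian alpha u v &
          {ae lebesgue_rV n, forall x, f x = mu x + v x},
        [/\ ('N[lebesgue_rV n]_+oo[EFin \o mu] <= lambda%:E)%E,
            ('N[lebesgue_rV n]_1[EFin \o mu] =
             'N[lebesgue_rV n]_1[EFin \o f])%E,
            {ae lebesgue_rV n, forall x, Omega x -> mu x = lambda} &
            (lebesgue_rV n Omega <=
             (1 / lambda)%:E * 'N[lebesgue_rV n]_1[EFin \o f])%E] &
        1 <= alpha ->
          sobolev 1 u /\
          exists2 g, is_weak_gradient u g &
            {ae lebesgue_rV n, forall x, ~ Omega x -> g x = 0}].
Proof.
pose leb := (lebesgue_rV n : {sigma_finite_measure set 'rV[R]_n -> \bar R}).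
have Lf : L1 leb f by exact/Lfun1_integrable.
have L2f : L2 leb f by exact/Lfun2P.
(* The construction needs nonnegativity at every point; the positive part is a representative of [f]
   that has it. *)
pose fp x := Num.max (f x) 0.
have fpE : {ae leb, forall x, f x = fp x}.
  by apply: filterS f0 => x fx; rewrite /fp; apply/esym/max_idPl.
have fp0 x : 0 <= fp x by rewrite le_max lexx orbT.
have mfp : measurable_fun setT fp by apply: measurable_maxr => //; exact: L1_meas Lf.
have fple x : `|fp x| <= `|f x|.
  by rewrite ger0_norm// ge_max normr_ge0 andbT ler_norm.
have Lfp : L1 leb fp by apply: L1_le mfp fple _; exact: L1_norm.
have L2fp : L2 leb fp by exact: L2_le mfp fple L2f.
have [u [v [[Lu L2u u0 um La] [Lv L2v v0 lap aemu]]]] :=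
  fractional_obstacle hn alpha0 alpha2 lambda0 Lfp L2fp fp0.
pose mu x := fp x - v x.
have Lmu : L1 leb mu by exact: L1B.
have mu0 : {ae leb, forall x, 0 <= mu x} by apply: filterS aemu => x [/andP[]].
have Nmu : ('N[leb]_+oo[EFin \o mu] <= lambda%:E)%E.
  (* The second branch is the default value 0 of the essential supremum norm on a space of measure
     zero. *)
  rewrite unlock /=; case: ifPn => _; last by rewrite lee_fin ltW.
  apply/ess_sup_inf.ess_supP; apply: filterS aemu => x [/andP[h1 h2] _] /=.
  by rewrite lee_fin ger0_norm.
have Nf : ('N[leb]_1[EFin \o f] = (Int leb fp)%:E)%E.
  rewrite Lnorm1 /=; under eq_integral => x _ do rewrite /=.
  rewrite (L1_fin_num (L1_norm Lf)); congr (_%:E); apply: ae_int_eq => //; first exact: L1_norm.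
  by apply: filterS f0 => x fx; rewrite ger0_norm// /fp; apply/esym/max_idPl.
exists mu, u => Omega; split.
- split => //; first exact/Lfun1_integrable.
  rewrite inE; apply/andP; split; first by rewrite inE; exact: L1_meas Lmu.
  by rewrite inE /finite_norm; apply: le_lt_trans Nmu _; rewrite ltry.
- split; first exact: aeW.
    by exists v.
  exact/Lfun1_integrable.
- by exists v => //; apply: filterS fpE => x ->; rewrite /mu subrK.
- split => //.
  + rewrite Nf Lnorm1 /=; under eq_integral => x _ do rewrite /=.
    rewrite (L1_fin_num (L1_norm Lmu)); congr (_%:E).
    rewrite (_ : Int leb fp = Int leb mu); last by rewrite /mu intB// v0 subr0.
    by apply: ae_int_eq => //; [exact: L1_norm|apply: filterS mu0 => x h; rewrite ger0_norm].
  + by apply: filterS aemu => x [].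
  + by rewrite Nf -EFinM mul1r mulrC.
move=> alpha1.
(* For alpha >= 1 the symbol of order 1 is at most 1 plus the symbol of order alpha; low frequencies
   are covered by u in L^2. *)
have Lhalf : L2 leb (fun xi => lapsym xi `^ (1 / 2) * hartley u xi).
  have [L2H _] := hartley_plancherel Lu L2u.
  have h0 : 0 < 1 / 2 :> R by lra.
  have h1 : 1 / 2 < 1 :> R by lra.
  (* Used for the measurability of the symbol, a pointwise limit of continuous-kernel transforms. *)
  have [s sa] := @fractional_approximates R n _ h0 h1.
  have abs g : L2 leb g -> L2 leb (fun x => `|g x|).
    move=> Lg; apply: (L2_le _ _ Lg) => [|x]; last by rewrite normr_id.
    by apply: measurableT_comp => //; exact: L2_meas Lg.
  apply: (L2_le _ _ (L2D (abs _ L2H) (abs _ La))) => [|xi].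
    by apply: measurable_funM; [exact: measurable_limit_symbol sa|exact: L2_meas L2H].
  rewrite [leRHS]ger0_norm ?addr_ge0// !normrM (ger0_norm (powR_ge0 _ _)).
  rewrite (ger0_norm (powR_ge0 _ _)) -[X in X + _]mul1r -mulrDl ler_wpM2r//.
  by apply: lapsym_powR_le => //; lra.
split; first by apply: sobolev_symbol => //; lra.
have /choice[g gP] := partial_derivative Lu L2u u0 Lhalf.
have Lg i : L2 leb (g i) by case: (gP i).
have E i : (fun x => (\row_j g j x) 0 i) = g i by apply/funext => x; rewrite mxE.
exists (fun x => \row_i g i x).
  split; first exact: L2_locally_integrable.
  move=> i; rewrite E; split; first exact: L2_locally_integrable.
  move=> phi tphi; have [_ _ /(_ phi tphi)] := gP i; rewrite /Int => ->.
  by congr (- _); apply: eq_Rintegral => x _; rewrite mxE.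
have z : {ae leb, forall x, forall i, u x = 0 -> g i x = 0}.
  by apply: filter_forall => i; case: (gP i).
apply: filterS z => x gx /negP; rewrite -leNgt => ux.
apply/rowP => i; rewrite !mxE gx//; apply/eqP; rewrite eq_le ux; exact: u0.
Qed.
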